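(* Let $n\ge3$. The curvature conditions $$K^\top\ge K_2^\perp\ge K_1^\perp\ge L>0$$ are preserved under the Ricci flow of $O(2)\times O(n-1)$-invariant metrics on $S^n$. That is, if $(S^n,g(t))_{t\in[\alpha,0)}$ is a Ricci flow of $O(2)\times O(n-1)$-invariant Riemannian metrics and these inequalities hold everywhere on $S^n$ at $t=\alpha$, then they hold everywhere on $S^n$ for all $t\in[\alpha,0)$.
   Context: $O(2)\times O(n-1)\subset O(n+1)$ acts on $S^n\subset\mathbb{R}^2\oplus\mathbb{R}^{n-1}$ in the standard way. The principal part of $S^n$ is identified with $(0,\frac{\pi}{2})\times S^1\times S^{n-2}$ via $(r,\theta,\omega)\mapsto(\cos r\cos\theta,\cos r\sin\theta,\sin(r)\,\omega)$. Every $O(2)\times O(n-1)$-invariant metric on $S^n$ has there the form $g=\chi(r)^2dr^2+\psi(r)^2d\theta^2+\varphi(r)^2g_{S^{n-2}}$, with $g_{S^{n-2}}$ the round metric of radius $1$ and $\chi,\psi,\varphi$ smooth on $[0,\frac{\pi}{2}]$ and positive on $(0,\frac\pi2)$, satisfying: $\chi$ is even and positive at $0$ and $\frac\pi2$; $\psi$ is even and positive at $0$, odd at $\frac\pi2$, with $\psi'(\frac\pi2)=-\chi(\frac\pi2)$; $\varphi$ is odd at $0$, even and positive at $\frac\pi2$, with $\varphi'(0)=\chi(0)$. Write $s(r)=\int_0^r\chi$ and $\partial_s=\chi^{-1}\partial_r$ (all these depend also on $t$ for a time-dependent metric). The quantities $$K^\top=-\frac{\psi_{ss}}{\psi},\quad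 K_1^\perp=-\frac{\varphi_{ss}}{\varphi},\quad K_2^\perp=-\frac{\psi_s\varphi_s}{\psi\varphi},\quad L=\frac{1-\varphi_s^2}{\varphi^2}$$ are sectional curvatures and the eigenvalues of the curvature operator ($L$ being a curvature eigenvalue only if $n\ge4$, but it is defined by this formula for all $n\ge3$). They extend smoothly to the singular orbits $r=0,\frac\pi2$. *)

(* Defs.v *)
From HB Require Import structures.
From mathcomp Require Import all_boot all_order all_algebra.
From mathcomp Require Import all_classical all_reals all_analysis.

Set Implicit Arguments.
Unset Strict Implicit.
Unset Printing Implicit Defensive.

Import Order.TTheory GRing.Theory Num.Theory.
Import numFieldNormedType.Exports.

Local Open Scope classical_set_scope.
Local Open Scope ring_scope.

Section Smooth.
Context {R : realType} {V W : normedModType R}.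

(* For finite-dimensional [V] this is the usual class C^k on an open set [O]:
   all iterated directional derivatives up to order [k] exist and are
   continuous. *)
Fixpoint Ck (k : nat) (O : set V) (f : V -> W) : Prop :=
  (forall x, O x -> {for x, continuous f}) /\
  if k is k'.+1 then
    forall v : V, (forall x, O x -> derivable f x v) /\ Ck k' O ('D_v f)
  else True.

(* Smoothness on a not necessarily open set [A] means that [f] extends locally
   to a smooth map; this is used for time intervals closed on the left. *)
Definition smooth_on (A : set V) (f : V -> W) : Prop :=
  forall x, A x -> exists (O : set V) (h : V -> W),
    [/\ open O, O x, forall k, Ck k O h & forall y, O y -> A y -> f y = h y].

End Smooth.

Section Coordinates.
Context {R : realType} {n : nat}.
Implicit Types (h : 'rV[R]_n -> 'M[R]_n) (x : 'rV[R]_n) (i j k l : 'I_n).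

Definition partial i (f : 'rV[R]_n -> R^o) : 'rV[R]_n -> R :=
  'D_(delta_mx 0 i : 'rV[R]_n) f.

(* Gamma^k_{ij} *)
Definition christoffel h k i j x : R :=
  2^-1 * \sum_l invmx (h x) k l *
    (partial i (fun y => h y j l) x + partial j (fun y => h y i l) x
     - partial l (fun y => h y i j) x).

(* Sign convention: the unit sphere S^n has Ric = (n - 1) g. *)
Definition ricci h x : 'M[R]_n :=
  \matrix_(i, j)
    (\sum_k partial k (christoffel h k i j) x
     - \sum_k partial j (christoffel h k i k) x
     + \sum_k \sum_l christoffel h k k l x * christoffel h l i j x
     - \sum_k \sum_l christoffel h k j l x * christoffel h l i k x).

End Coordinates.

(* [S^n] is the unit sphere of [R^2 (+) R^(n-1)], with points written as row
   vectors; the index [2 + n.-1] equals [n + 1] as soon as [0 < n]. *)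

Notation ambient R n := ('rV[R]_(2 + n.-1)).

Section Sphere.
Context {R : realType} {n : nat}.

Definition sphere : set (ambient R n) := [set p | p *m p^T = 1%:M].

Definition tangent (p : ambient R n) : set (ambient R n) :=
  [set u | u *m p^T = 0].

(* A field of bilinear forms on [S^n] is given by a matrix at each point; only
   its values on [sphere] and on pairs of tangent vectors are meaningful. *)
Definition tensor2 := ambient R n -> 'M[R]_(2 + n.-1).

Definition inner (g : tensor2) (p u v : ambient R n) : R :=
  (u *m g p *m v^T) 0 0.

Definition frame (F : 'rV[R]_n -> ambient R n) (x : 'rV[R]_n) :
    'M[R]_(n, 2 + n.-1) :=
  \matrix_i 'D_(delta_mx 0 i : 'rV[R]_n) F x.

(* Inverses of coordinate charts. Injectivity of [F] is not required: [F] is a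
   local diffeomorphism, and everything below is local in [x]. *)
Definition local_parametrization
    (U : set 'rV[R]_n) (F : 'rV[R]_n -> ambient R n) : Prop :=
  [/\ open U, smooth_on U F, forall x, U x -> sphere (F x)
    & forall x, U x -> row_free (frame F x)].

(* The matrix (g_ij) in the coordinates given by [F]. *)
Definition metric_coord (g : tensor2) (F : 'rV[R]_n -> ambient R n)
    (x : 'rV[R]_n) : 'M[R]_n :=
  frame F x *m g (F x) *m (frame F x)^T.

Definition riemannian_metric (g : tensor2) : Prop :=
  [/\ forall p u v, sphere p -> tangent p u -> tangent p v ->
        inner g p u v = inner g p v u,
      forall p u, sphere p -> tangent p u -> u != 0 -> 0 < inner g p u u
    & forall U F, local_parametrization U F -> smooth_on U (metric_coord g F)].

(* Smooth families of metrics with d/dt g = - 2 Ric on [I], in all local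
   coordinates. The time derivative is taken within [I], hence is one-sided at
   an endpoint of [I]. *)
Definition ricci_flow (I : set R) (g : R -> tensor2) : Prop :=
  [/\ forall t, I t -> riemannian_metric (g t),
      forall U F, local_parametrization U F ->
        smooth_on (I `*` U)
          (fun z : R^o * 'rV[R]_n => metric_coord (g z.1) F z.2)
    & forall U F, local_parametrization U F ->
        forall t x, I t -> U x ->
        (s - t)^-1 *: (metric_coord (g s) F x - metric_coord (g t) F x)
          @[s --> within I t^'] --> - (2 *: ricci (metric_coord (g t) F) x)].

Definition orthogonal_mx m (A : 'M[R]_m) : Prop := A *m A^T = 1%:M.

Definition invariant_metric (g : tensor2) : Prop :=
  forall (P : 'M[R]_2) (Q : 'M[R]_(n.-1)),
    orthogonal_mx P -> orthogonal_mx Q ->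
    let A := block_mx P 0 0 Q in
    forall p u v, sphere p -> tangent p u -> tangent p v ->
      inner g (p *m A) (u *m A) (v *m A) = inner g p u v.

Definition polar (r theta : R) (omega : 'rV[R]_(n.-1)) : ambient R n :=
  row_mx (\row_(j < 2) (cos r * (if j == 0 then cos theta else sin theta)))
         (sin r *: omega).

Definition unit_vec (k : nat) : 'rV[R]_(n.-1) := \row_j (j == k :> nat)%:R.

Definition norm_g (g : tensor2) (p u : ambient R n) : R :=
  Num.sqrt (inner g p u u).

(* For an invariant metric
     g = chi(r)^2 dr^2 + psi(r)^2 dtheta^2 + phi(r)^2 g_{S^(n-2)},
   so chi, psi and phi are the lengths of the r- and theta-coordinate fields
   and of a unit tangent vector of S^(n-2), here measured at the points with
   theta = 0 and omega = e_0. *)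
Definition base_point (r : R) : ambient R n := polar r 0 (unit_vec 0).

Definition chi (g : tensor2) (r : R) : R :=
  norm_g g (base_point r) (derive1 (fun r' : R => polar r' 0 (unit_vec 0)) r).

Definition psi (g : tensor2) (r : R) : R :=
  norm_g g (base_point r) (derive1 (fun theta : R => polar r theta (unit_vec 0)) 0).

Definition phi (g : tensor2) (r : R) : R :=
  norm_g g (base_point r)
    (derive1
       (fun a : R => polar r 0 (cos a *: unit_vec 0 + sin a *: unit_vec 1)) 0).

(* d/ds, where ds = chi dr *)
Definition ds (g : tensor2) (f : R -> R) (r : R) : R :=
  derive1 (f : R -> R^o) r / chi g r.

(* Value at [r] in [0, pi/2] of the continuous extension of a function given
   on ]0, pi/2[. *)
Definition extend (f : R -> R) (r : R) : R :=
  if 0 < r < pi / 2 then f r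
  else lim (f x @[x --> within [set x | 0 < x < pi / 2] (nbhs r)]).

Definition K_top (g : tensor2) : R -> R :=
  extend (fun r => - (ds g (ds g (psi g)) r / psi g r)).

Definition K1_perp (g : tensor2) : R -> R :=
  extend (fun r => - (ds g (ds g (phi g)) r / phi g r)).

Definition K2_perp (g : tensor2) : R -> R :=
  extend (fun r =>
    - ((ds g (psi g) r * ds g (phi g) r) / (psi g r * phi g r))).

Definition L_curv (g : tensor2) : R -> R :=
  extend (fun r => (1 - ds g (phi g) r ^+ 2) / phi g r ^+ 2).

Definition curvature_conditions (g : tensor2) : Prop :=
  forall r : R, 0 <= r <= pi / 2 ->
    [/\ K2_perp g r <= K_top g r, K1_perp g r <= K2_perp g r,
        L_curv g r <= K1_perp g r & 0 < L_curv g r].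

End Sphere.

Arguments tensor2 : clear implicits.

(* Main.v *)
Require Import Defs.
From mathcomp Require Import all_boot all_order all_algebra.
From mathcomp Require Import all_classical all_reals all_analysis.
From mathcomp Require Import ring lra.

(** Write [m = n - 2] and let [s] be the arc length of a geodesic orthogonal to the
    orbits. On the open interval of [r] the flow of invariant metrics is the system
      [chi_t = - chi (A + m C)], [psi_t = - psi (A + m B)],
      [phi_t = - phi (C + B + (m - 1) D)]
    for the three profiles, where [A], [B], [C], [D] are [K^top], [K_2^perp],
    [K_1^perp], [L]. Commuting the time derivative with that in [s] gives
    reaction-diffusion equations for the four curvatures.

    Part of the differences [A - B], [B - C], [C - D] has to vanish at each singular
    orbit, so their signs are not open conditions there. The quotients
      [X = (A - B) / phi^2], [Y = (B - C) / psi^2], [Z = (C - D) / phi^2]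
    do not have this defect. They remain bounded up to the singular orbits, because
    the profiles are even or odd there ([collapse]), and they satisfy equations with
    bounded reaction terms ([evolution_Xh], [evolution_Yh], [evolution_Zh]). The
    terms that couple [X], [Y], [Z] have nonnegative coefficients when [B] is
    nonnegative, and [B = D + psi^2 Y + phi^2 Z]. Hence [X, Y, Z >= 0] and
    [D >= delta > 0] persist by the maximum principle for systems ([positivity]).

    The drift terms of these equations blow up at the singular orbits. The function
    [w = - ln phi - ln psi] is a supersolution of the heat equation that is infinite
    at both of them, and the drift terms act on it by [4 q^2 - 4 B] and
    [4 p^2 - 4 B], which are bounded below. Adding [eps exp (K t) (w + c)] to the
    four quantities therefore forces a first zero to lie on a compact part of the
    open interval ([first_touching_time]), where the derivatives at a minimum give
    a contradiction; then [eps] tends to zero. At the singular orbits themselves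
    the inequalities follow by passing to the limit ([curvature_order_preserved]).

    The passage from the metric to its profiles rests on reflections. They show that
    the metric is diagonal along the geodesic from [(1, 0)] to the first unit vector
    of the other factor and even at both ends ([inner_flip],
    [radial_form_opp], [radial_form_refl]). A stereographic chart around this
    geodesic, which crosses the singular orbits, gives the smoothness of the profiles
    there ([Crinf_metric_coord]). In polar coordinates, with stereographic
    coordinates on the sphere, the metric is diagonal on an open set, and the Ricci
    tensor is computed at one point of each orbit ([ricci_warped]). *)

Set Implicit Arguments.
Unset Strict Implicit.
Unset Printing Implicit Defensive.

Import Order.TTheory GRing.Theory Num.Theory.
Import numFieldNormedType.Exports.

Local Open Scope classical_set_scope.
Local Open Scope ring_scope.

(** * Differentiation in one variable and along a direction *)

Section DirectionalDerivative.
Context {R : realType} {V : normedModType R}.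
Implicit Types (f g : V -> R) (x v : V) (a b : R).

Lemma isD_eq f x v a b : is_derive x v f a -> a = b -> is_derive x v f b.
Proof. by move=> ? <-. Qed.

Lemma isD_add f g x v a b : is_derive x v f a -> is_derive x v g b ->
  is_derive x v (fun y => f y + g y) (a + b).
Proof. exact: is_deriveD. Qed.

Lemma isD_opp f x v a : is_derive x v f a -> is_derive x v (fun y => - f y) (- a).
Proof. exact: is_deriveN. Qed.

Lemma isD_sub f g x v a b : is_derive x v f a -> is_derive x v g b ->
  is_derive x v (fun y => f y - g y) (a - b).
Proof. exact: is_deriveB. Qed.

Lemma isD_mul f g x v a b : is_derive x v f a -> is_derive x v g b ->
  is_derive x v (fun y => f y * g y) (a * g x + f x * b).
Proof.
move=> fa gb; apply: isD_eq (is_deriveM fa gb) _.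
by rewrite /GRing.scale/= addrC mulrC.
Qed.

Lemma isD_inv f x v a : f x != 0 -> is_derive x v f a ->
  is_derive x v (fun y => (f y)^-1) (- a / f x ^+ 2).
Proof.
move=> fx0 fa; have df : derivable f x v by [].
split; first exact: derivableV.
rewrite deriveV// derive_val /GRing.scale/= mulNr -exprVn exprVn; field.
exact: fx0.
Qed.

End DirectionalDerivative.

Section OneVariable.
Context {R : realType}.
Implicit Types (f g : R -> R) (x a b : R).

Lemma isD_ext f g x a : f =1 g -> is_derive x 1 g a -> is_derive x (1 : R) f a.
Proof. by move=> /funext ->. Qed.

Lemma isD_cst x (c : R) : is_derive x (1 : R) (fun=> c) 0.
Proof. exact: is_derive_cst. Qed.

Lemma isD_id x : is_derive x (1 : R) (fun y => y) 1.
Proof. exact: is_derive_id. Qed.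

Lemma isD_div f g x a b : g x != 0 -> is_derive x 1 f a -> is_derive x 1 g b ->
  is_derive x (1 : R) (fun y => f y / g y) ((a * g x - f x * b) / g x ^+ 2).
Proof.
move=> gx0 fa gb; apply: isD_eq (isD_mul fa (isD_inv gx0 gb)) _.
by field.
Qed.

Lemma isD_exp f x a k : is_derive x 1 f a ->
  is_derive x (1 : R) (fun y => f y ^+ k) (k%:R * f x ^+ k.-1 * a).
Proof.
move=> fa; elim: k => [|k IH].
  by rewrite mul0r mul0r; apply: isD_ext (isD_cst x 1) => y; rewrite expr0.
apply: (@isD_ext _ (fun y => f y * f y ^+ k)); first by move=> y; rewrite exprS.
apply: isD_eq (isD_mul fa IH) _; case: k {IH} => [|k]; first by rewrite !mul0r expr0; ring.
by rewrite /= -natr1 exprS; ring.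
Qed.

Lemma isD_comp f g x a b : is_derive x 1 f a -> is_derive (f x) 1 g b ->
  is_derive x (1 : R) (fun y => g (f y)) (b * a).
Proof. by move=> fa gb; apply: is_derive1_comp. Qed.

Lemma isD_sqrt f x a : 0 < f x -> is_derive x 1 f a ->
  is_derive x (1 : R) (fun y => Num.sqrt (f y)) (a / (2 * Num.sqrt (f x))).
Proof.
move=> fx0 fa; apply: isD_eq (isD_comp fa (is_derive1_sqrt fx0)) _.
by rewrite mulrC.
Qed.

Lemma isD_ln f x a : 0 < f x -> is_derive x 1 f a ->
  is_derive x (1 : R) (fun y => ln (f y)) (a / f x).
Proof.
move=> fx0 fa; apply: isD_eq (isD_comp fa (is_derive1_ln fx0)) _.
by rewrite mulrC.
Qed.

Lemma isD_sin x : is_derive x (1 : R) sin (cos x).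
Proof. exact: is_derive_sin. Qed.

Lemma isD_cos x : is_derive x (1 : R) cos (- sin x).
Proof. exact: is_derive_cos. Qed.

Lemma isD_derivable f x a : is_derive x (1 : R) f a -> derivable f x 1.
Proof. by move=> []. Qed.

Lemma derivable_isD f x : derivable f x 1 -> is_derive x (1 : R) f (derive1 f x).
Proof. by move=> fx; rewrite derive1E; exact: derivableP. Qed.

Lemma isD_derive1 f x a : is_derive x (1 : R) f a -> derive1 f x = a.
Proof. by move=> fa; rewrite derive1E derive_val. Qed.

Lemma isD_near f g x a : (\forall y \near x, f y = g y) ->
  is_derive x 1 g a -> is_derive x (1 : R) f a.
Proof.
move=> fg ga; apply: (near_eq_is_derive _ ga).
by near do apply/esym.
Unshelve. all: by end_near. Qed.

Lemma isD_cont f x a : is_derive x (1 : R) f a -> {for x, continuous f}.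
Proof. by move=> [? _]; apply: differentiable_continuous; exact/derivable1_diffP. Qed.

Lemma isD_uniq f x a b : is_derive x (1 : R) f a -> is_derive x 1 f b -> a = b.
Proof. by move=> [_ <-] [_ <-]. Qed.

End OneVariable.

(** * Mean values and minima *)

Section MeanValues.
Context {R : realType}.
Implicit Types (f g df : R -> R) (x a b : R).

(** The form in which derivatives are estimated: no division by [h], and no
    exception at [h = 0]. *)
Lemma isDP f x a : is_derive x 1 f a <->
  forall e, 0 < e -> exists2 d, 0 < d &
    forall h, `|h| < d -> `|f (x + h) - f x - a * h| <= e * `|h|.
Proof.
have cvgP' : ((fun h => h^-1 *: (f (h *: 1 + x) - f x)) @ 0^' --> a) <->
    forall e, 0 < e -> exists2 d, 0 < d &
      forall h, `|h| < d -> `|f (x + h) - f x - a * h| <= e * `|h|.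
  split=> [/cvgrPdist_le H e e0|H].
    have := H _ e0; rewrite near_withinE => /nbhs_ballP[d /= d0 dH].
    exists d => // h hd; have [->|h0] := eqVneq h 0.
      by rewrite addr0 subrr mulr0 subr0 !normr0 mulr0.
    have /= := dH h; rewrite /ball/= sub0r normrN => /(_ hd h0).
    rewrite -[X in X <= _]normrN opprB -(ler_pM2r (x := `|h|)) ?normr_gt0//.
    rewrite -normrM mulrBl /GRing.scale/= mulr1 [h + x]addrC mulrAC mulVf// mul1r.
    by [].
  apply/cvgrPdist_le => e e0; have [d d0 dH] := H _ e0.
  rewrite near_withinE; apply/nbhs_ballP; exists d => //= h.
  rewrite /ball/= sub0r normrN => hd h0.
  rewrite -[X in X <= _]normrN opprB -(ler_pM2r (x := `|h|)) ?normr_gt0//.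
  rewrite -normrM mulrBl /GRing.scale/= mulr1 [h + x]addrC mulrAC mulVf// mul1r.
  exact: dH.
rewrite -cvgP'; split.
  by move=> [fx <-]; exact: fx.
move=> H; split; first by apply/cvg_ex; exists a.
exact: cvg_lim H.
Qed.

(** Stated for [a] and [b] in either order, since increments on both sides of
    a base point are compared below. *)
Lemma mean_value f df a b :
  (forall x, Num.min a b <= x <= Num.max a b -> is_derive x 1 f (df x)) ->
  exists2 c, Num.min a b <= c <= Num.max a b & f b - f a = df c * (b - a).
Proof.
wlog ab : a b / a < b => [H|] fdf.
  have [ab|ba|<-] : [\/ a < b, b < a | a = b]
      by case: (ltgtP a b); [constructor 1|constructor 2|constructor 3].
    exact: H.
    have [|c cab cE] := H b a ba; first by rewrite minC maxC.
    exists c; first by rewrite minC maxC.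
    by rewrite -opprB cE; ring.
  exists a; last by rewrite !subrr mulr0.
  by rewrite minxx maxxx lexx.
have mE : Num.min a b = a by apply/min_idPl/ltW.
have ME : Num.max a b = b by apply/max_idPr/ltW.
rewrite mE ME in fdf *.
have [x xab||c cab cE] := @MVT R f df a b ab.
- by apply: fdf; rewrite !ltW// (itvP xab).
- apply: continuous_in_subspaceT => x; rewrite inE/= in_itv/= => /fdf.
  exact: isD_cont.
- by exists c => //; rewrite !ltW// (itvP cab).
Qed.

Lemma isD_close f x a c e : 0 <= e -> is_derive x 1 f a ->
  (exists2 d, 0 < d & forall h, `|h| < d ->
     `|f (x + h) - f x - c * h| <= e * `|h|) ->
  `|a - c| <= e.
Proof.
move=> e0 /isDP fa [d d0 dH]; apply/ler_addgt0Pr => k k0.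
have [d' d'0 dH'] := fa _ k0.
pose h := Num.min d d' / 2.
have m0 : 0 < Num.min d d' by rewrite lt_min d0.
have h0 : 0 < h by rewrite divr_gt0.
have hm : h < Num.min d d' by rewrite /h ltr_pdivrMr// ltr_pMr// ltr1n.
have [hd hd'] : h < d /\ h < d' by move: hm; rewrite lt_min => /andP.
have := dH h; have := dH' h; rewrite gtr0_norm// => /(_ hd') H1 /(_ hd) H2.
rewrite -(ler_pM2r h0) -[X in _ * X <= _](gtr0_norm h0) -normrM.
have -> : (a - c) * h = (f (x + h) - f x - c * h) - (f (x + h) - f x - a * h).
  by ring.
by rewrite mulrDl (le_trans (ler_normB _ _))// lerD.
Qed.

(** The derivative of [f] is given as [df * w] because it will be known in terms
    of the arc length derivative [df]. If [a] were negative, [df] would be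
    negative just to the right of [x], and the mean value theorem would give a
    smaller value of [f] there. *)
Lemma min_second_derivative f df (w : R -> R) x a :
  (\forall y \near x, 0 < w y) ->
  (\forall y \near x, is_derive (y : R) 1 f (df y * w y)) ->
  is_derive x 1 df a -> (\forall y \near x, f x <= f y) ->
  df x = 0 /\ 0 <= a.
Proof.
move=> nw nf dfa /nbhs_ballP[d2 /= d20 fmin].
have [d1 /= d10 H1] := (nbhs_ballP _ _).1 (filterI nw nf).
have w0 y : ball x d1 y -> 0 < w y by move=> /H1[].
have fdf y : ball x d1 y -> is_derive y 1 f (df y * w y) by move=> /H1[].
pose d := Num.min d1 d2; have d0 : 0 < d by rewrite lt_min d10.
have dd1 y : `|x - y| < d -> ball x d1 y.
  by rewrite lt_min => /andP[].
have dd2 y : `|x - y| < d -> f x <= f y.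
  by rewrite lt_min => /andP[_ H]; apply: fmin.
have df0 : df x = 0.
  apply/eqP; have /eqP : df x * w x = 0; last first.
    by rewrite mulf_eq0 (gt_eqF (w0 x _)) ?orbF//; exact: ballxx.
  have xd y : y \in `]x - d, x + d[%R -> `|x - y| < d.
    by move=> yx; rewrite ltr_distlC ?(itvP yx).
  have xx : x \in `]x - d, x + d[%R by rewrite in_itv/= ltrBlDr ltrDl d0.
  have fx : is_derive x 1 f (df x * w x) by apply: fdf; apply: dd1; exact: xd.
  apply: isD_uniq fx _; apply: (@derive1_at_min _ f (x - d) (x + d)) => //.
  - by rewrite lerBlDr -addrA lerDl addr_ge0// ltW.
  - by move=> y /xd/dd1/fdf[].
  - by move=> y /xd/dd2.
split=> //; rewrite leNgt; apply/negP => a0.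
have [|d' d'0 H] := (isDP df x a).1 dfa (- a / 2); first by rewrite divr_gt0// oppr_gt0.
have dneg c : x < c -> c - x < d' -> df c < 0.
  move=> xc cd; have c0 : 0 < c - x by rewrite subr_gt0.
  have := H (c - x); rewrite gtr0_norm// => /(_ cd).
  rewrite (_ : x + (c - x) = c); last by ring.
  rewrite df0 subr0 ler_norml => /andP[_].
  have : a * (c - x) < 0 by rewrite pmulr_llt0.
  by set P := a * _; rewrite mulrAC mulNr -/P; lra.
pose h := Num.min d d' / 2.
have m0 : 0 < Num.min d d' by rewrite lt_min d0.
have h0 : 0 < h by rewrite divr_gt0.
have hm : h < Num.min d d' by rewrite /h ltr_pdivrMr// ltr_pMr// ltr1n.
have [hd hd'] : h < d /\ h < d' by move: hm; rewrite lt_min => /andP.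
have xh : x < x + h by rewrite ltrDl.
have fd y : x <= y <= x + h -> is_derive y 1 f (df y * w y).
  move=> /andP[xy yh]; apply/fdf/dd1; rewrite distrC ger0_norm ?subr_ge0//.
  by rewrite (le_lt_trans _ hd)// lerBlDl.
have [y||c] := @MVT _ f (fun y => df y * w y) x (x + h) xh.
- by move=> yx; apply: fd; rewrite !ltW// (itvP yx).
- apply: continuous_in_subspaceT => y; rewrite inE/= in_itv/= => /fd.
  exact: isD_cont.
rewrite in_itv/= => /andP[xc ch] cE.
have : f x <= f (x + h) by apply: dd2; rewrite opprD addNKr normrN gtr0_norm.
have wc : 0 < w c.
  apply/w0/dd1; rewrite distrC gtr0_norm ?subr_gt0// (lt_trans _ hd)//; lra.
rewrite -subr_ge0 cE addrAC subrr add0r pmulr_lge0// pmulr_lge0//.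
rewrite leNgt dneg// (lt_trans _ hd')//; lra.
Qed.
End MeanValues.

(** * Symmetry of mixed derivatives *)

Section Strip.
Context {R : realType}.
Implicit Types (f g : R -> R -> R) (t r : R) (I J : set R).

Lemma near_box (P : R * R -> Prop) t r : (\forall z \near (t, r), P z) ->
  exists2 d : R, 0 < d & forall s x, `|s - t| < d -> `|x - r| < d -> P (s, x).
Proof.
case=> -[A B] /= [/nbhs_ballP[a /= a0 aA] /nbhs_ballP[b /= b0 bB]] AB.
exists (Num.min a b) => [|s x]; first by rewrite lt_min a0.
rewrite !lt_min => /andP[sa _] /andP[_ xb]; apply: AB; split => /=.
  by apply: aA; rewrite /ball/= distrC.
by apply: bB; rewrite /ball/= distrC.
Qed.

(** Peano's form of the symmetry of mixed derivatives: the second difference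
    of [f] over a box is, by the mean value theorem used first in time and
    then in space, a value of [Gr] times the area of the box. *)
Lemma mixed_derivative f (G fr Gr : R -> R -> R) t r :
  (\forall z \near (t, r), is_derive (z.1 : R) 1 (f ^~ z.2) (G z.1 z.2)) ->
  (\forall z \near (t, r), is_derive (z.2 : R) 1 (f z.1) (fr z.1 z.2)) ->
  (\forall z \near (t, r), is_derive (z.2 : R) 1 (G z.1) (Gr z.1 z.2)) ->
  Gr z.1 z.2 @[z --> (t, r)] --> Gr t r ->
  is_derive t 1 (fr ^~ r) (Gr t r).
Proof.
move=> fG ffr GGr cGr; apply/isDP => e e0.
have /cvgrPdist_le/(_ _ e0) cG := cGr.
have [d d0 H] : exists2 d : R, 0 < d & forall s x, `|s - t| < d -> `|x - r| < d ->
    [/\ is_derive s 1 (f ^~ x) (G s x), is_derive x 1 (f s) (fr s x),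
        is_derive x 1 (G s) (Gr s x) & `|Gr t r - Gr s x| <= e].
  have [d d0 H] := near_box (filterI (filterI fG ffr) (filterI GGr cG)).
  by exists d => // s x sd xd; have [[? ?] [? ?]] := H s x sd xd; split.
exists d => // h hd.
have mid (a k c : R) : Num.min a (a + k) <= c <= Num.max a (a + k) -> `|c - a| <= `|k|.
  have [k0|k0] := leP 0 k.
    rewrite min_l ?lerDl// max_r ?lerDl// => /andP[y1 y2].
    by rewrite !ger0_norm ?subr_ge0// lerBlDl.
  have ak : a + k <= a by lra.
  rewrite (min_r ak) (max_l ak) => /andP[y1 y2].
  by rewrite (ler0_norm (ltW k0)) ler0_norm ?subr_le0//; lra.
have td : `|t - t| < d by rewrite subrr normr0.
have rd : `|r - r| < d by rewrite subrr normr0.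
have thd : `|t + h - t| < d by rewrite addrAC subrr add0r.
have [_ D1 _ _] := H _ _ thd rd; have [_ D2 _ _] := H _ _ td rd.
apply: (isD_close _ (isD_sub D1 D2)); first by rewrite mulr_ge0// ltW.
exists d => //= k kd.
have rkd : `|r + k - r| < d by rewrite addrAC subrr add0r.
have [|s /mid sh] := @mean_value _ (fun s => f s (r + k) - f s r)
    (fun s => G s (r + k) - G s r) t (t + h).
  move=> s /mid sh; have sd := le_lt_trans sh hd.
  have [A1 _ _ _] := H _ _ sd rkd; have [A2 _ _ _] := H _ _ sd rd.
  exact: isD_sub A1 A2.
have sd := le_lt_trans sh hd.
have [|x /mid xk ->] := @mean_value _ (G s) (Gr s) r (r + k).
  by move=> x /mid xk; have [] := H _ _ sd (le_lt_trans xk kd).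
have [_ _ _ Gsx] := H _ _ sd (le_lt_trans xk kd).
have -> : f (t + h) (r + k) - f t (r + k) - (f (t + h) r - f t r) =
  f (t + h) (r + k) - f (t + h) r - (f t (r + k) - f t r) by ring.
move=> ->.
have -> : Gr s x * (r + k - r) * (t + h - t) - Gr t r * h * k =
  - ((Gr t r - Gr s x) * h * k) by ring.
by rewrite normrN !normrM -!mulrA ler_wpM2r// mulr_ge0.
Qed.
End Strip.

(** * Functions smooth in the space variable *)

Section StripClass.
Context {R : realType}.
Implicit Types (f g : R -> R -> R) (t r : R).

Definition dr f : R -> R -> R := fun t r => derive1 (f t) r.

Definition cts (I J : set R) f : Prop := forall t r, I t -> J r ->
  f z.1 z.2 @[z --> within (I `*` J) (nbhs (t, r))] --> f t r.

(** Functions of [(t, r)] with jointly continuous [r]-derivatives up to order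
    [k]; no regularity in [t] is recorded beyond continuity, because time
    derivatives will all be computed from the flow equation. *)
Fixpoint Crk (I J : set R) (k : nat) f : Prop :=
  cts I J f /\
  if k is k'.+1 then
    (forall t r, I t -> J r -> derivable (f t) r 1) /\ Crk I J k' (dr f)
  else True.

Definition Crinf I J f : Prop := forall k, Crk I J k f.

Variables I J : set R.
Hypothesis openJ : open J.

Lemma cts_ext f g : (forall t r, I t -> J r -> f t r = g t r) ->
  cts I J f -> cts I J g.
Proof.
move=> fg cf t r It Jr; rewrite -fg//; apply: cvg_trans (cf t r It Jr).
apply: near_eq_cvg; rewrite near_withinE; apply: nearW => -[s x] [/= Is Jx].
exact: fg.
Qed.

Lemma cts_cst (c : R) : cts I J (fun _ _ => c).
Proof. by move=> t r _ _; exact: cvg_cst. Qed.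

Lemma cts_add f g : cts I J f -> cts I J g -> cts I J (fun t r => f t r + g t r).
Proof. by move=> cf cg t r It Jr; apply: cvgD; [exact: cf|exact: cg]. Qed.

Lemma cts_mul f g : cts I J f -> cts I J g -> cts I J (fun t r => f t r * g t r).
Proof. by move=> cf cg t r It Jr; apply: cvgM; [exact: cf|exact: cg]. Qed.

Lemma cts_inv f : (forall t r, I t -> J r -> f t r != 0) -> cts I J f ->
  cts I J (fun t r => (f t r)^-1).
Proof. by move=> f0 cf t r It Jr; apply: cvgV; [exact: f0|exact: cf]. Qed.

Lemma cts_comp f (h : R -> R) :
  (forall t r, I t -> J r -> {for f t r, continuous h}) -> cts I J f ->
  cts I J (fun t r => h (f t r)).
Proof.
by move=> hc cf t r It Jr; apply: (cvg_comp _ _ (cf t r It Jr)); exact: hc.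
Qed.

Lemma cts_space (h : R -> R) : (forall r, J r -> {for r, continuous h}) ->
  cts I J (fun _ r => h r).
Proof.
move=> hc t r It Jr; apply: (@cvg_comp _ _ _ snd h _ (nbhs r)); last exact: hc.
by apply: cvg_trans (@cvg_snd _ _ (nbhs t) (nbhs r) _); apply: cvg_app; exact: cvg_within.
Qed.

Lemma cts_time (h : R -> R) : (forall t, I t -> {for t, continuous h}) ->
  cts I J (fun t _ => h t).
Proof.
move=> hc t r It Jr; apply: (@cvg_comp _ _ _ fst h _ (nbhs t)); last exact: hc.
by apply: cvg_trans (@cvg_fst _ _ (nbhs t) (nbhs r) _); apply: cvg_app; exact: cvg_within.
Qed.

Lemma Crk_cts k f : Crk I J k f -> cts I J f.
Proof. by case: k => [|k] []. Qed.

Lemma Crk_ext k f g : (forall t r, I t -> J r -> f t r = g t r) ->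
  Crk I J k f -> Crk I J k g.
Proof.
elim: k f g => [|k IH] f g fg [cf H]; split=> //; try exact: cts_ext cf.
have [df Cf] := H.
have near_fg t r : I t -> J r -> \forall x \near r, g t x = f t x.
  move=> It Jr; have : nbhs r J by apply: open_nbhs_nbhs.
  by apply: filterS => x Jx; rewrite fg.
have D t r (It : I t) (Jr : J r) :=
  isD_near (near_fg t r It Jr) (derivable_isD (df t r It Jr)).
split=> [t r It Jr|]; first exact: isD_derivable (D t r It Jr).
by apply: IH Cf => t r It Jr; rewrite /dr (isD_derive1 (D t r It Jr)).
Qed.

Lemma Crk_intro k f g : cts I J f ->
  (forall t r, I t -> J r -> is_derive r 1 (f t) (g t r)) ->
  Crk I J k g -> Crk I J k.+1 f.
Proof.
move=> cf fg Cg; split=> //; split=> [t r It Jr|].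
  exact: isD_derivable (fg t r It Jr).
by apply: Crk_ext Cg => t r It Jr; rewrite /dr (isD_derive1 (fg t r It Jr)).
Qed.

Lemma Crk_isD k f : Crk I J k.+1 f ->
  forall t r, I t -> J r -> is_derive r 1 (f t) (dr f t r).
Proof. by move=> [_ [df _]] t r It Jr; apply: derivable_isD; exact: df. Qed.

Lemma Crk_dr k f : Crk I J k.+1 f -> Crk I J k (dr f).
Proof. by move=> [_ []]. Qed.

Lemma Crk_pred k f : Crk I J k.+1 f -> Crk I J k f.
Proof.
by elim: k f => [|k IH] f [cf [df Cf]]; split=> //; split=> //; exact: IH.
Qed.

Lemma Crk_cst k (c : R) : Crk I J k (fun _ _ => c).
Proof.
elim: k c => [|k IH] c; first by split=> //; exact: cts_cst.
by apply: (@Crk_intro _ _ (fun _ _ => 0)) => //; exact: cts_cst.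
Qed.

Lemma Crk_add k f g : Crk I J k f -> Crk I J k g ->
  Crk I J k (fun t r => f t r + g t r).
Proof.
elim: k f g => [|k IH] f g Cf Cg.
  by split=> //; apply: cts_add; [exact: Crk_cts Cf|exact: Crk_cts Cg].
apply: Crk_intro; first by apply: cts_add; [exact: Crk_cts Cf|exact: Crk_cts Cg].
  by move=> t r It Jr; exact: isD_add (Crk_isD Cf It Jr) (Crk_isD Cg It Jr).
exact: IH (Crk_dr Cf) (Crk_dr Cg).
Qed.

Lemma Crk_mul k f g : Crk I J k f -> Crk I J k g ->
  Crk I J k (fun t r => f t r * g t r).
Proof.
elim: k f g => [|k IH] f g Cf Cg.
  by split=> //; apply: cts_mul; [exact: Crk_cts Cf|exact: Crk_cts Cg].
apply: Crk_intro; first by apply: cts_mul; [exact: Crk_cts Cf|exact: Crk_cts Cg].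
  by move=> t r It Jr; exact: isD_mul (Crk_isD Cf It Jr) (Crk_isD Cg It Jr).
by apply: Crk_add; apply: IH; by [exact: Crk_dr|exact: Crk_pred].
Qed.

Lemma Crk_opp k f : Crk I J k f -> Crk I J k (fun t r => - f t r).
Proof.
move=> Cf; apply: Crk_ext (Crk_mul (Crk_cst k (-1)) Cf) => t r _ _.
by rewrite mulN1r.
Qed.

Lemma Crk_inv k f : (forall t r, I t -> J r -> f t r != 0) -> Crk I J k f ->
  Crk I J k (fun t r => (f t r)^-1).
Proof.
move=> f0; elim: k => [|k IH] Cf.
  by split=> //; apply: cts_inv => //; exact: Crk_cts Cf.
apply: (@Crk_intro _ _ (fun t r => - (dr f t r * ((f t r)^-1 * (f t r)^-1)))).
- by apply: cts_inv => //; exact: Crk_cts Cf.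
- move=> t r It Jr; apply: isD_eq (isD_inv (f0 _ _ It Jr) (Crk_isD Cf It Jr)) _.
  by rewrite mulNr expr2 invfM.
- apply: Crk_opp; apply: Crk_mul; first exact: Crk_dr.
  by apply: Crk_mul; apply: IH; exact: Crk_pred.
Qed.

Lemma Crk_sqrt k f : (forall t r, I t -> J r -> 0 < f t r) -> Crk I J k f ->
  Crk I J k (fun t r => Num.sqrt (f t r)).
Proof.
move=> f0; have sc g : cts I J g -> cts I J (fun t r => Num.sqrt (g t r)).
  by apply: cts_comp => t r _ _; exact: sqrt_continuous.
elim: k => [|k IH] Cf; first by split=> //; apply: sc; exact: Crk_cts Cf.
apply: Crk_intro (sc _ (Crk_cts Cf)) _ _.
  move=> t r It Jr; exact: isD_sqrt (f0 _ _ It Jr) (Crk_isD Cf It Jr).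
apply: Crk_mul; first exact: Crk_dr.
apply: Crk_inv => [t r It Jr|].
  by rewrite mulf_neq0// gt_eqF// sqrtr_gt0 f0.
by apply: Crk_mul; [exact: Crk_cst|exact: IH (Crk_pred Cf)].
Qed.

Lemma Crinf_cts f : Crinf I J f -> cts I J f.
Proof. by move=> /(_ 0%N)/Crk_cts. Qed.

Lemma Crinf_isD f : Crinf I J f ->
  forall t r, I t -> J r -> is_derive r 1 (f t) (dr f t r).
Proof. by move=> /(_ 1%N)/Crk_isD. Qed.

Lemma Crinf_dr f : Crinf I J f -> Crinf I J (dr f).
Proof. by move=> Cf k; exact: Crk_dr (Cf k.+1). Qed.

Lemma Crinf_ext f g : (forall t r, I t -> J r -> f t r = g t r) ->
  Crinf I J f -> Crinf I J g.
Proof. by move=> fg Cf k; exact: Crk_ext fg (Cf k). Qed.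

Lemma Crinf_intro f g : cts I J f ->
  (forall t r, I t -> J r -> is_derive r 1 (f t) (g t r)) ->
  Crinf I J g -> Crinf I J f.
Proof. by move=> cf fg Cg [|k]; [split|exact: Crk_intro cf fg (Cg k)]. Qed.

Lemma Crinf_cst (c : R) : Crinf I J (fun _ _ => c).
Proof. by move=> k; exact: Crk_cst. Qed.

Lemma Crinf_add f g : Crinf I J f -> Crinf I J g ->
  Crinf I J (fun t r => f t r + g t r).
Proof. by move=> Cf Cg k; exact: Crk_add. Qed.

Lemma Crinf_opp f : Crinf I J f -> Crinf I J (fun t r => - f t r).
Proof. by move=> Cf k; exact: Crk_opp. Qed.

Lemma Crinf_mul f g : Crinf I J f -> Crinf I J g ->
  Crinf I J (fun t r => f t r * g t r).
Proof. by move=> Cf Cg k; exact: Crk_mul. Qed.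

Lemma Crinf_exp f n : Crinf I J f -> Crinf I J (fun t r => f t r ^+ n).
Proof.
move=> Cf; elim: n => [|n IH].
  by apply: Crinf_ext (Crinf_cst 1) => t r _ _; rewrite expr0.
by apply: Crinf_ext (Crinf_mul Cf IH) => t r _ _; rewrite exprS.
Qed.

Lemma Crinf_inv f : (forall t r, I t -> J r -> f t r != 0) -> Crinf I J f ->
  Crinf I J (fun t r => (f t r)^-1).
Proof. by move=> f0 Cf k; exact: Crk_inv. Qed.

Lemma Crinf_sqrt f : (forall t r, I t -> J r -> 0 < f t r) -> Crinf I J f ->
  Crinf I J (fun t r => Num.sqrt (f t r)).
Proof. by move=> f0 Cf k; exact: Crk_sqrt. Qed.

Lemma Crinf_ln f : (forall t r, I t -> J r -> 0 < f t r) -> Crinf I J f ->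
  Crinf I J (fun t r => ln (f t r)).
Proof.
move=> f0 Cf; apply: (@Crinf_intro _ (fun t r => dr f t r * (f t r)^-1)).
- apply: cts_comp (Crinf_cts Cf) => t r It Jr.
  exact: isD_cont (is_derive1_ln (f0 _ _ It Jr)).
- by move=> t r It Jr; exact: isD_ln (f0 _ _ It Jr) (Crinf_isD Cf It Jr).
- apply: Crinf_mul; first exact: Crinf_dr.
  by apply: Crinf_inv => // t r It Jr; rewrite gt_eqF// f0.
Qed.

Lemma Crinf_sincos : Crinf I J (fun _ r => sin r) /\ Crinf I J (fun _ r => cos r).
Proof.
suff H k : Crk I J k (fun _ r => sin r) /\ Crk I J k (fun _ r => cos r).
  by split=> k; case: (H k).
have cs : cts I J (fun _ r => sin r).
  by apply: cts_space => r _; exact: continuous_sin.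
have cc : cts I J (fun _ r => cos r).
  by apply: cts_space => r _; exact: continuous_cos.
elim: k => [|k [IHs IHc]]; first by do !split.
by split; [exact: Crk_intro cs _ IHc|exact: Crk_intro cc _ (Crk_opp IHs)].
Qed.

End StripClass.

Section StripRestrict.
Context {R : realType}.
Implicit Types (f g : R -> R -> R) (I J : set R).

Lemma cts_sub I J I' J' f : I' `<=` I -> J' `<=` J -> cts I J f -> cts I' J' f.
Proof.
move=> II JJ cf t r It Jr; apply: cvg_trans (cf t r (II _ It) (JJ _ Jr)).
apply: cvg_app; apply: within_subset => -[s x] [/= Is Jx].
by split; [exact: II|exact: JJ].
Qed.

Lemma Crinf_sub I J I' J' f : I' `<=` I -> J' `<=` J -> Crinf I J f -> Crinf I' J' f.
Proof.
move=> II JJ Cf k; elim: k f {Cf}(Cf k) => [|k IH] f [cf H]; split=> //.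
- exact: cts_sub cf.
- exact: cts_sub cf.
- have [df Cf] := H; split; last exact: IH.
  by move=> t r It Jr; apply: df; [exact: II|exact: JJ].
Qed.

Lemma cts_bounded I J (a b c d : R) f : (forall t, a <= t <= b -> I t) ->
  (forall r, c <= r <= d -> J r) -> cts I J f ->
  exists2 M, 0 < M & forall t r, a <= t <= b -> c <= r <= d -> `|f t r| <= M.
Proof.
move=> II JJ cf.
have [ab|ba] := leP a b; last first.
  by exists 1 => // t r /andP[ta tb]; move: (le_trans ta tb); rewrite leNgt ba.
have [cd|dc] := leP c d; last first.
  by exists 1 => // t r _ /andP[ta tb]; move: (le_trans ta tb); rewrite leNgt dc.
pose K : set (R * R) := `[a, b] `*` `[c, d].
have K0 : K !=set0 by exists (a, c); split => /=; rewrite in_itv/= lexx.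
have cK : compact K by apply: compact_setX; exact: segment_compact.
have cfK : {within K, continuous (fun z => `|f z.1 z.2|)}.
  apply/subspace_continuousP => -[t r] [/=]; rewrite !in_itv/= => tab rcd.
  apply: cvg_norm; apply: cvg_trans (cf t r (II _ tab) (JJ _ rcd)).
  apply: cvg_app; apply: within_subset => -[s x] [/=].
  by rewrite !in_itv/= => ? ?; split; [exact: II|exact: JJ].
have [z _ zM] := compact_EVT_max K0 cK cfK.
exists (`|f z.1 z.2| + 1); first by rewrite ltr_wpDl.
move=> t r tab rcd; rewrite (le_trans (zM (t, r) _)) ?lerDl//.
by rewrite inE; split; rewrite /= in_itv.
Qed.

Lemma cts_lower I J (a b c d : R) f : (forall t, a <= t <= b -> I t) ->
  (forall r, c <= r <= d -> J r) -> cts I J f ->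
  (forall t r, a <= t <= b -> c <= r <= d -> 0 < f t r) ->
  exists2 m, 0 < m & forall t r, a <= t <= b -> c <= r <= d -> m <= f t r.
Proof.
move=> II JJ cf f0; pose g t r := (f t r)^-1.
have [|||M M0 gM] := @cts_bounded `[a, b] `[c, d] a b c d g.
- by move=> t; rewrite /= in_itv.
- by move=> t; rewrite /= in_itv.
- apply: cts_inv; first by move=> t r /=; rewrite !in_itv/= => *; rewrite gt_eqF// f0.
  by apply: cts_sub cf => t /=; rewrite in_itv/=; [exact: II|exact: JJ].
exists M^-1; first by rewrite invr_gt0.
move=> t r tab rcd; have := gM t r tab rcd; have ft := f0 t r tab rcd.
rewrite ger0_norm; last by rewrite invr_ge0 ltW.
by move=> H; rewrite -[f t r]invrK lef_pV2// posrE// invr_gt0.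
Qed.

End StripRestrict.

(** * First touching times *)

Section MaximumPrinciple.
Context {R : realType} (k : nat) (f : 'I_k -> R -> R -> R).
Variables (a T lo hi d1 d2 : R).
Hypotheses (lod : lo < d1) (dhi : d2 < hi).
Let I : set R := [set t | a <= t <= T].
Let J : set R := [set r | lo < r < hi].
Hypothesis cf : forall i, cts I J (f i).
Hypothesis f_init : forall i r, lo < r < hi -> 0 < f i a r.
Hypothesis f_edge : forall i t r, a <= t <= T -> lo < r < hi ->
  ~~ (d1 <= r <= d2) -> 0 < f i t r.
Hypothesis f_touch : forall i t r, a < t <= T -> lo < r < hi -> f i t r = 0 ->
  (forall j x, lo < x < hi -> 0 <= f j t x) ->
  exists2 ft, is_derive t 1 (f i ^~ r) ft & 0 < ft.

Let B : set (R * R) := `[a, T] `*` `[d1, d2].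
Let K : set (R * R) := B `&` [set z | exists i, f i z.1 z.2 <= 0].

Let BIJ : B `<=` I `*` J.
Proof.
move=> [t r] [/=]; rewrite !in_itv/= => tI /andP[r1 r2]; split=> //=.
by rewrite /J/= (lt_le_trans lod r1) (le_lt_trans r2 dhi).
Qed.

Let cB : compact B.
Proof. by apply: compact_setX; exact: segment_compact. Qed.

Let cK : compact K.
Proof.
apply: (subclosed_compact _ cB); last by move=> z [].
rewrite closedE => -[t r] /= H; apply: contrapT => NK; apply: H.
have [Btr|NB] := pselect (B (t, r)); last first.
  have cB' : closed B by apply: compact_closed cB; exact: norm_hausdorff.
  have : nbhs (t, r) (~` B) by apply: open_nbhs_nbhs; split=> //; exact: closed_openC.
  by apply: filterS => z NBz [].
have [It Jr] := BIJ Btr.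
have fpos i : 0 < f i t r.
  by rewrite ltNge; apply/negP => fi; apply: NK; split=> //; exists i.
have : \forall z \near within (I `*` J) (nbhs (t, r)), forall i, 0 < f i z.1 z.2.
  by apply: filter_forall => i; apply: (cvgr_gt _ (cf It Jr)); exact: fpos.
rewrite near_withinE; apply: filterS => z Hz [/BIJ/Hz fz [i]].
by rewrite leNgt fz.
Qed.

(** The set [K] of points of the box where some [f i] is nonpositive is compact, so
    if it is not empty it has a point of least time. There the function that
    vanishes has been positive at earlier times, which contradicts a positive
    time derivative. Positivity near the edges keeps [K] away from the ends of
    the open interval, where nothing is known about [f]. *)
Lemma first_touching_time i t r : a <= t <= T -> lo < r < hi -> 0 < f i t r.
Proof.
move=> tI rJ; rewrite ltNge; apply/negP => fitr.
have drd : d1 <= r <= d2.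
  by apply: contrapT => /negP /(f_edge i tI rJ); rewrite ltNge fitr.
have K0 : K !=set0.
  by exists (t, r); split; [split; rewrite /= in_itv|exists i].
have cfst : {within K, continuous (fst : R * R -> R)}.
  by apply: continuous_subspaceT => z; exact: cvg_fst.
have [[t0 r0] /set_mem K0' tmin] := compact_EVT_min K0 cK cfst.
have {}tmin s x j : a <= s < t0 -> lo < x < hi -> 0 < f j s x.
  move=> /andP[s1 s2] xJ; rewrite ltNge; apply/negP => fs.
  have sI : a <= s <= T.
    rewrite s1 (le_trans (ltW s2))//.
    by case: K0' => -[/=]; rewrite in_itv/= => /andP[].
  have xd : d1 <= x <= d2.
    by apply: contrapT => /negP /(f_edge j sI xJ); rewrite ltNge fs.
  suff /tmin : (s, x) \in K by rewrite /= leNgt s2.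
  by rewrite inE; split; [split; rewrite /= in_itv|exists j].
case: K0' => [Bz [/= j fj]]; have [/= It0 Jr0] := BIJ Bz.
have at0 : a < t0.
  move: (It0) => /andP[]; rewrite le_eqVlt => /orP[/eqP at0|//] _.
  by move: fj; rewrite leNgt -at0 f_init.
have fge l x : lo < x < hi -> 0 <= f l t0 x.
  move=> xJ; rewrite leNgt; apply/negP => fneg.
  have fn : \forall z \near within (I `*` J) (nbhs (t0, x)), f l z.1 z.2 < 0.
    by apply: (cvgr_lt _ (@cf l _ _ It0 xJ)); exact: fneg.
  have [d d0 H] := @near_box _ (fun z => (I `*` J) z -> f l z.1 z.2 < 0) t0 x fn.
  pose s := Num.max a (t0 - d / 2).
  have st : s < t0 by rewrite gt_max at0 ltrBlDr ltrDl divr_gt0.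
  have as_ : a <= s by rewrite le_max lexx.
  have sd : t0 - s < d.
    rewrite ltrBlDl -ltrBlDr lt_max; apply/orP; right.
    by rewrite ltrD2l ltrN2 ltr_pdivrMr// ltr_pMr// ltr1n.
  have : f l s x < 0.
    apply: H; rewrite ?subrr ?normr0// ?ltr0_norm ?subr_lt0 ?opprB//.
    split=> //; rewrite /I/= as_ (le_trans (ltW st))//.
    by case/andP: It0.
  by apply/negP; rewrite -leNgt ltW// tmin// as_.
have fj0 : f j t0 r0 = 0 by apply/eqP; rewrite eq_le fj fge.
have [|ft /isDP D ft0] := f_touch _ Jr0 fj0 fge.
  by rewrite at0; case/andP: It0.
have [|d d0 H] := D (ft / 2); first by rewrite divr_gt0.
pose s := Num.max a (t0 - d / 2).
have st : s < t0 by rewrite gt_max at0 ltrBlDr ltrDl divr_gt0.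
have as_ : a <= s by rewrite le_max lexx.
have := H (s - t0); rewrite ltr0_norm ?subr_lt0// opprB.
have -> : t0 - s < d.
  rewrite ltrBlDl -ltrBlDr lt_max; apply/orP; right.
  by rewrite ltrD2l ltrN2 ltr_pdivrMr// ltr_pMr// ltr1n.
move=> /(_ isT); rewrite (_ : t0 + (s - t0) = s); last by ring.
rewrite fj0 subr0 ler_norml => /andP[_].
have : 0 < f j s r0 by apply: tmin => //; rewrite as_.
have : 0 < ft * (t0 - s) by rewrite mulr_gt0// subr_gt0.
rewrite -[s - t0]opprB mulrN opprK mulrAC; lra.
Qed.

End MaximumPrinciple.

(** * Evolution of the curvatures of a warped metric *)

Section WarpedQuantities.
Context {R : realType}.
Implicit Types (f g : R -> R -> R) (t r : R).
Variables (chi psi phi : R -> R -> R).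

Definition arcd f : R -> R -> R := fun t r => derive1 (f t) r / chi t r.
(** The curvatures [K^top], [K_1^perp], [K_2^perp] and [L] in this order; [pp] and
    [qq] are, up to sign, the principal curvatures of the orbits. *)
Definition kt t r : R := - (arcd (arcd psi) t r / psi t r).
Definition k1 t r : R := - (arcd (arcd phi) t r / phi t r).
Definition k2 t r : R :=
  - ((arcd psi t r * arcd phi t r) / (psi t r * phi t r)).
Definition kl t r : R := (1 - arcd phi t r ^+ 2) / phi t r ^+ 2.
Definition pp t r : R := arcd psi t r / psi t r.
Definition qq t r : R := arcd phi t r / phi t r.

(** The Laplacian of [chi^2 dr^2 + psi^2 dtheta^2 + phi^2 g_(S^m)] on functions of
    [r] alone. *)
Definition laplace (m : nat) f t r : R :=
  arcd (arcd f) t r + (pp t r + m%:R * qq t r) * arcd f t r.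

End WarpedQuantities.

Section Evolution.
Context {R : realType} (m : nat) (m0 : (0 < m)%N) (a : R) (chi psi phi : R -> R -> R).
Implicit Types (f g : R -> R -> R) (t r : R).
Let I : set R := [set t | a <= t < 0].
Let J : set R := [set r | 0 < r < pi / 2].
Let mm : R := m%:R.

Local Notation S := (arcd chi).
Local Notation A := (kt chi psi).
Local Notation B := (k2 chi psi phi).
Local Notation C := (k1 chi phi).
Local Notation D := (kl chi phi).
Local Notation p := (pp chi psi).
Local Notation q := (qq chi phi).
Local Notation Lap := (laplace chi psi phi m).

Hypothesis chi0 : forall t r, I t -> J r -> 0 < chi t r.
Hypothesis psi0 : forall t r, I t -> J r -> 0 < psi t r.
Hypothesis phi0 : forall t r, I t -> J r -> 0 < phi t r.
Hypothesis Cchi : Crinf I J chi.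
Hypothesis Cpsi : Crinf I J psi.
Hypothesis Cphi : Crinf I J phi.
Hypothesis Tchi : forall t r, a < t < 0 -> J r ->
  is_derive t 1 (chi ^~ r) (- chi t r * (A t r + mm * C t r)).
Hypothesis Tpsi : forall t r, a < t < 0 -> J r ->
  is_derive t 1 (psi ^~ r) (- psi t r * (A t r + mm * B t r)).
Hypothesis Tphi : forall t r, a < t < 0 -> J r ->
  is_derive t 1 (phi ^~ r)
    (- phi t r * (C t r + B t r + (mm - 1) * D t r)).

Let openJ : open J.
Proof.
rewrite (_ : J = `]0, pi / 2[%classic); first exact: interval_open.
by apply/seteqP; split=> x; rewrite /= in_itv.
Qed.

Let chiN t r : I t -> J r -> chi t r != 0.
Proof. by move=> It Jr; rewrite gt_eqF// chi0. Qed.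
Let psiN t r : I t -> J r -> psi t r != 0.
Proof. by move=> It Jr; rewrite gt_eqF// psi0. Qed.
Let phiN t r : I t -> J r -> phi t r != 0.
Proof. by move=> It Jr; rewrite gt_eqF// phi0. Qed.

Let Io t : a < t < 0 -> I t.
Proof. by move=> /andP[/ltW ? ?]; apply/andP. Qed.

(* the arc length derivative is [b]; stated without a division so that the
   rules of calculus apply *)
Let isS f (b : R) t r := is_derive r 1 (f t) (b * chi t r).
Let isT f (b : R) t r := is_derive t 1 (f ^~ r) b.

Let SE f b t r : I t -> J r -> isS f b t r -> S f t r = b.
Proof. by move=> It Jr H; rewrite /arcd (isD_derive1 H) mulfK// chiN. Qed.

Let isSE f t r : I t -> J r -> Crinf I J f -> isS f (S f t r) t r.
Proof.
move=> It Jr /Crinf_isD/(_ t r It Jr) H; apply: isD_eq H _.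
by rewrite /arcd divfK// chiN.
Qed.

Let CS f : Crinf I J f -> Crinf I J (S f).
Proof.
move=> Cf; apply: Crinf_mul; [exact: openJ|exact: Crinf_dr|].
by apply: Crinf_inv => //; exact: chiN.
Qed.

Let S_ext f g t r : I t -> J r -> (forall x, J x -> f t x = g t x) ->
  S f t r = S g t r.
Proof.
move=> It Jr fg; rewrite /arcd; congr (_ / _).
rewrite !derive1E; apply: near_eq_derive.
have : nbhs r J by apply: open_nbhs_nbhs.
by apply: filterS => x /fg.
Qed.

Let isS_ext f g b t r : I t -> J r -> (forall x, J x -> f t x = g t x) ->
  isS g b t r -> isS f b t r.
Proof.
move=> It Jr fg; apply: isD_near.
have : nbhs r J by apply: open_nbhs_nbhs.
by apply: filterS => x /fg.
Qed.

Let isT_ext f g b t r : a < t < 0 -> J r -> (forall s, I s -> f s r = g s r) ->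
  isT g b t r -> isT f b t r.
Proof.
move=> It Jr fg; apply: isD_near.
have : nbhs t `]a, 0[%classic.
  by apply: open_nbhs_nbhs; split; [exact: interval_open|rewrite /= in_itv].
by apply: filterS => s; rewrite /= in_itv/= => /Io/fg.
Qed.

Let isS_cst (c : R) t r : isS (fun _ _ => c) 0 t r.
Proof. by apply: isD_eq (isD_cst r c) _; rewrite mul0r. Qed.

Let isS_add f g b c t r : isS f b t r -> isS g c t r ->
  isS (fun t r => f t r + g t r) (b + c) t r.
Proof. by move=> Sf Sg; apply: isD_eq (isD_add Sf Sg) _; rewrite mulrDl. Qed.

Let isS_sub f g b c t r : isS f b t r -> isS g c t r ->
  isS (fun t r => f t r - g t r) (b - c) t r.
Proof. by move=> Sf Sg; apply: isD_eq (isD_sub Sf Sg) _; rewrite mulrBl. Qed.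

Let isS_opp f b t r : isS f b t r -> isS (fun t r => - f t r) (- b) t r.
Proof. by move=> Sf; apply: isD_eq (isD_opp Sf) _; rewrite mulNr. Qed.

Let isS_mul f g b c t r : isS f b t r -> isS g c t r ->
  isS (fun t r => f t r * g t r) (b * g t r + f t r * c) t r.
Proof. by move=> Sf Sg; apply: isD_eq (isD_mul Sf Sg) _; ring. Qed.

Let isS_div f g b c t r : g t r != 0 -> isS f b t r -> isS g c t r ->
  isS (fun t r => f t r / g t r) ((b * g t r - f t r * c) / g t r ^+ 2) t r.
Proof. by move=> g0 Sf Sg; apply: isD_eq (isD_div g0 Sf Sg) _; field. Qed.

Let isS_exp f b k t r : isS f b t r ->
  isS (fun t r => f t r ^+ k) (k%:R * f t r ^+ k.-1 * b) t r.
Proof. by move=> Sf; apply: isD_eq (isD_exp k Sf) _; rewrite !mulrA. Qed.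

(** ** First order identities *)

Let Cp : Crinf I J p.
Proof. by apply: Crinf_mul => //; [exact: CS|exact: Crinf_inv]. Qed.
Let Cq : Crinf I J q.
Proof. by apply: Crinf_mul => //; [exact: CS|exact: Crinf_inv]. Qed.
Let CA : Crinf I J A.
Proof.
apply: Crinf_opp => //; apply: Crinf_mul => //; last exact: Crinf_inv.
by do 2!apply: CS.
Qed.
Let CC : Crinf I J C.
Proof.
apply: Crinf_opp => //; apply: Crinf_mul => //; last exact: Crinf_inv.
by do 2!apply: CS.
Qed.
Let CB : Crinf I J B.
Proof.
apply: Crinf_opp => //; apply: Crinf_mul => //.
  by apply: Crinf_mul => //; apply: CS.
apply: Crinf_inv => //; last exact: Crinf_mul.
by move=> t r It Jr; rewrite mulf_neq0 ?psiN ?phiN.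
Qed.
Let CD : Crinf I J D.
Proof.
apply: Crinf_mul => //.
  apply: Crinf_add => //; first exact: Crinf_cst.
  by apply: Crinf_opp => //; apply: Crinf_exp => //; apply: CS.
apply: Crinf_inv => //; last exact: Crinf_exp.
by move=> t r It Jr; rewrite expf_neq0// phiN.
Qed.

Let Spsi t r : I t -> J r -> isS psi (p t r * psi t r) t r.
Proof.
by move=> It Jr; rewrite /pp divfK ?psiN//; exact: isSE.
Qed.
Let Sphi t r : I t -> J r -> isS phi (q t r * phi t r) t r.
Proof.
by move=> It Jr; rewrite /qq divfK ?phiN//; exact: isSE.
Qed.

Let Sp t r : I t -> J r -> isS p (- A t r - p t r ^+ 2) t r.
Proof.
move=> It Jr; have H : isS (S psi) (S (S psi) t r) t r.
  by apply: isSE => //; exact: CS.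
apply: isD_eq (isS_div (psiN It Jr) H (Spsi It Jr)) _; congr (_ * _).
rewrite /kt /pp; field; exact: psiN.
Qed.

Let Sq t r : I t -> J r -> isS q (- C t r - q t r ^+ 2) t r.
Proof.
move=> It Jr; have H : isS (S phi) (S (S phi) t r) t r.
  by apply: isSE => //; exact: CS.
apply: isD_eq (isS_div (phiN It Jr) H (Sphi It Jr)) _; congr (_ * _).
rewrite /k1 /qq; field; exact: phiN.
Qed.

(** Together with [p_s = - A - p^2] and [q_s = - C - q^2], the identities
    [B = - p q] and [D = phi^-2 - q^2] reduce every derivative below to the four
    curvatures, their arc length derivatives and [p], [q]. *)
Lemma k2E t r : I t -> J r -> B t r = - (p t r * q t r).
Proof. by move=> It Jr; rewrite /k2 /pp /qq; field; rewrite psiN// phiN. Qed.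

Lemma klE t r : I t -> J r -> D t r = (phi t r ^+ 2)^-1 - q t r ^+ 2.
Proof. by move=> It Jr; rewrite /kl /qq; field; rewrite phiN. Qed.

Let SB t r : I t -> J r ->
  isS B (q t r * (A t r - B t r) - p t r * (B t r - C t r)) t r.
Proof.
move=> It Jr; apply: (isS_ext (g := fun t r => - (p t r * q t r))) => //.
  by move=> x Jx; rewrite k2E.
apply: isD_eq (isS_opp (isS_mul (Sp It Jr) (Sq It Jr))) _; congr (_ * _).
by rewrite k2E//; ring.
Qed.

Let SD t r : I t -> J r -> isS D (2 * q t r * (C t r - D t r)) t r.
Proof.
move=> It Jr; apply: (isS_ext (g := fun t r => 1 / phi t r ^+ 2 - q t r ^+ 2)) => //.
  by move=> x Jx; rewrite klE// div1r.
have H2 := isS_exp 2 (Sphi It Jr).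
have P2 : phi t r ^+ 2 != 0 by rewrite expf_neq0// phiN.
apply: isD_eq (isS_sub (isS_div (g := fun t r => phi t r ^+ 2) P2 (isS_cst 1 t r) H2) (isS_exp 2 (Sq It Jr))) _.
by congr (_ * _); rewrite klE//=; field; exact: phiN.
Qed.

(** The arc length parameter changes with time, which adds the second term
    to the commutator of the two derivatives. *)
Let TS f F t r : Crinf I J f -> Crinf I J F ->
  (forall t r, a < t < 0 -> J r -> isT f (F t r) t r) -> a < t < 0 -> J r ->
  isT (S f) (S F t r + (A t r + mm * C t r) * S f t r) t r.
Proof.
move=> Cf CF fF It Jr; have It' := Io It.
have nbh : nbhs (t, r) (`]a, 0[%classic `*` J).
  exists (`]a, 0[%classic, J) => //; split; last exact: open_nbhs_nbhs.
  by apply: open_nbhs_nbhs; split; [exact: interval_open|rewrite /= in_itv].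
have H : is_derive t 1 ((dr f) ^~ r) (dr F t r).
  apply: (@mixed_derivative _ f F (dr f) (dr F)).
  - by apply: filterS nbh => -[s x] [/=]; rewrite in_itv/= => Is Jx; exact: fF.
  - apply: filterS nbh => -[s x] [/=]; rewrite in_itv/= => /Io Is Jx.
    exact: Crinf_isD Cf _ _ Is Jx.
  - apply: filterS nbh => -[s x] [/=]; rewrite in_itv/= => /Io Is Jx.
    exact: Crinf_isD CF _ _ Is Jx.
  - have := Crinf_cts (Crinf_dr CF) It' Jr; apply: cvg_trans; apply: cvg_app.
    move=> P /= wP; apply: filterS2 nbh wP => -[s x] [/=].
    by rewrite in_itv/= => /Io Is Jx; apply.
apply: isD_eq (isD_div (chiN It' Jr) H (Tchi It Jr)) _.
rewrite /arcd -/(dr f t r) -/(dr F t r); field; exact: chiN.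
Qed.

(* [psi_t = - psi P], [phi_t = - phi Q], [chi_t = - chi E] *)
Let P t r := A t r + mm * B t r.
Let Q t r := C t r + B t r + (mm - 1) * D t r.
Let E t r := A t r + mm * C t r.

Let Cscale f (c : R) : Crinf I J f -> Crinf I J (fun t r => c * f t r).
Proof. by move=> Cf; apply: Crinf_mul => //; exact: Crinf_cst. Qed.
Let CP : Crinf I J P.
Proof. by apply: Crinf_add => //; exact: Cscale. Qed.
Let CQ : Crinf I J Q.
Proof. by apply: Crinf_add => //; [exact: Crinf_add|exact: Cscale]. Qed.
Let CE : Crinf I J E.
Proof. by apply: Crinf_add => //; exact: Cscale. Qed.

Let Tp t r : a < t < 0 -> J r -> isT p (- S P t r + E t r * p t r) t r.
Proof.
move=> It Jr; have It' := Io It.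
have CF : Crinf I J (fun t r => - psi t r * P t r).
  by apply: Crinf_mul => //; exact: Crinf_opp.
have TSp := TS Cpsi CF Tpsi It Jr.
apply: isD_eq (isD_div (psiN It' Jr) TSp (Tpsi It Jr)) _.
have -> : S (fun t r => - psi t r * P t r) t r =
    - (p t r * psi t r) * P t r + - psi t r * S P t r.
  apply: SE => //; apply: isS_mul; last exact: isSE.
  by apply: isS_opp; exact: Spsi.
have -> : S psi t r = p t r * psi t r by rewrite /pp divfK// psiN.
by rewrite /P /E; field; exact: psiN.
Qed.

Let Tq t r : a < t < 0 -> J r -> isT q (- S Q t r + E t r * q t r) t r.
Proof.
move=> It Jr; have It' := Io It.
have CF : Crinf I J (fun t r => - phi t r * Q t r).
  by apply: Crinf_mul => //; exact: Crinf_opp.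
have TSp := TS Cphi CF Tphi It Jr.
apply: isD_eq (isD_div (phiN It' Jr) TSp (Tphi It Jr)) _.
have -> : S (fun t r => - phi t r * Q t r) t r =
    - (q t r * phi t r) * Q t r + - phi t r * S Q t r.
  apply: SE => //; apply: isS_mul; last exact: isSE.
  by apply: isS_opp; exact: Sphi.
have -> : S phi t r = q t r * phi t r by rewrite /qq divfK// phiN.
by rewrite /Q /E; field; exact: phiN.
Qed.

Lemma arcd_k2 t r : I t -> J r ->
  S B t r = q t r * (A t r - B t r) - p t r * (B t r - C t r).
Proof. by move=> It Jr; apply: SE => //; exact: SB. Qed.

Lemma arcd_kl t r : I t -> J r -> S D t r = 2 * q t r * (C t r - D t r).
Proof. by move=> It Jr; apply: SE => //; exact: SD. Qed.

Let B1 t r := q t r * (A t r - B t r) - p t r * (B t r - C t r).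
Let D1 t r := 2 * q t r * (C t r - D t r).
Let SBE t r : I t -> J r -> S B t r = B1 t r.
Proof. exact: arcd_k2. Qed.
Let SDE t r : I t -> J r -> S D t r = D1 t r.
Proof. exact: arcd_kl. Qed.
Let SSBE t r : I t -> J r -> S (S B) t r =
  (- C t r - q t r ^+ 2) * (A t r - B t r) + q t r * (S A t r - B1 t r)
  - ((- A t r - p t r ^+ 2) * (B t r - C t r) + p t r * (B1 t r - S C t r)).
Proof.
move=> It Jr; rewrite (@S_ext _ B1)//; last by move=> x Jx; exact: SBE.
apply: SE => //; apply: isS_sub; apply: isS_mul; [exact: Sq| |exact: Sp|].
  by apply: isS_sub; [exact: isSE|exact: SB].
by apply: isS_sub; [exact: SB|exact: isSE].
Qed.
Let SSDE t r : I t -> J r -> S (S D) t r =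
  2 * (- C t r - q t r ^+ 2) * (C t r - D t r)
  + 2 * q t r * (S C t r - D1 t r).
Proof.
move=> It Jr; rewrite (@S_ext _ D1)//; last by move=> x Jx; exact: SDE.
apply: SE => //; apply: isS_mul; last first.
  by apply: isS_sub; [exact: isSE|exact: SD].
apply: isD_eq (isS_mul (isS_cst 2 t r) (Sq It Jr)) _.
by rewrite mul0r add0r.
Qed.
Let isS_scale f (c b : R) t r : isS f b t r -> isS (fun t r => c * f t r) (c * b) t r.
Proof.
by move=> Sf; apply: isD_eq (isS_mul (isS_cst c t r) Sf) _; rewrite mul0r add0r.
Qed.
Let SPE t r : I t -> J r -> S P t r = S A t r + mm * S B t r.
Proof.
move=> It Jr; apply: SE => //; apply: isS_add; first exact: isSE.
by apply: isS_scale; exact: isSE.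
Qed.
Let SQE t r : I t -> J r -> S Q t r = S C t r + S B t r + (mm - 1) * S D t r.
Proof.
move=> It Jr; apply: SE => //; apply: isS_add; last by apply: isS_scale; exact: isSE.
by apply: isS_add; exact: isSE.
Qed.
Let SEE t r : I t -> J r -> S E t r = S A t r + mm * S C t r.
Proof.
move=> It Jr; apply: SE => //; apply: isS_add; first exact: isSE.
by apply: isS_scale; exact: isSE.
Qed.
Let SSPE t r : I t -> J r -> S (S P) t r = S (S A) t r + mm * S (S B) t r.
Proof.
move=> It Jr; rewrite (@S_ext _ (fun t r => S A t r + mm * S B t r))//; last first.
  by move=> x Jx; exact: SPE.
apply: SE => //; apply: isS_add; first by apply: isSE => //; exact: CS.
by apply: isS_scale; apply: isSE => //; exact: CS.
Qed.
Let SSQE t r : I t -> J r ->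
  S (S Q) t r = S (S C) t r + S (S B) t r + (mm - 1) * S (S D) t r.
Proof.
move=> It Jr.
rewrite (@S_ext _ (fun t r => S C t r + S B t r + (mm - 1) * S D t r))//; last first.
  by move=> x Jx; exact: SQE.
apply: SE => //; apply: isS_add; last first.
  by apply: isS_scale; apply: isSE => //; exact: CS.
by apply: isS_add; apply: isSE => //; exact: CS.
Qed.

(** The evolution equations follow from those of [p] and [q]: time derivatives are
    commuted with the arc length derivative, and the Gauss and Codazzi type
    identities above remove the second derivatives of [B] and [D] that do not
    belong to the Laplacian. *)
Lemma evolution_kt t r : a < t < 0 -> J r -> isT A
  (Lap A t r + 2 * A t r ^+ 2 + 2 * mm * B t r * C t r
   - 2 * mm * q t r ^+ 2 * (A t r - B t r)) t r.
Proof.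
move=> It Jr; have It' := Io It.
pose F t r := - S P t r + E t r * p t r.
have CF : Crinf I J F.
  apply: Crinf_add => //; last exact: Crinf_mul.
  by apply: Crinf_opp => //; exact: CS.
have TSp := TS Cp CF Tp It Jr.
apply: (isT_ext (g := fun t r => - S p t r - p t r ^+ 2)) => //.
  by move=> s Is; rewrite (SE Is Jr (Sp Is Jr)); ring.
apply: isD_eq (isD_sub (isD_opp TSp) (isD_exp 2 (Tp It Jr))) _.
have -> : S F t r = - S (S P) t r + (S E t r * p t r + E t r * S p t r).
  apply: SE => //; apply: isS_add; first by apply: isS_opp; apply: isSE => //; exact: CS.
  by apply: isS_mul; exact: isSE.
rewrite /laplace SSPE// SPE// SEE// SSBE// SBE// (SE It' Jr (Sp It' Jr)) /B1 /E /=.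
rewrite -/mm; rewrite (k2E It' Jr); ring.
Qed.

Lemma evolution_k1 t r : a < t < 0 -> J r -> isT C
  (Lap C t r + 2 * C t r ^+ 2 + 2 * A t r * B t r
   + 2 * (mm - 1) * C t r * D t r + 2 * p t r ^+ 2 * (B t r - C t r)
   - 2 * (mm - 1) * q t r ^+ 2 * (C t r - D t r)) t r.
Proof.
move=> It Jr; have It' := Io It.
pose F t r := - S Q t r + E t r * q t r.
have CF : Crinf I J F.
  apply: Crinf_add => //; last exact: Crinf_mul.
  by apply: Crinf_opp => //; exact: CS.
have TSp := TS Cq CF Tq It Jr.
apply: (isT_ext (g := fun t r => - S q t r - q t r ^+ 2)) => //.
  by move=> s Is; rewrite (SE Is Jr (Sq Is Jr)); ring.
apply: isD_eq (isD_sub (isD_opp TSp) (isD_exp 2 (Tq It Jr))) _.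
have -> : S F t r = - S (S Q) t r + (S E t r * q t r + E t r * S q t r).
  apply: SE => //; apply: isS_add; first by apply: isS_opp; apply: isSE => //; exact: CS.
  by apply: isS_mul; exact: isSE.
rewrite /laplace SSQE// SQE// SEE// SSBE// SBE// SSDE// SDE//.
rewrite (SE It' Jr (Sq It' Jr)) /B1 /D1 /E /=.
rewrite -/mm; rewrite (k2E It' Jr); ring.
Qed.

Lemma evolution_k2 t r : a < t < 0 -> J r -> isT B
  (Lap B t r + 2 * B t r ^+ 2 + 2 * A t r * C t r
   + 2 * (mm - 1) * B t r * D t r - 2 * p t r ^+ 2 * (B t r - C t r)
   + 2 * q t r ^+ 2 * (A t r - B t r)) t r.
Proof.
move=> It Jr; have It' := Io It.
apply: (isT_ext (g := fun t r => - (p t r * q t r))) => //.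
  by move=> s Is; rewrite k2E.
apply: isD_eq (isD_opp (isD_mul (Tp It Jr) (Tq It Jr))) _.
rewrite /laplace SPE// SQE// SSBE// SBE// SDE// /B1 /D1 /E /=.
rewrite -/mm; rewrite (k2E It' Jr); ring.
Qed.

Lemma evolution_kl t r : a < t < 0 -> J r -> isT D
  (Lap D t r + 2 * (mm - 1) * D t r ^+ 2 + 2 * B t r ^+ 2 + 2 * C t r ^+ 2
   + 4 * q t r ^+ 2 * (C t r - D t r)) t r.
Proof.
move=> It Jr; have It' := Io It.
apply: (isT_ext (g := fun t r => (phi t r ^+ 2)^-1 - q t r ^+ 2)) => //.
  by move=> s Is; rewrite klE.
have P2 : phi t r ^+ 2 != 0 by rewrite expf_neq0// phiN.
apply: isD_eq (isD_sub (isD_inv (f := fun s => phi s r ^+ 2) P2 (isD_exp 2 (Tphi It Jr)))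
  (isD_exp 2 (Tq It Jr))) _.
rewrite /laplace SQE// SSDE// SBE// SDE// /B1 /D1 /E /=.
rewrite -/mm (k2E It' Jr) (klE It' Jr); field; exact: phiN.
Qed.

(** ** The rescaled differences *)

Let hat_phi f t r := f t r / phi t r ^+ 2.
Let hat_psi f t r := f t r / psi t r ^+ 2.

Let phi2 t r : I t -> J r -> phi t r ^+ 2 != 0.
Proof. by move=> It Jr; rewrite expf_neq0// phiN. Qed.
Let psi2 t r : I t -> J r -> psi t r ^+ 2 != 0.
Proof. by move=> It Jr; rewrite expf_neq0// psiN. Qed.

Let Chat_phi f : Crinf I J f -> Crinf I J (hat_phi f).
Proof.
move=> Cf; apply: Crinf_mul => //; apply: Crinf_inv => //.
exact: Crinf_exp.
Qed.
Let Chat_psi f : Crinf I J f -> Crinf I J (hat_psi f).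
Proof.
move=> Cf; apply: Crinf_mul => //; apply: Crinf_inv => //.
exact: Crinf_exp.
Qed.

(* Dividing by [phi^2] turns the terms of first order into the drift
   [4 q d/ds]; the terms of order [q^2] that appear cancel against those of
   the evolution equations. *)
Let drift_phi f t r : I t -> J r -> Crinf I J f ->
  Lap (hat_phi f) t r + 4 * q t r * S (hat_phi f) t r =
  Lap f t r / phi t r ^+ 2 - hat_phi f t r *
    (2 * (mm + 1) * q t r ^+ 2 - 2 * C t r - 2 * B t r).
Proof.
move=> It Jr Cf.
pose g t r := (S f t r - 2 * q t r * f t r) / phi t r ^+ 2.
have Sh x : J x -> S (hat_phi f) t x = g t x.
  move=> Jx; apply: SE => //.
  apply: isD_eq (isS_div (g := fun t r => phi t r ^+ 2) (phi2 It Jx)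
    (isSE It Jx Cf) (isS_exp 2 (Sphi It Jx))) _.
  by congr (_ * _); rewrite /g /=; field; exact: phiN.
have Sg : isS g ((S (S f) t r - 2 * (- C t r - q t r ^+ 2) * f t r
    - 4 * q t r * S f t r + 4 * q t r ^+ 2 * f t r) / phi t r ^+ 2) t r.
  have H : isS (fun t r => S f t r - 2 * q t r * f t r)
      (S (S f) t r - (2 * (- C t r - q t r ^+ 2) * f t r + 2 * q t r * S f t r)) t r.
    apply: isS_sub; first by apply: isSE => //; exact: CS.
    apply: (isS_mul (f := fun t r => 2 * q t r)); last exact: isSE.
    by apply: isS_scale; exact: Sq.
  apply: isD_eq (isS_div (g := fun t r => phi t r ^+ 2) (phi2 It Jr) H
    (isS_exp 2 (Sphi It Jr))) _.
  by congr (_ * _); rewrite /g /=; field; exact: phiN.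
rewrite /laplace Sh// (S_ext It Jr Sh) (SE It Jr Sg) /g /hat_phi (k2E It Jr) -/mm.
by field; exact: phiN.
Qed.

Let drift_psi f t r : I t -> J r -> Crinf I J f ->
  Lap (hat_psi f) t r + 4 * p t r * S (hat_psi f) t r =
  Lap f t r / psi t r ^+ 2 - hat_psi f t r *
    (4 * p t r ^+ 2 - 2 * A t r - 2 * mm * B t r).
Proof.
move=> It Jr Cf.
pose g t r := (S f t r - 2 * p t r * f t r) / psi t r ^+ 2.
have Sh x : J x -> S (hat_psi f) t x = g t x.
  move=> Jx; apply: SE => //.
  apply: isD_eq (isS_div (g := fun t r => psi t r ^+ 2) (psi2 It Jx)
    (isSE It Jx Cf) (isS_exp 2 (Spsi It Jx))) _.
  by congr (_ * _); rewrite /g /=; field; exact: psiN.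
have Sg : isS g ((S (S f) t r - 2 * (- A t r - p t r ^+ 2) * f t r
    - 4 * p t r * S f t r + 4 * p t r ^+ 2 * f t r) / psi t r ^+ 2) t r.
  have H : isS (fun t r => S f t r - 2 * p t r * f t r)
      (S (S f) t r - (2 * (- A t r - p t r ^+ 2) * f t r + 2 * p t r * S f t r)) t r.
    apply: isS_sub; first by apply: isSE => //; exact: CS.
    apply: (isS_mul (f := fun t r => 2 * p t r)); last exact: isSE.
    by apply: isS_scale; exact: Sp.
  apply: isD_eq (isS_div (g := fun t r => psi t r ^+ 2) (psi2 It Jr) H
    (isS_exp 2 (Spsi It Jr))) _.
  by congr (_ * _); rewrite /g /=; field; exact: psiN.
rewrite /laplace Sh// (S_ext It Jr Sh) (SE It Jr Sg) /g /hat_psi (k2E It Jr) -/mm.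
by field; exact: psiN.
Qed.

Let lap_sub f g t r : I t -> J r -> Crinf I J f -> Crinf I J g ->
  Lap (fun t r => f t r - g t r) t r = Lap f t r - Lap g t r.
Proof.
move=> It Jr Cf Cg.
have H x : J x -> S (fun t r => f t r - g t r) t x = S f t x - S g t x.
  by move=> Jx; apply: SE => //; apply: isS_sub; exact: isSE.
rewrite /laplace H// (@S_ext _ (fun t r => S f t r - S g t r))//.
have -> : S (fun t r => S f t r - S g t r) t r = S (S f) t r - S (S g) t r.
  by apply: SE => //; apply: isS_sub; apply: isSE => //; exact: CS.
move: (S (S f) t r) (S (S g) t r) (S f t r) (S g t r) (p t r) (q t r).
move=> x1 x2 x3 x4 x5 x6.
by ring.
Qed.

(** Each difference vanishes to second order on the singular orbit where the radius
    in the denominator does; the quotients satisfy a system in which every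
    reaction coefficient stays bounded, also the squared slopes below. *)
Definition Xh t r : R := (A t r - B t r) / phi t r ^+ 2.
Definition Yh t r : R := (B t r - C t r) / psi t r ^+ 2.
Definition Zh t r : R := (C t r - D t r) / phi t r ^+ 2.
Definition psi_slope t r : R := S psi t r ^+ 2 / phi t r ^+ 2.
Definition phi_slope t r : R := S phi t r ^+ 2 / psi t r ^+ 2.

Let Csub f g : Crinf I J f -> Crinf I J g -> Crinf I J (fun t r => f t r - g t r).
Proof. by move=> Cf Cg; apply: Crinf_add => //; exact: Crinf_opp. Qed.

Lemma Crinf_Xh : Crinf I J Xh.
Proof. by apply: Chat_phi; exact: Csub. Qed.
Lemma Crinf_Yh : Crinf I J Yh.
Proof. by apply: Chat_psi; exact: Csub. Qed.
Lemma Crinf_Zh : Crinf I J Zh.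
Proof. by apply: Chat_phi; exact: Csub. Qed.
Lemma Crinf_kl : Crinf I J D.
Proof. exact: CD. Qed.
Lemma Crinf_kt : Crinf I J A.
Proof. exact: CA. Qed.
Lemma Crinf_k1 : Crinf I J C.
Proof. exact: CC. Qed.
Lemma Crinf_k2 : Crinf I J B.
Proof. exact: CB. Qed.
Lemma Crinf_arcd f : Crinf I J f -> Crinf I J (S f).
Proof. exact: CS. Qed.

(** In the three equations the reaction terms that couple different quotients have
    nonnegative coefficients as soon as [B] is nonnegative. *)
Lemma evolution_Xh t r : a < t < 0 -> J r -> isT Xh
  (Lap Xh t r + 4 * q t r * S Xh t r
   + Xh t r * (2 * (mm - 1) * D t r + 2 * A t r + 2 * B t r - 2 * C t r)
   + 2 * (mm - 1) * B t r * Zh t r + 2 * psi_slope t r * Yh t r) t r.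
Proof.
move=> It Jr; have It' := Io It.
have T1 := isD_sub (evolution_kt It Jr) (evolution_k2 It Jr).
apply: isD_eq (isD_div (g := fun s => phi s r ^+ 2) (phi2 It' Jr) T1
  (isD_exp 2 (Tphi It Jr))) _.
have -> := drift_phi It' Jr (Csub CA CB); rewrite lap_sub// /Xh /Yh /Zh /psi_slope /=.
rewrite (_ : S psi t r = p t r * psi t r); last by rewrite /pp divfK ?psiN.
by rewrite /hat_phi; field; rewrite ?phiN ?psiN.
Qed.

Lemma evolution_Zh t r : a < t < 0 -> J r -> isT Zh
  (Lap Zh t r + 4 * q t r * S Zh t r
   + Zh t r * (4 * (mm - 1) * D t r)
   + 2 * B t r * Xh t r + 2 * psi_slope t r * Yh t r) t r.
Proof.
move=> It Jr; have It' := Io It.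
have T1 := isD_sub (evolution_k1 It Jr) (evolution_kl It Jr).
apply: isD_eq (isD_div (g := fun s => phi s r ^+ 2) (phi2 It' Jr) T1
  (isD_exp 2 (Tphi It Jr))) _.
have -> := drift_phi It' Jr (Csub CC CD); rewrite lap_sub// /Xh /Yh /Zh /psi_slope /=.
rewrite (_ : S psi t r = p t r * psi t r); last by rewrite /pp divfK ?psiN.
by rewrite /hat_phi; field; rewrite ?phiN ?psiN.
Qed.

Lemma evolution_Yh t r : a < t < 0 -> J r -> isT Yh
  (Lap Yh t r + 4 * p t r * S Yh t r
   + Yh t r * (2 * B t r + 2 * C t r - 2 * A t r + 2 * (mm - 1) * D t r)
   + 2 * phi_slope t r * (Xh t r + (mm - 1) * Zh t r)) t r.
Proof.
move=> It Jr; have It' := Io It.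
have T1 := isD_sub (evolution_k2 It Jr) (evolution_k1 It Jr).
apply: isD_eq (isD_div (g := fun s => psi s r ^+ 2) (psi2 It' Jr) T1
  (isD_exp 2 (Tpsi It Jr))) _.
have -> := drift_psi It' Jr (Csub CB CC); rewrite lap_sub// /Xh /Yh /Zh /phi_slope /=.
rewrite (_ : S phi t r = q t r * phi t r); last by rewrite /qq divfK ?phiN.
by rewrite /hat_psi; field; rewrite ?phiN ?psiN.
Qed.

Lemma evolution_kl_hat t r : a < t < 0 -> J r -> isT D
  (Lap D t r + 2 * (mm - 1) * D t r ^+ 2 + 2 * B t r ^+ 2 + 2 * C t r ^+ 2
   + 4 * S phi t r ^+ 2 * Zh t r) t r.
Proof.
move=> It Jr; have It' := Io It; apply: isD_eq (evolution_kl It Jr) _.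
rewrite (_ : S phi t r = q t r * phi t r); last by rewrite /qq divfK ?phiN.
by rewrite /Zh; field; exact: phiN.
Qed.

(** The singular orbits have codimension at least two, so minus the logarithm of
    the distance to them gives a supersolution that is infinite there. *)
Definition barrier t r : R := - ln (phi t r) - ln (psi t r).

Lemma Crinf_barrier : Crinf I J barrier.
Proof.
by apply: Csub; [apply: Crinf_opp => //|]; exact: Crinf_ln.
Qed.

Lemma arc_barrier t r : I t -> J r -> S barrier t r = - q t r - p t r.
Proof.
move=> It Jr; apply: SE => //.
apply: isD_eq (isD_sub (isD_opp (isD_ln (phi0 It Jr) (Sphi It Jr)))
  (isD_ln (psi0 It Jr) (Spsi It Jr))) _.
by field; rewrite phiN ?psiN.
Qed.

Lemma evolution_barrier t r : a < t < 0 -> J r -> isT barrier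
  (Lap barrier t r + (mm - 1) / phi t r ^+ 2) t r.
Proof.
move=> It Jr; have It' := Io It.
apply: isD_eq (isD_sub (isD_opp (isD_ln (phi0 It' Jr) (Tphi It Jr)))
  (isD_ln (psi0 It' Jr) (Tpsi It Jr))) _.
have Sb x : J x -> S barrier t x = (fun t r => - q t r - p t r) t x.
  by move=> Jx; exact: arc_barrier.
rewrite /laplace (@S_ext _ (fun t r => - q t r - p t r) t r)// Sb//.
rewrite (SE It' Jr (isS_sub (isS_opp (Sq It' Jr)) (Sp It' Jr))).
by rewrite (k2E It' Jr) (klE It' Jr) -/mm; field; rewrite phiN ?psiN.
Qed.

(** The first and second order conditions at a spatial minimum of [f + e w]
    express the derivatives of [f] by those of the weight [w] alone, so that the
    singular drift terms can be evaluated for [w]. *)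
Lemma min_conditions f w (e : R) t r : I t -> J r -> Crinf I J f -> Crinf I J w ->
  (forall x, J x -> f t r + e * w t r <= f t x + e * w t x) ->
  S f t r = - e * S w t r /\ - e * S (S w) t r <= S (S f) t r.
Proof.
move=> It Jr Cf Cw fmin.
have nJ : nbhs r J by apply: open_nbhs_nbhs.
have [||||H1 H2] := @min_second_derivative _ (fun x => f t x + e * w t x)
  (fun x => S f t x + e * S w t x) (chi t) r
  ((S (S f) t r + e * S (S w) t r) * chi t r).
- by apply: filterS nJ => x Jx; exact: chi0.
- apply: filterS nJ => x Jx; apply: (isS_add (g := fun t x => e * w t x)).
    exact: isSE.
  by apply: isS_scale; exact: isSE.
- apply: (isS_add (g := fun t x => e * S w t x)); first by apply: isSE => //; exact: CS.
  by apply: isS_scale; apply: isSE => //; exact: CS.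
- by apply: filterS nJ => x; exact: fmin.
split; first by apply/eqP; rewrite -subr_eq0 mulNr opprK H1.
by move: H2; rewrite pmulr_lge0 ?chi0// => H2; rewrite mulNr -subr_ge0 opprK.
Qed.

End Evolution.

(** * The maximum principle for the differences of curvatures *)

Section Reaction.
Context {R : realType}.
Implicit Types x y z b c A B C D k s n p q M N U : R.

(** The product of two bounded factors that are nonnegative up to a multiple of
    [b] is nonnegative up to a multiple of [b]; for [b = 0] this is the sign
    condition that makes the coupling [B Z] harmless. *)
Lemma mul_almost_ge0 x z b M L : 0 <= b -> 0 <= L -> `|x| <= M -> `|z| <= M ->
  - (b * L) <= x -> - b <= z -> - (b * (M + L * M)) <= x * z.
Proof.
move=> b0 L0 xM zM bx bz.
have M0 : 0 <= M by apply: le_trans xM.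
have bLM : 0 <= b * (L * M) by rewrite !mulr_ge0.
have bM : 0 <= b * M by rewrite mulr_ge0.
rewrite mulrDr.
have [x0|x0] := leP 0 x.
  have H1 : x * - b <= x * z by rewrite ler_wpM2l.
  have : b * x <= b * M by rewrite ler_wpM2l// (le_trans (ler_norm _)).
  by rewrite mulrN mulrC in H1; lra.
have H1 : x * M <= x * z.
  rewrite -subr_ge0 -mulrBr mulr_le0 ?(ltW x0)// subr_le0.
  exact: le_trans (ler_norm _) zM.
have H2 : - (b * L) * M <= x * M by rewrite ler_wpM2r.
by rewrite mulNr -mulrA in H2; lra.
Qed.

Lemma mul_ge_lower x y b c : 0 <= x <= c -> 0 <= b -> - b <= y -> - (c * b) <= x * y.
Proof.
move=> /andP[x0 xc] b0 yb.
have H1 : x * - b <= x * y by rewrite ler_wpM2l.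
have H2 : x * b <= c * b by rewrite ler_wpM2r.
by rewrite mulrN in H1; lra.
Qed.

(** The reaction terms at a point where one of the four quantities reaches [- b]
    while the others are at least [- b]: they exceed [- 36 U - b], with [U] a
    constant multiple of [b]. *)
Lemma reaction_X n x D A B C z k y b M U : x = - b ->
  - (b * (2 * (n * M) + 6 * M)) <=
    b * - (2 * (n - 1) * D + 2 * A + 2 * B - 2 * C) ->
  M * b <= U -> n * (M * b) <= U -> - U <= (n - 1) * (B * z) ->
  - (M * b) <= k * y -> 0 < U -> 0 < b ->
  - (36 * U) < x * (2 * (n - 1) * D + 2 * A + 2 * B - 2 * C)
    + 2 * (n - 1) * B * z + 2 * k * y + b.
Proof. by move=> ->; lra. Qed.

Lemma reaction_Y n x D A B C z k y b M U : y = - b ->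
  - (b * (2 * (n * M) + 6 * M)) <=
    b * - (2 * B + 2 * C - 2 * A + 2 * (n - 1) * D) ->
  M * b <= U -> n * (M * b) <= U -> - U <= (n - 1) * (k * z) ->
  - (M * b) <= k * x -> 0 < U -> 0 < b ->
  - (36 * U) < y * (2 * B + 2 * C - 2 * A + 2 * (n - 1) * D)
    + 2 * k * (x + (n - 1) * z) + b.
Proof. by move=> ->; lra. Qed.

Lemma reaction_Z n x D B z k y b M N U : z = - b ->
  - (b * (4 * (n * M))) <= b * - (4 * (n - 1) * D) ->
  M * b <= U -> b * N <= U -> n * (M * b) <= U -> - (b * N) <= B * x ->
  - (M * b) <= k * y -> 0 < U -> 0 < b ->
  - (36 * U) < z * (4 * (n - 1) * D) + 2 * B * x + 2 * k * y + b.
Proof. by move=> ->; lra. Qed.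

Lemma reaction_D n D B C s z b M U : 0 <= (n - 1) * D ^+ 2 ->
  M * b <= U -> - (M * b) <= s * z -> 0 < U -> 0 < b ->
  - (36 * U) < 2 * (n - 1) * D ^+ 2 + 2 * B ^+ 2 + 2 * C ^+ 2 + 4 * s * z + b.
Proof. by move: (sqr_ge0 B) (sqr_ge0 C); lra. Qed.

(** The drift acts on the barrier by [- 4 q (- q - p) = 4 q^2 + 4 p q], where the
    unbounded part is nonnegative and [p q = - B] is bounded. *)
Lemma drift_ge B p q M : B = - (p * q) -> B <= M -> 0 <= q ^+ 2 ->
  - (4 * M) <= - (4 * q) * (- q - p).
Proof. by move=> ->; lra. Qed.

Lemma reaction_coef_X n A B C D M : (n - 1) * D <= n * M -> A <= M -> B <= M ->
  - M <= C ->
  - (2 * (n * M) + 6 * M) <= - (2 * (n - 1) * D + 2 * A + 2 * B - 2 * C).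
Proof. by lra. Qed.

Lemma reaction_coef_Y n A B C D M : (n - 1) * D <= n * M -> - M <= A -> B <= M ->
  C <= M ->
  - (2 * (n * M) + 6 * M) <= - (2 * B + 2 * C - 2 * A + 2 * (n - 1) * D).
Proof. by lra. Qed.

Lemma reaction_coef_Z n D M : (n - 1) * D <= n * M ->
  - (4 * (n * M)) <= - (4 * (n - 1) * D).
Proof. by lra. Qed.

End Reaction.

Section Positivity.
Context {R : realType} (m : nat) (m0 : (0 < m)%N) (a : R).
Variables (chi psi phi : R -> R -> R).
Implicit Types (f g : R -> R -> R) (t r : R).
Let I : set R := [set t | a <= t < 0].
Let J : set R := [set r | 0 < r < pi / 2].
Let mm : R := m%:R.

Local Notation S := (arcd chi).
Local Notation A := (kt chi psi).
Local Notation B := (k2 chi psi phi).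
Local Notation C := (k1 chi phi).
Local Notation D := (kl chi phi).
Local Notation p := (pp chi psi).
Local Notation q := (qq chi phi).
Local Notation Lap := (laplace chi psi phi m).
Local Notation X := (Xh chi psi phi).
Local Notation Y := (Yh chi psi phi).
Local Notation Z := (Zh chi phi).
Local Notation w := (barrier psi phi).

Hypothesis chi0 : forall t r, I t -> J r -> 0 < chi t r.
Hypothesis psi0 : forall t r, I t -> J r -> 0 < psi t r.
Hypothesis phi0 : forall t r, I t -> J r -> 0 < phi t r.
Hypothesis Cchi : Crinf I J chi.
Hypothesis Cpsi : Crinf I J psi.
Hypothesis Cphi : Crinf I J phi.
Hypothesis Tchi : forall t r, a < t < 0 -> J r ->
  is_derive t 1 (chi ^~ r) (- chi t r * (A t r + mm * C t r)).
Hypothesis Tpsi : forall t r, a < t < 0 -> J r ->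
  is_derive t 1 (psi ^~ r) (- psi t r * (A t r + mm * B t r)).
Hypothesis Tphi : forall t r, a < t < 0 -> J r ->
  is_derive t 1 (phi ^~ r)
    (- phi t r * (C t r + B t r + (mm - 1) * D t r)).

Variables (T M delta : R).
Hypotheses (aT : a <= T) (T0 : T < 0) (M1 : 1 <= M) (delta0 : 0 < delta).
Hypothesis bounds : forall t r, a <= t <= T -> J r ->
  [/\ `|A t r| <= M, `|B t r| <= M, `|C t r| <= M & `|D t r| <= M] /\
  [/\ `|X t r| <= M, `|Y t r| <= M & `|Z t r| <= M] /\
  [/\ psi_slope chi psi phi t r <= M, phi_slope chi psi phi t r <= M, S phi t r ^+ 2 <= M,
      psi t r <= M & phi t r <= M].
Hypothesis edge : forall N, exists d1 d2 : R, [/\ 0 < d1, d2 < pi / 2 &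
  forall t r, a <= t <= T -> J r -> ~~ (d1 <= r <= d2) -> N <= w t r].
Hypothesis init : forall r, J r ->
  [/\ 0 <= X a r, 0 <= Y a r, 0 <= Z a r & delta <= D a r].

(* [L] controls [B = D + psi^2 Y + phi^2 Z] from below, [N] the products with
   [B], and [K] is large enough for the growth of [exp (K t)] to dominate all
   reaction terms; [c] makes [w + c] at least [1]. *)
Let L : R := 1 + 2 * M ^+ 2.
Let N : R := M + L * M.
Let K : R := 1 + 40 * (mm * N).
Let c : R := 1 + 2 * ln M.

Let w_ge t r : a <= t <= T -> J r -> 1 <= w t r + c.
Proof.
move=> tI Jr; have It : I t by case/andP: tI => ? ?; apply/andP; split=> //; apply: le_lt_trans T0.
have [_ [_ [_ _ _ psiM phiM]]] := bounds tI Jr.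
have M0 : 0 < M by apply: lt_le_trans M1.
have H1 : ln (phi t r) <= ln M by rewrite ler_ln ?posrE// phi0.
have H2 : ln (psi t r) <= ln M by rewrite ler_ln ?posrE// psi0.
by rewrite /barrier /c; lra.
Qed.

(* the four quantities that stay nonnegative *)
Let base (i : 'I_4) : R -> R -> R :=
  match val i with 0%N => X | 1%N => Y | 2%N => Z | _ => fun t r => D t r - delta end.

Section Epsilon.
Variables (eps : R) (eps0 : 0 < eps).

Let e t : R := eps * expR (K * (t - a)).
Let F (i : 'I_4) t r := base i t r + e t * (w t r + c).

Let e0 t : 0 < e t.
Proof. by rewrite mulr_gt0// expR_gt0. Qed.

Let Te t : is_derive t 1 e (K * e t).
Proof.
have H : is_derive t (1 : R) (fun t => K * (t - a)) K.
  apply: isD_eq (isD_mul (isD_cst t K) (isD_sub (isD_id t) (isD_cst t a))) _.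
  by rewrite mul0r add0r subr0 mulr1.
apply: isD_eq (isD_mul (isD_cst t eps) (isD_comp H (is_derive_expR _))) _.
by rewrite mul0r add0r /e; ring.
Qed.

(* At a spatial minimum of [f + e w] where [f + e (w + c)] vanishes, the Laplacian
   of [f] is compared with that of the barrier; what is left of the time
   derivative is the reaction [rho], which the growth of [e] dominates. *)
Let touch_value f t r (k rho : R) :
  a < t <= T -> J r -> Crinf I J f ->
  (forall x, J x -> f t r + e t * w t r <= f t x + e t * w t x) ->
  is_derive t 1 (f ^~ r) (Lap f t r + k * S f t r + rho) ->
  - (4 * M) <= - k * S w t r ->
  - (e t * (w t r + c)) * (36 * (mm * N)) < rho + e t * (w t r + c) ->
  exists2 ft, is_derive t 1 (fun t => f t r + e t * (w t r + c)) ft & 0 < ft.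
Proof.
move=> /andP[at_ tT] Jr Cf fmin Tf kw hrho.
have tI : a <= t <= T by rewrite ltW.
have It : a < t < 0 by rewrite at_ (le_lt_trans tT).
have It' : I t by case/andP: It => /ltW ? ?; apply/andP.
have Cw : Crinf I J w by exact: Crinf_barrier.
have Tw : is_derive t 1 (w ^~ r) (Lap w t r + (mm - 1) / phi t r ^+ 2).
  by apply: (evolution_barrier (a := a)).
have [S1 S2] : S f t r = - e t * S w t r /\ - e t * S (S w) t r <= S (S f) t r.
  by apply: (min_conditions (a := a)) fmin.
eexists; first exact: isD_add Tf (isD_mul (Te t) (isD_add Tw (isD_cst t c))).
rewrite addr0 /laplace S1.
have W1 := w_ge tI Jr; have et := e0 t.
have N1 : M <= mm * N.
  have mm1 : 1 <= mm by rewrite /mm ler1n.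
  have MN : M <= N.
    by rewrite /N lerDl mulr_ge0 ?(le_trans _ M1)// /L addr_ge0// mulr_ge0// sqr_ge0.
  by rewrite -[M]mul1r ler_pM// (le_trans _ M1).
have H3 : 0 <= e t * ((mm - 1) / phi t r ^+ 2).
  by rewrite mulr_ge0 ?(ltW et)// divr_ge0 ?sqr_ge0// subr_ge0 /mm ler1n.
have H4 : e t * - (4 * M) <= e t * (- k * S w t r) by rewrite ler_pM2l.
have eW : e t <= e t * (w t r + c) by rewrite ler_peMr// ltW.
have H5 : e t * M <= e t * (w t r + c) * (mm * N).
  by apply: ler_pM => //; [exact: ltW|exact: le_trans M1].
move: S2 H3 H4 H5 hrho; rewrite /K.
set SSf := S (S f) t r; set SSw := S (S w) t r; set Sw := S w t r.
set h := (mm - 1) / _; set W := w t r + c; set E := e t.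
set U := mm * N; set pq := _ + m%:R * _; move=> S2 H3 H4 H5 hrho.
have -> : SSf + pq * (- E * Sw) + k * (- E * Sw) + rho
    + ((1 + 40 * U) * E * W + E * (SSw + pq * Sw + h))
  = (SSf - - E * SSw) + (rho + E * W + E * W * (36 * U))
    + E * h + E * (- k * Sw) + 4 * (E * W * U) by ring.
have : 0 < rho + E * W + E * W * (36 * U).
  by move: hrho; rewrite mulNr; lra.
have : E * - (4 * M) = - (4 * (E * M)) by ring.
lra.
Qed.

Let F_touch i t r : a < t <= T -> J r -> F i t r = 0 ->
  (forall j x, J x -> 0 <= F j t x) ->
  exists2 ft, is_derive t 1 (F i ^~ r) ft & 0 < ft.
Proof.
move=> tI' Jr Fi Fge; have /andP[at_ tT] := tI'.
have tI : a <= t <= T by rewrite ltW.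
have It : a < t < 0 by rewrite at_ (le_lt_trans tT).
have It' : I t by case/andP: It => /ltW ? ?; apply/andP.
have fmin x : J x -> base i t r + e t * w t r <= base i t x + e t * w t x.
  by move=> Jx; move: Fi (Fge i x Jx); rewrite /F; lra.
have [[AM BM CM DM] [[XM YM ZM] [kM lM sM psM phM]]] := bounds tI Jr.
have k0 : 0 <= psi_slope chi psi phi t r by rewrite divr_ge0 ?sqr_ge0.
have l0 : 0 <= phi_slope chi psi phi t r by rewrite divr_ge0 ?sqr_ge0.
have M0 : 0 < M by apply: lt_le_trans M1.
have mm1 : 1 <= mm by rewrite /mm ler1n.
have L1 : 1 <= L by rewrite /L lerDl mulr_ge0// sqr_ge0.
have N0 : 0 < N by rewrite addr_gt0// mulr_gt0// (lt_le_trans _ L1).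
have MN : M <= N by rewrite /N lerDl mulr_ge0 ?(ltW M0)// (le_trans _ L1).
set b := e t * (w t r + c).
have b0 : 0 < b by rewrite mulr_gt0// (lt_le_trans _ (w_ge tI Jr)).
have Xb : - b <= X t r by have := Fge 0 r Jr; rewrite /F /base/= -/b; lra.
have Yb : - b <= Y t r by have := Fge 1 r Jr; rewrite /F /base/= -/b; lra.
have Zb : - b <= Z t r.
  by have := Fge (Ordinal (isT : (2 < 4)%N)) r Jr; rewrite /F /base/= -/b; lra.
have Db : - b <= D t r.
  have := Fge (Ordinal (isT : (3 < 4)%N)) r Jr; rewrite /F /base/= -/b.
  by move: delta0; lra.
have u2 : 0 <= phi t r ^+ 2 <= M ^+ 2.
  by rewrite sqr_ge0 ler_sqr ?nnegrE ?(ltW M0) ?(ltW (phi0 It' Jr)).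
have v2 : 0 <= psi t r ^+ 2 <= M ^+ 2.
  by rewrite sqr_ge0 ler_sqr ?nnegrE ?(ltW M0) ?(ltW (psi0 It' Jr)).
have BE : B t r = D t r + psi t r ^+ 2 * Y t r + phi t r ^+ 2 * Z t r.
  by rewrite /Yh /Zh; field; rewrite !gt_eqF ?psi0 ?phi0.
have Bb : - (b * L) <= B t r.
  have H1 := mul_ge_lower u2 (ltW b0) Zb; have H2 := mul_ge_lower v2 (ltW b0) Yb.
  by rewrite BE /L mulrDr; move: H1 H2 Db; lra.
have L0 : 0 <= L by exact: le_trans L1.
have BX := mul_almost_ge0 (ltW b0) L0 BM XM Bb Xb.
have BZ := mul_almost_ge0 (ltW b0) L0 BM ZM Bb Zb.
rewrite -/N in BX BZ.
have kY : - (M * b) <= psi_slope chi psi phi t r * Y t r.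
  by apply: mul_ge_lower => //; [rewrite k0|exact: ltW].
have lX : - (M * b) <= phi_slope chi psi phi t r * X t r.
  by apply: mul_ge_lower => //; [rewrite l0|exact: ltW].
have lZ : - (M * b) <= phi_slope chi psi phi t r * Z t r.
  by apply: mul_ge_lower => //; [rewrite l0|exact: ltW].
have sZ : - (M * b) <= S phi t r ^+ 2 * Z t r.
  by apply: mul_ge_lower => //; [rewrite sqr_ge0|exact: ltW].
have mD : `|(mm - 1) * D t r| <= mm * M.
  by rewrite normrM ler_pM// ger0_norm ?subr_ge0// gerBl.
pose U := b * (mm * N).
have bM : M * b <= U.
  rewrite /U mulrC ler_pM2l// -[M]mul1r ler_pM// ltW//.
have bN : b * N <= U by rewrite /U ler_pM2l// -[X in X <= _]mul1r ler_pM2r.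
have bmM : mm * (M * b) <= U.
  rewrite (_ : mm * (M * b) = b * (mm * M)); last by ring.
  by rewrite /U ler_pM2l// ler_pM2l// (lt_le_trans ltr01 mm1).
have U0 : 0 < U by apply: mulr_gt0 => //; apply: mulr_gt0 => //; exact: lt_le_trans mm1.
have qq0 : 0 <= q t r ^+ 2 by rewrite sqr_ge0.
have pp0 : 0 <= p t r ^+ 2 by rewrite sqr_ge0.
have Sw : S w t r = - q t r - p t r by apply: (arc_barrier (a := a)).
have B_pq : B t r = - (p t r * q t r) by apply: (k2E (a := a)).
have Bnorm : B t r <= M by move: BM; rewrite ler_norml => /andP[].
have drift1 : - (4 * M) <= - (4 * q t r) * S w t r.
  by rewrite Sw; exact: drift_ge B_pq Bnorm qq0.
have drift2 : - (4 * M) <= - (4 * p t r) * S w t r.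
  rewrite Sw addrC; apply: drift_ge Bnorm pp0.
  by rewrite B_pq mulrC.
have [ANl ANr] : - M <= A t r /\ A t r <= M by move: AM; rewrite ler_norml => /andP.
have [CNl CNr] : - M <= C t r /\ C t r <= M by move: CM; rewrite ler_norml => /andP.
have [BNl BNr] : - M <= B t r /\ B t r <= M by move: BM; rewrite ler_norml => /andP.
have [DNl DNr] : - (mm * M) <= (mm - 1) * D t r /\ (mm - 1) * D t r <= mm * M.
  by move: mD; rewrite ler_norml => /andP.
have mBZ : - U <= (mm - 1) * (B t r * Z t r).
  have : 0 <= mm - 1 <= mm by rewrite subr_ge0 mm1 gerBl ler01.
  move=> /mul_ge_lower/(_ _ BZ); rewrite (_ : mm * (b * N) = U); last first.
    by rewrite /U; ring.
  by apply; rewrite mulr_ge0// ltW.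
have mlZ : - U <= (mm - 1) * (phi_slope chi psi phi t r * Z t r).
  have : 0 <= mm - 1 <= mm by rewrite subr_ge0 mm1 gerBl ler01.
  move=> /mul_ge_lower/(_ _ lZ) H; apply: le_trans (H _); last first.
    by rewrite mulr_ge0// ltW.
  by rewrite lerN2.
have bC c0 c1 : - c0 <= c1 -> - (b * c0) <= b * c1.
  by move=> H; rewrite -mulrN ler_pM2l.
have Uge : - b * (36 * (mm * N)) = - (36 * U) by rewrite /U; ring.
case: i Fi fmin => -[|[|[|[|//]]]] hi; rewrite /F /base /= -/b => Fi fmin.
- have Xi : X t r = - b by apply/eqP; rewrite -addr_eq0 Fi.
  have CX : Crinf I J X by exact: (Crinf_Xh (a := a)).
  apply: (touch_value (f := X) (k := 4 * q t r)
    (rho := X t r * (2 * (mm - 1) * D t r + 2 * A t r + 2 * B t r - 2 * C t r)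
    + 2 * (mm - 1) * B t r * Z t r + 2 * psi_slope chi psi phi t r * Y t r) tI' Jr CX fmin _ drift1 _).
  + apply: isD_eq (evolution_Xh chi0 psi0 phi0 Cchi Cpsi Cphi Tchi Tpsi Tphi It Jr) _.
    by rewrite -/mm -!addrA.
  + rewrite -/b Uge.
    have /bC H : - (2 * (mm * M) + 6 * M) <=
      - (2 * (mm - 1) * D t r + 2 * A t r + 2 * B t r - 2 * C t r).
      exact: reaction_coef_X.
    exact: (reaction_X Xi H bM bmM mBZ kY).
- have Yi : Y t r = - b by apply/eqP; rewrite -addr_eq0 Fi.
  have CX : Crinf I J Y by exact: (Crinf_Yh (a := a)).
  apply: (touch_value (f := Y) (k := 4 * p t r)
    (rho := Y t r * (2 * B t r + 2 * C t r - 2 * A t r + 2 * (mm - 1) * D t r)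
    + 2 * phi_slope chi psi phi t r * (X t r + (mm - 1) * Z t r)) tI' Jr CX fmin _ drift2 _).
  + apply: isD_eq (evolution_Yh chi0 psi0 phi0 Cchi Cpsi Cphi Tchi Tpsi Tphi It Jr) _.
    by rewrite -/mm -!addrA.
  + rewrite -/b Uge.
    have /bC H : - (2 * (mm * M) + 6 * M) <=
      - (2 * B t r + 2 * C t r - 2 * A t r + 2 * (mm - 1) * D t r).
      exact: reaction_coef_Y.
    exact: (reaction_Y Yi H bM bmM mlZ lX).
- have Zi : Z t r = - b by apply/eqP; rewrite -addr_eq0 Fi.
  have CX : Crinf I J Z by exact: (Crinf_Zh (a := a)).
  apply: (touch_value (f := Z) (k := 4 * q t r)
    (rho := Z t r * (4 * (mm - 1) * D t r)
    + 2 * B t r * X t r + 2 * psi_slope chi psi phi t r * Y t r) tI' Jr CX fmin _ drift1 _).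
  + apply: isD_eq (evolution_Zh chi0 psi0 phi0 Cchi Cpsi Cphi Tchi Tphi It Jr) _.
    by rewrite -/mm -!addrA.
  + rewrite -/b Uge.
    have /bC H : - (4 * (mm * M)) <= - (4 * (mm - 1) * D t r).
      exact: reaction_coef_Z.
    exact: (reaction_Z Zi H bM bN bmM BX kY).
- have fmin' x : J x -> D t r + e t * w t r <= D t x + e t * w t x.
    by move=> /fmin; rewrite !(addrAC _ (- delta)) lerD2r.
  have drift0 : - (4 * M) <= - 0 * S w t r.
    by rewrite oppr0 mul0r oppr_le0 mulr_ge0// ltW.
  have CDl : Crinf I J D by exact: Crinf_kl.
  have [||ft H ft0] := touch_value (f := D) (k := 0) (rho := 2 * (mm - 1) * D t r ^+ 2
    + 2 * B t r ^+ 2 + 2 * C t r ^+ 2 + 4 * S phi t r ^+ 2 * Z t r)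
    tI' Jr CDl fmin' _ drift0 _.
  + apply: isD_eq (evolution_kl_hat chi0 psi0 phi0 Cchi Cpsi Cphi Tchi Tphi It Jr) _.
    by rewrite -/mm mul0r addr0 -!addrA.
  + rewrite -/b Uge.
    have D2 : 0 <= (mm - 1) * D t r ^+ 2 by rewrite mulr_ge0 ?sqr_ge0// subr_ge0.
    exact: (reaction_D _ _ D2 bM sZ).
  + exists ft => //; apply: (isD_ext _ (isD_eq (isD_sub H (isD_cst t delta)) (subr0 _))).
    by move=> s; rewrite addrAC.
Qed.

Let IT : set R := [set t | a <= t <= T].

Let ITI : IT `<=` I.
Proof. by move=> t /andP[? tT]; apply/andP; split=> //; exact: le_lt_trans T0. Qed.

Let cF i : cts IT J (F i).
Proof.
apply: cts_add; last first.
  apply: cts_mul; first by apply: cts_time => t _; exact: isD_cont (Te t).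
  apply: cts_add; last exact: cts_cst.
  by apply: cts_sub ITI (@subset_refl _ _) _; apply: Crinf_cts; exact: Crinf_barrier.
have Cb f : Crinf I J f -> cts IT J f.
  by move=> Cf; apply: cts_sub ITI (@subset_refl _ _) (Crinf_cts Cf).
have CD : Crinf I J D by exact: Crinf_kl.
case: i => -[|[|[|[|//]]]] hi; rewrite /base /=.
- by apply: Cb; exact: (Crinf_Xh chi0).
- by apply: Cb; exact: (Crinf_Yh chi0).
- by apply: Cb; exact: (Crinf_Zh chi0).
- by apply: cts_add; [exact: Cb|exact: cts_cst].
Qed.

Let F_pos i t r : a <= t <= T -> J r -> 0 < F i t r.
Proof.
move=> tI Jr.
have M0 : 0 < M by apply: lt_le_trans M1.
have eW s x : a <= s <= T -> J x -> 0 < e s * (w s x + c).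
  by move=> sI Jx; rewrite mulr_gt0// (lt_le_trans ltr01) ?w_ge.
have eps_e s : a <= s <= T -> eps <= e s.
  move=> /andP[as_ _]; rewrite /e ler_peMr// ?(ltW eps0)//.
  have L0 : 0 < L by rewrite /L addr_gt0// mulr_gt0// exprn_gt0.
  have N0 : 0 < N by rewrite /N addr_gt0// mulr_gt0.
  have mm0 : 0 < mm by rewrite /mm ltr0n.
  have K0 : 0 < K by rewrite /K addr_gt0// mulr_gt0// mulr_gt0.
  by rewrite -[X in X <= _]expR0 ler_expR mulr_ge0 ?(ltW K0)// subr_ge0.
have base_ge j s x : a <= s <= T -> J x -> - (M + delta) <= base j s x.
  move=> sI Jx; have [[_ _ _ DM] [[XM YM ZM] _]] := bounds sI Jx.
  have low y : `|y| <= M -> - (M + delta) <= y.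
    by rewrite ler_norml => /andP[H _]; apply: le_trans H; rewrite lerN2 lerDl ltW.
  case: j => -[|[|[|[|//]]]] hi; rewrite /base /=; try exact: low.
  by rewrite opprD lerD2r; move: DM; rewrite ler_norml => /andP[].
have [d1 [d2 [d10 d2p edges]]] := edge ((M + delta + 1) / eps - c).
apply: (@first_touching_time _ 4 F a T 0 (pi / 2) d1 d2) => //.
- move=> j x Jx; have aI : a <= a <= T by rewrite lexx.
  rewrite ltr_wpDl ?eW//; have [X0 Y0 Z0 D0] := init Jx.
  by case: j => -[|[|[|[|//]]]] hi; rewrite /base /= ?subr_ge0.
- move=> j s x sI Jx dx; have := edges s x sI Jx dx.
  rewrite lerBlDr ler_pdivrMr// => H.
  have H2 : (w s x + c) * eps <= e s * (w s x + c).
    by rewrite mulrC ler_pM2r ?eps_e// (lt_le_trans ltr01) ?w_ge.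
  have := base_ge j s x sI Jx; rewrite /F.
  by move: (le_trans H H2); lra.
Qed.

Lemma eps_positivity i t r : a <= t <= T -> J r ->
  - (e t * (w t r + c)) < base i t r.
Proof. by move=> tI Jr; rewrite -subr_gt0 opprK; exact: F_pos. Qed.

End Epsilon.

(** The maximum principle, applied to the quantities increased by
    [eps exp (K (t - a)) (w + c)], which is infinite at the singular orbits, gives
    positivity for every [eps]. *)
Lemma positivity t r : a <= t <= T -> J r ->
  [/\ 0 <= X t r, 0 <= Y t r, 0 <= Z t r & delta <= D t r].
Proof.
move=> tI Jr.
have H i : 0 <= base i t r.
  rewrite leNgt; apply/negP => b0.
  pose W := expR (K * (t - a)) * (w t r + c).
  have W0 : 0 < W by rewrite mulr_gt0 ?expR_gt0// (lt_le_trans ltr01) ?w_ge.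
  have e0 : 0 < - base i t r / W by rewrite divr_gt0// oppr_gt0.
  have := eps_positivity e0 i tI Jr; rewrite -mulrA -/W divfK ?gt_eqF//.
  by rewrite opprK ltxx.
split; [exact: (H 0)|exact: (H 1)|exact: (H (Ordinal (isT : (2 < 4)%N)))|].
by have := H (Ordinal (isT : (3 < 4)%N)); rewrite /base /= subr_ge0.
Qed.

End Positivity.

(** * Asymptotics at a singular orbit *)

Section Orders.
Context {R : realType} (I : set R) (t0 T r0 : R).
Hypothesis ITI : forall t, t0 <= t <= T -> I t.
Implicit Types (f g : R -> R -> R) (t r : R) (k : nat).

Let smooth f := Crinf I setT f.
Let openR : open (setT : set R) := openT.

(** Order of vanishing at [r0], uniform on the time interval. *)
Definition vanish k f := exists2 M, 0 < M &
  forall t r, t0 <= t <= T -> `|r - r0| <= 1 -> `|f t r| <= M * `|r - r0| ^+ k.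

Lemma vanish0 f : smooth f -> vanish 0 f.
Proof.
move=> /Crinf_cts cf.
have [M M0 H] := @cts_bounded _ I setT t0 T (r0 - 1) (r0 + 1) f ITI (fun _ _ => Logic.I) cf.
exists M => // t r tI; rewrite ler_distl => rd; rewrite expr0 mulr1; exact: H.
Qed.

Lemma vanish_add k f g : vanish k f -> vanish k g ->
  vanish k (fun t r => f t r + g t r).
Proof.
move=> [M M0 H] [N N0 H']; exists (M + N); first exact: addr_gt0.
move=> t r tI rd; rewrite mulrDl (le_trans (ler_normD _ _))// lerD//; [exact: H|exact: H'].
Qed.

Lemma vanish_opp k f : vanish k f -> vanish k (fun t r => - f t r).
Proof. by move=> [M M0 H]; exists M => // t r tI rd; rewrite normrN H. Qed.

Lemma vanish_mul j k f g : vanish j f -> vanish k g ->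
  vanish (j + k) (fun t r => f t r * g t r).
Proof.
move=> [M M0 H] [N N0 H']; exists (M * N); first exact: mulr_gt0.
by move=> t r tI rd; rewrite normrM exprD mulrACA ler_pM// ?H ?H'.
Qed.

Lemma vanish_scale k (c : R) f : vanish k f -> vanish k (fun t r => c * f t r).
Proof.
move=> [M M0 H]; exists ((`|c| + 1) * M); first by rewrite mulr_gt0// ltr_wpDl.
move=> t r tI rd; rewrite normrM -mulrA ler_pM// ?lerDl//; exact: H.
Qed.

Lemma vanish_int k f g : (forall t r, I t -> is_derive r 1 (f t) (g t r)) ->
  (forall t, I t -> f t r0 = 0) -> vanish k g -> vanish k.+1 f.
Proof.
move=> fg f0 [M M0 H]; exists M => // t r tI rd.
have [|c cI] := @mean_value _ (f t) (g t) r0 r.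
  by move=> x _; apply: fg; exact: ITI.
rewrite (f0 t (ITI tI)) subr0 => ->.
have cr : `|c - r0| <= `|r - r0|.
  have [r0r|rr0] := leP r0 r.
    move: cI; rewrite min_l// max_r// => /andP[c1 c2].
    by rewrite !ger0_norm ?subr_ge0// lerD2r.
  move: cI; rewrite min_r ?(ltW rr0)// max_l ?(ltW rr0)// => /andP[c1 c2].
  by rewrite !ler0_norm ?subr_le0 ?(ltW rr0)// lerN2 lerD2r.
rewrite normrM exprSr mulrA ler_wpM2r//.
rewrite (le_trans (H _ _ tI (le_trans cr rd)))// ler_pM2l//.
by rewrite lerXn2r ?nnegrE.
Qed.

Definition parity (c : R) f := forall t r, I t -> f t (2 * r0 - r) = c * f t r.

(** The smoothness of the metric across a singular orbit enters through parity: every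
    second Taylor coefficient vanishes. *)
Lemma parity_dr c f : smooth f -> parity c f -> parity (- c) (dr f).
Proof.
move=> Cf pf t r It.
have D1 : is_derive r (1 : R) (fun r => f t (2 * r0 - r)) (- dr f t (2 * r0 - r)).
  have H : is_derive r (1 : R) (fun r => 2 * r0 - r) (- 1).
    by apply: isD_eq (isD_sub (isD_cst r (2 * r0)) (isD_id r)) _; rewrite sub0r.
  apply: isD_eq (isD_comp H (Crinf_isD Cf It _)) _ => //.
  by rewrite mulrN mulr1.
have D2 : is_derive r (1 : R) (fun r => f t (2 * r0 - r)) (c * dr f t r).
  apply: (isD_ext (g := fun r => c * f t r)) => [x|]; first exact: pf.
  apply: isD_eq (isD_mul (isD_cst r c) (Crinf_isD Cf It _)) _ => //.
  by rewrite mul0r add0r.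
by rewrite mulNr -(isD_uniq D1 D2) opprK.
Qed.

Lemma parity_mul c d f g : parity c f -> parity d g ->
  parity (c * d) (fun t r => f t r * g t r).
Proof. by move=> pf pg t r It; rewrite pf// pg//; ring. Qed.

Lemma parity_add c f g : parity c f -> parity c g ->
  parity c (fun t r => f t r + g t r).
Proof. by move=> pf pg t r It; rewrite pf// pg// mulrDr. Qed.

Lemma parity_opp c f : parity c f -> parity c (fun t r => - f t r).
Proof. by move=> pf t r It; rewrite pf// mulrN. Qed.

Lemma odd_at f : parity (- 1) f -> forall t, I t -> f t r0 = 0.
Proof.
move=> pf t It; have := pf t r0 It.
rewrite (_ : 2 * r0 - r0 = r0); last by ring.
by rewrite mulN1r => H; lra.
Qed.

Lemma odd_vanish f : smooth f -> parity (- 1) f -> vanish 1 f.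
Proof.
move=> Cf pf; apply: vanish_int (odd_at pf) (vanish0 (Crinf_dr Cf)) => t r It.
exact: Crinf_isD.
Qed.

Lemma even_dr_vanish f : smooth f -> parity 1 f -> vanish 1 (dr f).
Proof. by move=> Cf pf; apply: odd_vanish; [exact: Crinf_dr|exact: parity_dr]. Qed.

End Orders.

Section Identities.
Context {R : realType}.

Lemma second_order_identity (n0 n1 n2 n3 f0 f1 f2 f3 : R) :
  n3 * f0 + n2 * f1 - (n2 * f1 + n1 * f2)
  - (0 * (n0 * f2) + 2 * (n1 * f2 + n0 * f3))
  = n3 * f0 + (- (3 * (n1 * f2)) + - (2 * (n0 * f3))).
Proof. ring. Qed.

Lemma first_order_identity (n0 n1 n2 f0 f1 f2 : R) :
  n2 * f0 + n1 * f1 - (0 * (n0 * f1) + 2 * (n1 * f1 + n0 * f2))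
  = n2 * f0 - n1 * f1 - 2 * (n0 * f2).
Proof. ring. Qed.

Lemma wronskian_identity (g1 g2 g3 f0 f1 f2 : R) :
  g3 * f0 + g2 * f1 - (g2 * f1 + g1 * f2) = g3 * f0 + - (g1 * f2).
Proof. ring. Qed.

End Identities.

Section Collapse.
Context {R : realType} (a t0 T r0 : R) (h f g : R -> R -> R).
Implicit Types (F G : R -> R -> R) (t r : R).
Let I : set R := [set t | a <= t < 0].
Let J : set R := [set r | 0 < r < pi / 2].
Hypotheses (at0 : a <= t0) (T0 : T < 0).
Let smooth F := Crinf I setT F.
Hypotheses (Ch : smooth h) (Cf : smooth f) (Cg : smooth g).
Hypothesis h0 : forall t r, I t -> 0 < h t r.
Hypothesis f0 : forall t r, I t -> J r -> 0 < f t r.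
Hypothesis g0 : forall t r, I t -> J r -> 0 < g t r.
Hypothesis gr0 : forall t, I t -> 0 < g t r0.
Hypotheses (ph : parity I r0 1 h) (pf : parity I r0 (- 1) f) (pg : parity I r0 1 g).
Hypothesis Jr0 : ~ J r0.
Hypothesis cone : forall t, I t -> dr f t r0 ^+ 2 = h t r0 ^+ 2.

Local Notation van := (vanish t0 T r0).
Local Notation S := (arcd h).
Local Notation A := (kt h g).
Local Notation B := (k2 h g f).
Local Notation C := (k1 h f).
Local Notation D := (kl h f).
Local Notation p := (pp h g).
Local Notation q := (qq h f).

Let ITI t : t0 <= t <= T -> I t.
Proof.
by move=> /andP[t1 t2]; apply/andP; split; [exact: le_trans t1|exact: le_lt_trans T0].
Qed.
Let openR : open (setT : set R) := openT.

(* Here [f] is the radius of the sphere that collapses at [r0], and [g] the other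
   one. Up to a positive factor [N] is the numerator of [L]; it is even and
   vanishes at [r0], hence it is of order two. *)
Let N t r := h t r * h t r - dr f t r * dr f t r.
Let sdr F : smooth F -> smooth (dr F). Proof. exact: Crinf_dr. Qed.
Let smul F G : smooth F -> smooth G -> smooth (fun t r => F t r * G t r).
Proof. exact: Crinf_mul. Qed.
Let sopp F : smooth F -> smooth (fun t r => - F t r).
Proof. exact: Crinf_opp. Qed.
Let sadd F G : smooth F -> smooth G -> smooth (fun t r => F t r + G t r).
Proof. exact: Crinf_add. Qed.
Let isDr F t r : smooth F -> I t -> is_derive r 1 (F t) (dr F t r).
Proof. by move=> CF It; exact: Crinf_isD CF _ _ It Logic.I. Qed.
Let v0 F : smooth F -> van 0 F. Proof. exact: vanish0. Qed.

Let CN : smooth N.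
Proof. by apply: sadd; [exact: smul|apply: sopp; apply: smul; exact: sdr]. Qed.
Let pdf : parity I r0 1 (dr f).
Proof. by rewrite -[1]opprK; exact: parity_dr. Qed.
Let pN : parity I r0 1 N.
Proof.
apply: parity_add; first by rewrite -[1]mulr1; exact: parity_mul.
by apply: parity_opp; rewrite -[1]mulr1; exact: parity_mul.
Qed.
Let vf : van 1 f. Proof. exact: (odd_vanish (I := I)). Qed.
Let vh1 : van 1 (dr h). Proof. exact: (even_dr_vanish (I := I)). Qed.
Let vg1 : van 1 (dr g). Proof. exact: (even_dr_vanish (I := I)). Qed.
Let vf2 : van 1 (dr (dr f)).
Proof. by apply: (even_dr_vanish (I := I)) => //; exact: sdr. Qed.
Let vN1 : van 1 (dr N). Proof. exact: (even_dr_vanish (I := I)). Qed.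
Let N0 t : I t -> N t r0 = 0.
Proof. by move=> It; rewrite /N -!expr2 cone// subrr. Qed.
Let vN : van 2 N.
Proof. by apply: (vanish_int ITI _ N0 vN1) => t r It; exact: isDr. Qed.
Let pN2 : parity I r0 1 (dr (dr N)).
Proof.
rewrite -[1]opprK; apply: parity_dr; first exact: sdr.
exact: parity_dr.
Qed.
Let vN3 : van 1 (dr (dr (dr N))).
Proof. by apply: (even_dr_vanish (I := I)) => //; do 2!apply: sdr. Qed.

(* [V] and [H] are the numerators of the derivatives of [N / f^2] and [dr g / f];
   these even quotients must have derivatives of order one, that is, [V] is of
   order four and [H] of order three. The leading terms that could prevent it
   cancel after differentiating as often as necessary. *)
Let V t r := dr N t r * f t r - 2 * (N t r * dr f t r).
Let U t r := dr (dr N) t r * f t r - dr N t r * dr f t r - 2 * (N t r * dr (dr f) t r).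
Let fr0 t : I t -> f t r0 = 0. Proof. exact: (odd_at pf). Qed.
Let N1r0 t : I t -> dr N t r0 = 0.
Proof. by apply: (odd_at (I := I)); exact: parity_dr. Qed.
Let g1r0 t : I t -> dr g t r0 = 0.
Proof. by apply: (odd_at (I := I)); exact: parity_dr. Qed.

Let vV : van 4 V.
Proof.
have vU1 : van 2 (fun t r => dr (dr (dr N)) t r * f t r
    + (- (3 * (dr N t r * dr (dr f) t r)) + - (2 * (N t r * dr (dr (dr f)) t r)))).
  apply: vanish_add; first exact: (vanish_mul vN3 vf).
  apply: vanish_add; apply: vanish_opp.
    by apply: vanish_scale; exact: (vanish_mul vN1 vf2).
  apply: vanish_scale.
  exact: (vanish_mul vN (v0 (sdr (sdr (sdr Cf))))).
have vU : van 3 U.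
  apply: (vanish_int ITI _ _ vU1) => [t r It|t It]; last first.
    by rewrite /U N1r0// fr0// N0// !mul0r !mulr0 !subr0.
  apply: isD_eq (isD_sub (isD_sub (isD_mul (isDr _ (sdr (sdr CN)) It) (isDr _ Cf It))
    (isD_mul (isDr _ (sdr CN) It) (isDr _ (sdr Cf) It)))
    (isD_mul (isD_cst r 2) (isD_mul (isDr _ CN It) (isDr _ (sdr (sdr Cf)) It)))) _.
  exact: second_order_identity.
apply: (vanish_int ITI _ _ vU) => [t r It|t It]; last first.
  by rewrite /V fr0// N0// !mul0r !mulr0 !subr0.
apply: isD_eq (isD_sub (isD_mul (isDr _ (sdr CN) It) (isDr _ Cf It))
    (isD_mul (isD_cst r 2) (isD_mul (isDr _ CN It) (isDr _ (sdr Cf) It)))) _.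
exact: first_order_identity.
Qed.

Let H t r := dr (dr g) t r * f t r - dr g t r * dr f t r.
Let vH : van 3 H.
Proof.
have pg2 : parity I r0 1 (dr (dr g)).
  by rewrite -[1]opprK; apply: parity_dr (sdr Cg) _; exact: parity_dr Cg pg.
have vg3 : van 1 (dr (dr (dr g))) by apply: even_dr_vanish _ pg2; [exact: ITI|exact: sdr (sdr Cg)].
have v2 : van 2 (fun t r => dr (dr (dr g)) t r * f t r + - (dr g t r * dr (dr f) t r)).
  apply: vanish_add; first exact: (vanish_mul vg3 vf).
  by apply: vanish_opp; exact: (vanish_mul vg1 vf2).
apply: (vanish_int ITI _ _ v2) => [t r It|t It]; last first.
  by rewrite /H fr0// g1r0// mulr0 mul0r subrr.
apply: isD_eq (isD_sub (isD_mul (isDr _ (sdr (sdr Cg)) It) (isDr _ Cf It))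
    (isD_mul (isDr _ (sdr Cg) It) (isDr _ (sdr Cf) It))) _.
exact: wronskian_identity.
Qed.

(* The cone condition keeps [dr f] away from zero near [r0]; therefore [f] is
   comparable to the distance to [r0], and division by [f] lowers the order
   of vanishing by one. *)
Let lower : exists2 d, 0 < d <= 1 & exists2 k, 0 < k &
  forall t r, t0 <= t <= T -> `|r - r0| < d ->
    [/\ k <= `|dr f t r|, k * `|r - r0| <= `|f t r|, k <= g t r & k <= h t r].
Proof.
have cstT (x : R) : x - 0 <= x <= x + 0 -> setT x by [].
have [c1 c10 hc1] := @cts_lower _ I setT t0 T (r0 - 1) (r0 + 1) h ITI
  (fun _ _ => Logic.I) (Crinf_cts Ch) (fun t r tI _ => h0 r (ITI tI)).
have [|c2 c20 gc2] := @cts_lower _ I setT t0 T r0 r0 g ITI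
    (fun _ _ => Logic.I) (Crinf_cts Cg).
  by move=> t r tI; rewrite -eq_le eq_sym => /eqP ->; exact: gr0 (ITI tI).
have [M1 M10 NM] := vN; have [M2 M20 gM] : van 1 (fun t r => g t r - g t r0).
  apply: (vanish_int ITI (g := dr g)) => [t r It|t It|].
  - by apply: isD_eq (isD_sub (isDr _ Cg It) (isD_cst r _)) _; rewrite subr0.
  - by rewrite subrr.
  - exact: v0 (sdr Cg).
pose k := Num.min (c1 / 2) (c2 / 2).
have k0 : 0 < k by rewrite lt_min !divr_gt0.
pose d := Num.min 1 (Num.min (c1 ^+ 2 / 2 / M1) (c2 / 2 / M2)).
have d0 : 0 < d by rewrite !lt_min ltr01 !divr_gt0// exprn_gt0.
have d1 : d <= 1 by rewrite ge_min lexx.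
exists d; first by rewrite d0.
exists k => //.
have dc1 x : `|x - r0| < d -> `|x - r0| <= 1 by move=> /ltW/le_trans; apply.
have box x : `|x - r0| <= 1 -> r0 - 1 <= x <= r0 + 1 by rewrite ler_distl.
have f1k t r : t0 <= t <= T -> `|r - r0| < d -> k <= `|dr f t r|.
  move=> tI rd; have := NM t r tI (dc1 _ rd); have hr := hc1 t r tI (box _ (dc1 _ rd)).
  have : M1 * `|r - r0| ^+ 2 <= c1 ^+ 2 / 2.
    rewrite mulrC -ler_pdivlMr// (le_trans (y := `|r - r0| ^+ 1))//.
      by apply: ler_wiXn2l => //; exact: dc1.
    rewrite expr1 (le_trans (ltW rd))// /d !ge_min lexx orbT //.
  rewrite /N ler_norml => H1 /andP[_ H2].
  have H3 : c1 ^+ 2 <= h t r ^+ 2 by rewrite ler_sqr// nnegrE ltW// (lt_le_trans c10).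
  have H4 : (c1 / 2) ^+ 2 <= `|dr f t r| ^+ 2.
    rewrite real_normK ?num_real// expr_div_n.
    move: H1 H2 H3; rewrite -!expr2 => H1 H2 H3.
    have := sqr_ge0 c1; lra.
  rewrite (le_trans (y := c1 / 2)) ?ge_min ?lexx//.
  by move: H4; rewrite ler_sqr// nnegrE// divr_ge0// ltW.
move=> t r tI rd; split; first exact: f1k.
- have [|c cI] := @mean_value _ (f t) (dr f t) r0 r.
    by move=> x _; exact: isDr Cf (ITI tI).
  rewrite (fr0 (ITI tI)) subr0 => ->; rewrite normrM ler_wpM2r// f1k//.
  apply: le_lt_trans rd; have [r0r|rr0] := leP r0 r.
    move: cI; rewrite min_l// max_r// => /andP[x1 x2].
    by rewrite !ger0_norm ?subr_ge0// lerD2r.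
  move: cI; rewrite min_r ?(ltW rr0)// max_l ?(ltW rr0)// => /andP[x1 x2].
  by rewrite !ler0_norm ?subr_le0 ?(ltW rr0)// lerN2 lerD2r.
- have := gM t r tI (dc1 _ rd); rewrite expr1 ler_distl => /andP[H1 _].
  have : M2 * `|r - r0| <= c2 / 2.
    by rewrite mulrC -ler_pdivlMr// (le_trans (ltW rd))// /d !ge_min lexx !orbT.
  have := gc2 t r0 tI; rewrite lexx => /(_ isT).
  have : k <= c2 / 2 by rewrite ge_min lexx orbT.
  by move: H1; lra.
- rewrite (le_trans _ (hc1 t r tI (box _ (dc1 _ rd))))//.
  by rewrite ge_min ler_pdivrMr// ler_peMr ?ler1n// ltW.
Qed.

Definition small (d : R) (i : nat) F := exists2 M, 0 < M &
  forall t r, t0 <= t <= T -> J r -> `|r - r0| < d -> `|F t r| <= M * `|r - r0| ^+ i.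

(** All quantities of the maximum principle stay bounded up to a singular orbit.
    For the quotients of differences by [f^2] this uses the identities
    [D_s = 2 q (C - D)] and [B_s = q (A - B) - p (B - C)]: since [q f] tends to
    [1] or [- 1], the quotients are as regular as [D_s / f] and [B_s / f]. *)
Lemma collapse : exists2 d, 0 < d &
  [/\ small d 0 A, small d 0 B, small d 0 C & small d 0 D] /\
  [/\ small d 0 (Xh h g f), small d 0 (Zh h f), small d 0 (psi_slope h g f),
      small d 0 (phi_slope h g f) & small d 0 (fun t r => S f t r ^+ 2)] /\
  [/\ small d 0 (fun t r => (g t r)^-1), small d 1 f, small d 1 (S B) & small d 1 (S D)].
Proof.
have [d /andP[d0 d1] [k k0 low]] := lower.
have x0 r : J r -> 0 < `|r - r0|.
  by move=> Jr; rewrite normr_gt0 subr_eq0; apply/eqP => E; apply: Jr0; rewrite -E.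
have s_ext i F G : (forall t r, I t -> J r -> F t r = G t r) -> small d i F -> small d i G.
  by move=> FG [M M0 HF]; exists M => // t r tI Jr rd; rewrite -FG ?HF//; exact: ITI.
have s_van i F : van i F -> small d i F.
  move=> [M M0 HF]; exists M => // t r tI Jr rd; apply: HF => //.
  exact: le_trans (ltW rd) d1.
have s_add i F G : small d i F -> small d i G -> small d i (fun t r => F t r + G t r).
  move=> [M M0 HF] [M' M'0 HG]; exists (M + M'); first exact: addr_gt0.
  by move=> t r tI Jr rd; rewrite mulrDl (le_trans (ler_normD _ _))// lerD// ?HF ?HG.
have s_opp i F : small d i F -> small d i (fun t r => - F t r).
  by move=> [M M0 HF]; exists M => // t r tI Jr rd; rewrite normrN HF.
have s_mul i j F G : small d i F -> small d j G ->
    small d (i + j) (fun t r => F t r * G t r).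
  move=> [M M0 HF] [M' M'0 HG]; exists (M * M'); first exact: mulr_gt0.
  by move=> t r tI Jr rd; rewrite normrM exprD mulrACA ler_pM// ?HF ?HG.
have s_inv F : (forall t r, t0 <= t <= T -> `|r - r0| < d -> k <= `|F t r|) ->
    small d 0 (fun t r => (F t r)^-1).
  move=> HF; exists k^-1; first by rewrite invr_gt0.
  move=> t r tI Jr rd; rewrite expr0 mulr1 normfV lef_pV2 ?HF// posrE//.
  exact: lt_le_trans k0 (HF _ _ tI rd).
have s_weak i F : small d i F -> small d 0 F.
  move=> [M M0 HF]; exists M => // t r tI Jr rd; apply: le_trans (HF _ _ tI Jr rd) _.
  rewrite ler_pM2l// expr0 exprn_ile1//; exact: le_trans (ltW rd) d1.
have s_div i F : small d i.+1 F -> small d i (fun t r => F t r / f t r).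
  move=> [M M0 HF]; exists (M / k); first exact: divr_gt0.
  move=> t r tI Jr rd; have [_ fk _ _] := low t r tI rd.
  have xr := x0 _ Jr; have fn : 0 < `|f t r| by apply: lt_le_trans fk; rewrite mulr_gt0.
  rewrite normrM normfV ler_pdivrMr// (le_trans (HF _ _ tI Jr rd))//.
  rewrite exprSr (_ : M / k * _ * _ = M * (`|r - r0| ^+ i * (`|f t r| / k))).
    by rewrite ler_pM2l// ler_wpM2l ?exprn_ge0// ler_pdivlMr// mulrC.
  by rewrite !mulrA (mulrAC _ k^-1) (mulrAC _ k^-1) (mulrAC _ _ k^-1).
have fN t r : I t -> J r -> f t r != 0 by move=> It Jr; rewrite gt_eqF// f0.
have gN t r : I t -> J r -> g t r != 0 by move=> It Jr; rewrite gt_eqF// g0.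
have hN t r : I t -> h t r != 0 by move=> It; rewrite gt_eqF// h0.
have s0 F : smooth F -> small d 0 F by move=> CF; apply: s_van; exact: v0.
have s_hV : small d 0 (fun t r => (h t r)^-1).
  apply: s_inv => t r tI rd; have [_ _ _ hk] := low t r tI rd.
  by rewrite (le_trans hk)// ler_norm.
have s_gV : small d 0 (fun t r => (g t r)^-1).
  apply: s_inv => t r tI rd; have [_ _ gk _] := low t r tI rd.
  by rewrite (le_trans gk)// ler_norm.
have s_f1V : small d 0 (fun t r => (dr f t r)^-1).
  by apply: s_inv => t r tI rd; have [] := low t r tI rd.
have CJ F : smooth F -> Crinf I J F by apply: Crinf_sub.
have openJ : open J.
  rewrite (_ : J = `]0, pi / 2[%classic); first exact: interval_open.
  by apply/seteqP; split=> x; rewrite /= in_itv.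
have hJ t r : I t -> J r -> 0 < h t r by move=> It _; exact: h0.
have SE F F' t r : I t -> J r -> (forall x, J x -> is_derive x 1 (F t) (F' t x)) ->
    S F t r = F' t r / h t r.
  by move=> It Jr FF; rewrite /arcd (isD_derive1 (FF r Jr)).
pose W t r := dr g t r / f t r.
have sW : small d 0 W by exact: s_div _ _ (s_van _ _ vg1).
have sN2 : small d 0 (fun t r => N t r / f t r / f t r).
  exact: s_div _ _ (s_div _ _ (s_van _ _ vN)).
have sV3 : small d 1 (fun t r => V t r / f t r / f t r / f t r).
  exact: s_div _ _ (s_div _ _ (s_div _ _ (s_van _ _ vV))).
have sH2 : small d 1 (fun t r => H t r / f t r / f t r).
  exact: s_div _ _ (s_div _ _ (s_van _ _ vH)).
have DE t r : I t -> J r -> D t r = N t r / f t r / f t r * ((h t r)^-1 * (h t r)^-1).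
  move=> It Jr; rewrite /kl /arcd /N -/(dr f t r).
  by field; rewrite hN ?fN.
have BE t r : I t -> J r ->
    B t r = - (dr f t r * W t r * (h t r)^-1 * (h t r)^-1 * (g t r)^-1).
  move=> It Jr; rewrite /k2 /arcd /W -/(dr f t r) -/(dr g t r).
  by field; rewrite hN// fN// gN.
have SD' t r : I t -> J r -> S D t r =
    (V t r / f t r / f t r / f t r * ((h t r)^-1 * (h t r)^-1)
     + - (2 * (dr h t r * (N t r / f t r / f t r
        * ((h t r)^-1 * (h t r)^-1 * (h t r)^-1))))) * (h t r)^-1.
  move=> It Jr; rewrite /arcd; congr (_ / _); apply: isD_derive1.
  have h2 : (h t r * f t r) ^+ 2 != 0 by rewrite expf_neq0// mulf_neq0 ?hN ?fN.
  apply: (@isD_near _ _ (fun x => N t x / (h t x * f t x) ^+ 2)).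
    have : nbhs r J by apply: open_nbhs_nbhs.
    apply: filterS => x Jx; rewrite DE//; have hx := hN t x It; have fx := fN t x It Jx.
    by field; rewrite hx fx.
  apply: isD_eq (isD_div (g := fun x => (h t x * f t x) ^+ 2) h2 (isDr r CN It)
    (isD_exp 2 (isD_mul (isDr r Ch It) (isDr r Cf It)))) _.
  have hx := hN t r It; have fx := fN t r It Jr; rewrite /V.
  move: (dr N t r) (N t r) (dr h t r) (dr f t r) (h t r) (f t r) hx fx => *.
  by field; apply/andP.
have SB' t r : I t -> J r -> S B t r =
    - (dr (dr f) t r * W t r * (h t r)^-1 * (h t r)^-1 * (g t r)^-1
       + dr f t r * (H t r / f t r / f t r) * (h t r)^-1 * (h t r)^-1 * (g t r)^-1
       - 2 * (dr f t r * W t r * (h t r)^-1 * (h t r)^-1 * (h t r)^-1 * (g t r)^-1 * dr h t r)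
       - dr f t r * W t r * (h t r)^-1 * (h t r)^-1 * (g t r)^-1 * (g t r)^-1 * dr g t r)
      * (h t r)^-1.
  move=> It Jr; rewrite /arcd; congr (_ / _); apply: isD_derive1.
  have h2 : h t r * h t r * (f t r * g t r) != 0.
    by rewrite !mulf_neq0 ?hN ?fN ?gN.
  apply: (@isD_near _ _ (fun x =>
     - (dr f t x * dr g t x / (h t x * h t x * (f t x * g t x))))).
    have : nbhs r J by apply: open_nbhs_nbhs.
    apply: filterS => x Jx; rewrite BE//; have hx := hN t x It; have fx := fN t x It Jx.
    by have gx := gN t x It Jx; rewrite /W; field; rewrite hx fx gx.
  apply: isD_eq (isD_opp (isD_div (g := fun x => h t x * h t x * (f t x * g t x)) h2
    (isD_mul (isDr r (sdr Cf) It) (isDr r (sdr Cg) It))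
    (isD_mul (isD_mul (isDr r Ch It) (isDr r Ch It))
       (isD_mul (isDr r Cf It) (isDr r Cg It))))) _.
  have hx := hN t r It; have fx := fN t r It Jr; have gx := gN t r It Jr.
  rewrite /W /H.
  move: (dr (dr f) t r) (dr (dr g) t r) (dr h t r) (dr f t r) (dr g t r)
    (h t r) (f t r) (g t r) hx fx gx => *.
  by field; apply/and3P.
have kl_id t r : I t -> J r -> S D t r = 2 * q t r * (C t r - D t r).
  by apply: (arcd_kl (a := a)) => //; exact: CJ.
have k2_id t r : I t -> J r ->
    S B t r = q t r * (A t r - B t r) - p t r * (B t r - C t r).
  by apply: (arcd_k2 (a := a)) => //; exact: CJ.
have s_f1 : small d 0 (dr f) by exact: s0 (sdr Cf).
have s_g1 : small d 1 (dr g) by exact: s_van vg1.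
have s_h1 : small d 1 (dr h) by exact: s_van vh1.
have s_c c : small d 0 (fun _ _ => c) by apply: s0; exact: Crinf_cst.
have s_h : small d 0 h by exact: s0.
have s_f : small d 1 f by exact: s_van vf.
have s_f2 : small d 1 (dr (dr f)) by exact: s_van vf2.
have s_hV2 := s_mul _ _ _ _ s_hV s_hV.
have s_SD : small d 1 (S D).
  exact: s_ext (fun t r It Jr => esym (SD' t r It Jr))
    (s_mul _ _ _ _ (s_add _ _ _ (s_mul _ _ _ _ sV3 s_hV2) (s_opp _ _ (s_mul _ _ _ _ (s_c 2) (s_mul _ _ _ _ s_h1 (s_mul _ _ _ _ sN2 (s_mul _ _ _ _ s_hV2 s_hV)))))) s_hV).
have s_SB : small d 1 (S B).
  exact: s_ext (fun t r It Jr => esym (SB' t r It Jr))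
    (s_mul _ _ _ _ (s_opp _ _ (s_add _ _ _ (s_add _ _ _ (s_add _ _ _ (s_mul _ _ _ _ (s_mul _ _ _ _ (s_mul _ _ _ _ (s_mul _ _ _ _ s_f2 sW) s_hV) s_hV) s_gV) (s_mul _ _ _ _ (s_mul _ _ _ _ (s_mul _ _ _ _ (s_mul _ _ _ _ s_f1 sH2) s_hV) s_hV) s_gV)) (s_opp _ _ (s_mul _ _ _ _ (s_c 2) (s_mul _ _ _ _ (s_mul _ _ _ _ (s_mul _ _ _ _ (s_mul _ _ _ _ (s_mul _ _ _ _ (s_mul _ _ _ _ s_f1 sW) s_hV) s_hV) s_hV) s_gV) s_h1)))) (s_opp _ _ (s_mul _ _ _ _ (s_mul _ _ _ _ (s_mul _ _ _ _ (s_mul _ _ _ _ (s_mul _ _ _ _ (s_mul _ _ _ _ s_f1 sW) s_hV) s_hV) s_gV) s_gV) s_g1)))) s_hV).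
have s_D : small d 0 D.
  exact: s_ext (fun t r It Jr => esym (DE t r It Jr)) (s_mul _ _ _ _ sN2 s_hV2).
have s_B : small d 0 B.
  exact: s_ext (fun t r It Jr => esym (BE t r It Jr)) (s_opp _ _ (s_mul _ _ _ _ (s_mul _ _ _ _ (s_mul _ _ _ _ (s_mul _ _ _ _ s_f1 sW) s_hV) s_hV) s_gV)).
have smS F : smooth F -> smooth (S F).
  move=> CF; apply: Crinf_mul => //; first exact: sdr.
  by apply: Crinf_inv => // t r It _; exact: hN.
have s_A : small d 0 A by exact: s_opp _ _ (s_mul _ _ _ _ (s0 _ (smS _ (smS _ Cg))) s_gV).
have s_fV1 : small d 0 (fun t r => h t r * (dr f t r)^-1 * 2^-1).
  exact: (s_mul _ _ _ _ (s_mul _ _ _ _ s_h s_f1V) (s_c 2^-1)).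
have d1N t r : t0 <= t <= T -> `|r - r0| < d -> dr f t r != 0.
  move=> tI rd; have [kf _ _ _] := low t r tI rd.
  by rewrite -normr_gt0 (lt_le_trans k0).
have s_ext' i F G : (forall t r, t0 <= t <= T -> J r -> `|r - r0| < d -> F t r = G t r) ->
    small d i F -> small d i G.
  by move=> FG [M M0 HF]; exists M => // t r tI Jr rd; rewrite -FG ?HF.
have s_Zh : small d 0 (Zh h f).
  apply: (s_ext' _ (fun t r => S D t r / f t r * (h t r * (dr f t r)^-1 * 2^-1))); last first.
    exact: (s_mul _ _ _ _ (s_div _ _ s_SD) s_fV1).
  move=> t r tI Jr rd; have It := ITI tI; rewrite /Zh kl_id// /qq /arcd -/(dr f t r).
  have hx := hN t r It; have fx := fN t r It Jr; have f1x := d1N t r tI rd.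
  move: (C t r - D t r) (dr f t r) (h t r) (f t r) hx fx f1x => *.
  by field; apply/and3P.
have s_C : small d 0 C.
  apply: s_ext (s_add _ _ _ s_D (s_mul _ _ _ _ (s_weak _ _ s_f) (s_mul _ _ _ _ (s_weak _ _ s_f) s_Zh))) => t r It Jr.
  by rewrite /Zh; field; exact: fN.
have s_Y : small d 0 (fun t r => B t r - C t r) by exact: (s_add _ _ _ s_B (s_opp _ _ s_C)).
have s_Xh : small d 0 (Xh h g f).
  apply: (s_ext' _ (fun t r => (S B t r / f t r
      + W t r * ((h t r)^-1 * (g t r)^-1) * (B t r - C t r)) * (h t r * (dr f t r)^-1))).
    move=> t r tI Jr rd; have It := ITI tI; rewrite /Xh k2_id// /qq /pp /arcd /W.
    rewrite -/(dr f t r) -/(dr g t r).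
    have hx := hN t r It; have fx := fN t r It Jr; have f1x := d1N t r tI rd.
    have gx := gN t r It Jr.
    move: (A t r) (B t r) (C t r) (dr f t r) (dr g t r) (h t r) (f t r) (g t r)
      hx fx f1x gx => *.
    by field; apply/and4P.
  exact: (s_mul _ _ _ _ (s_add _ _ _ (s_div _ _ s_SB) (s_mul _ _ _ _ (s_mul _ _ _ _ sW (s_mul _ _ _ _ s_hV s_gV)) s_Y)) (s_mul _ _ _ _ s_h s_f1V)).
have s_Sf : small d 0 (S f) by exact: s0 (smS _ Cf).
have s_ps : small d 0 (psi_slope h g f).
  apply: s_ext (s_mul _ _ _ _ (s_mul _ _ _ _ sW s_hV) (s_mul _ _ _ _ sW s_hV)) => t r It Jr.
  by rewrite /psi_slope /arcd /W -/(dr g t r); field; rewrite hN ?fN.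
have s_fs : small d 0 (phi_slope h g f).
  apply: s_ext (s_mul _ _ _ _ (s_mul _ _ _ _ s_Sf s_gV) (s_mul _ _ _ _ s_Sf s_gV)) => t r It Jr.
  by rewrite /phi_slope; field; exact: gN.
have s_Sf2 : small d 0 (fun t r => S f t r ^+ 2).
  by apply: s_ext (s_mul _ _ _ _ s_Sf s_Sf) => t r It Jr; rewrite expr2.
by exists d.
Qed.
End Collapse.

(** * Limits at the ends of the interval *)

Section EndpointLimits.
Context {R : realType}.
Implicit Types (F G : R -> R) (r d M l : R).
Let J : set R := [set r | 0 < r < pi / 2].

Definition endpoint r0 := r0 = 0 \/ r0 = pi / 2.

Lemma endpoint_notin r0 : endpoint r0 -> ~ J r0.
Proof. by move=> [] -> /=; rewrite /J/= ltxx ?andbF. Qed.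

Lemma endpoint_near r0 d : endpoint r0 -> 0 < d -> exists2 r, J r & `|r - r0| < d.
Proof.
move=> e0 d0; pose x := Num.min (d / 2) (pi / 4).
have x0 : 0 < x by rewrite lt_min !divr_gt0// pi_gt0.
have xd : x < d by rewrite gt_min ltr_pdivrMr// ltr_pMr// ltr1n.
have xp : x <= pi / 4 by rewrite ge_min lexx orbT.
have pi0 := pi_gt0 R.
case: e0 => ->.
  exists x; last by rewrite subr0 gtr0_norm.
  by rewrite /J/= x0; move: xp pi0; lra.
exists (pi / 2 - x); last by rewrite addrAC subrr add0r normrN gtr0_norm.
by rewrite /J/=; apply/andP; split; move: xp pi0 x0; lra.
Qed.

Lemma endpoint_proper r0 : endpoint r0 -> ProperFilter (within J (nbhs r0)).
Proof.
move=> e0; apply: within_nbhs_proper => U /nbhs_ballP[d /= d0 dU].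
have [r Jr rd] := endpoint_near e0 d0; exists r; split=> //.
by apply: dU; rewrite /ball/= distrC.
Qed.

Lemma within_endpoint r0 d (P : R -> Prop) : 0 < d ->
  (forall r, J r -> `|r - r0| < d -> P r) -> \forall r \near within J (nbhs r0), P r.
Proof.
move=> d0 H; rewrite near_withinE; apply/nbhs_ballP; exists d => //= r.
by rewrite /ball/= distrC => rd Jr; exact: H.
Qed.

(** By the mean value theorem the values near the end are a Cauchy family. *)
Lemma bounded_derivative_cvg F F' r0 d M : endpoint r0 -> 0 < d -> 0 < M ->
  (forall r, J r -> `|r - r0| < d -> is_derive r 1 F (F' r) /\ `|F' r| <= M) ->
  cvg (F x @[x --> within J (nbhs r0)]).
Proof.
move=> e0 d0 M0 H; have PF := endpoint_proper e0.
apply/cauchy_cvgP; apply: cauchy_exP => eps eps0.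
pose d' := Num.min d (eps / (2 * M)).
have d'0 : 0 < d' by rewrite lt_min d0 divr_gt0// mulr_gt0.
have [x Jx xd] := endpoint_near e0 d'0; exists (F x).
apply: (within_endpoint d'0) => r Jr rd.
have mid y : Num.min x r <= y <= Num.max x r -> J y /\ `|y - r0| < d'.
  move=> /andP[y1 y2]; split.
    move: Jx Jr; rewrite /J/= => /andP[x1 x2] /andP[r1 r2].
    by rewrite (lt_le_trans _ y1) ?lt_min ?x1// (le_lt_trans y2)// gt_max x2.
  move: xd rd; rewrite !ltr_distl => /andP[x1 x2] /andP[r1 r2].
  by rewrite (lt_le_trans _ y1) ?lt_min ?x1// (le_lt_trans y2)// gt_max x2.
have dd y : `|y - r0| < d' -> `|y - r0| < d by rewrite lt_min => /andP[].
have [y /mid[Jy /dd yd]|y /mid[Jy /dd yd] E] := @mean_value _ F F' x r.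
  by have [] := H y Jy yd.
rewrite /ball/= distrC E normrM.
have [_ HM] := H y Jy yd.
have rx : `|r - x| < 2 * d'.
  have -> : r - x = (r - r0) - (x - r0) by ring.
  by rewrite (le_lt_trans (ler_normB _ _))// mulr_natl mulr2n ltrD.
have dM : 2 * d' * M <= eps.
  have : d' <= eps / (2 * M) by rewrite ge_min lexx orbT.
  by rewrite ler_pdivlMr ?mulr_gt0//; lra.
apply: lt_le_trans dM; rewrite mulrC.
by rewrite (le_lt_trans (ler_wpM2l _ HM))// ltr_pM2r.
Qed.

(** Differences such as [A - B = phi^2 X] vanish at an end of the interval, so that
    the limit of one curvature gives that of another. *)
Lemma cvg_of_close F G r0 d M l : endpoint r0 -> 0 < d -> 0 < M ->
  (forall r, J r -> `|r - r0| < d -> `|G r - F r| <= M * `|r - r0|) ->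
  F x @[x --> within J (nbhs r0)] --> l -> G x @[x --> within J (nbhs r0)] --> l.
Proof.
move=> e0 d0 M0 H Fl; have PF := endpoint_proper e0.
have H0 : (fun r => G r - F r) x @[x --> within J (nbhs r0)] --> 0.
  apply/cvgrPdist_le => eps eps0.
  apply: (within_endpoint (d := Num.min d (eps / M))).
    by rewrite lt_min d0 divr_gt0.
  move=> r Jr; rewrite lt_min => /andP[rd re].
  rewrite sub0r normrN (le_trans (H r Jr rd))// mulrC -ler_pdivlMr// ltW//.
have E : G = (fun r => (G r - F r) + F r) by apply/funext => x; rewrite subrK.
by rewrite E -[l]add0r; exact: cvgD H0 Fl.
Qed.

Lemma extend_in F r : J r -> extend F r = F r.
Proof. by rewrite /extend /J/= => ->. Qed.

Lemma extend_end F r0 l : endpoint r0 -> F x @[x --> within J (nbhs r0)] --> l ->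
  extend F r0 = l.
Proof.
move=> e0 Fl; have PF := endpoint_proper e0; rewrite /extend ifF.
  exact: cvg_lim Fl.
by apply/negP => /(endpoint_notin e0).
Qed.

Lemma positive_lower F l0 l1 : 0 < l0 -> 0 < l1 ->
  F x @[x --> within J (nbhs 0)] --> l0 ->
  F x @[x --> within J (nbhs (pi / 2))] --> l1 ->
  (forall r, J r -> {for r, continuous F}) -> (forall r, J r -> 0 < F r) ->
  exists2 delta, 0 < delta & forall r, J r -> delta <= F r.
Proof.
move=> l00 l10 F0 F1 Fc Fp.
have ex r0 l : 0 < l -> F x @[x --> within J (nbhs r0)] --> l ->
    exists2 d, 0 < d & forall r, J r -> `|r - r0| < d -> l / 2 <= F r.
  move=> lpos Fl; have : \forall r \near within J (nbhs r0), l / 2 <= F r.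
    by apply: (cvgr_ge _ Fl); rewrite ltr_pdivrMr// ltr_pMr// ltr1n.
  rewrite near_withinE => /nbhs_ballP[d /= d0 dH]; exists d => // r Jr rd.
  by apply: dH => //; rewrite /ball/= distrC.
have [d d0 H0] := ex _ _ l00 F0; have [d' d'0 H1] := ex _ _ l10 F1.
have pi0 := pi_gt0 R.
have [||||m m0 H] := @cts_lower _ setT J 0 0 (Num.min d (pi / 4))
    (pi / 2 - Num.min d' (pi / 4)) (fun _ => F).
- by [].
- move=> r /andP[r1 r2]; rewrite /J/= (lt_le_trans _ r1) ?lt_min ?d0 ?divr_gt0//.
  by rewrite (le_lt_trans r2)// ltrBlDr ltrDl lt_min d'0 divr_gt0.
- by apply: cts_space.
- move=> _ r _ /andP[r1 r2]; apply: Fp.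
  rewrite /J/= (lt_le_trans _ r1) ?lt_min ?d0 ?divr_gt0//.
  by rewrite (le_lt_trans r2)// ltrBlDr ltrDl lt_min d'0 divr_gt0.
exists (Num.min m (Num.min (l0 / 2) (l1 / 2))).
  by rewrite !lt_min m0 !divr_gt0.
move=> r Jr; rewrite !ge_min.
have [rd|rd] := ltP (`|r - 0|) d; first by rewrite (H0 r)// orbT.
have [rd'|rd'] := ltP (`|r - pi / 2|) d'; first by rewrite (H1 r)// !orbT.
rewrite (H 0 r)// ?lexx//; have /andP[r1 r2] := Jr.
move: rd rd'; rewrite subr0 gtr0_norm// ltr0_norm ?subr_lt0// opprB => rd rd'.
rewrite ge_min rd/= lerBrDr -lerBrDl; rewrite ge_min.
by apply/orP; left; move: rd'; lra.
Qed.

End EndpointLimits.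

(** * Preservation of the order of the curvatures *)

Section CommonBound.
Context {R : realType}.

Lemma common_bound (x1 x2 x3 x4 x5 x6 x7 x8 x9 x10 x11 x12 : R) :
  exists2 M, 1 <= M &
    [/\ x1 <= M, x2 <= M, x3 <= M & x4 <= M] /\
    [/\ x5 <= M, x6 <= M, x7 <= M & x8 <= M] /\
    [/\ x9 <= M, x10 <= M, x11 <= M & x12 <= M].
Proof.
pose s := [:: x1; x2; x3; x4; x5; x6; x7; x8; x9; x10; x11; x12].
exists (\big[Num.max/1]_(x <- s) x).
  by rewrite /s !big_cons !le_max big_nil lexx !orbT.
by rewrite /s !big_cons big_nil; do !split; rewrite !le_max lexx ?orbT.
Qed.

End CommonBound.

Section WarpedFlow.
Context {R : realType} (m : nat) (m0 : (0 < m)%N) (a : R) (chi b g : R -> R -> R).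
Implicit Types (F G : R -> R -> R) (t r d : R).
Let I : set R := [set t | a <= t < 0].
Let J : set R := [set r | 0 < r < pi / 2].
Let mm : R := m%:R.

(** The two radii factored by the sine and cosine, which carry the zeros and the
    parity prescribed at the singular orbits; [b], [g] and [chi] are even
    and positive. *)
Definition sphere_radius t r : R := sin r * b t r.
Definition circle_radius t r : R := cos r * g t r.

Local Notation phi := sphere_radius.
Local Notation psi := circle_radius.
Local Notation S := (arcd chi).
Local Notation A := (kt chi psi).
Local Notation B := (k2 chi psi phi).
Local Notation C := (k1 chi phi).
Local Notation D := (kl chi phi).

Hypotheses (Cchi : Crinf I setT chi) (Cb : Crinf I setT b) (Cg : Crinf I setT g).
Hypothesis chi0 : forall t r, I t -> 0 < chi t r.
Hypothesis b0 : forall t r, I t -> 0 < b t r.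
Hypothesis g0 : forall t r, I t -> 0 < g t r.
Hypothesis even : forall r0, endpoint r0 ->
  [/\ parity I r0 1 chi, parity I r0 1 b & parity I r0 1 g].
Hypothesis chi_b : forall t, I t -> chi t 0 = b t 0.
Hypothesis chi_g : forall t, I t -> chi t (pi / 2) = g t (pi / 2).
Hypothesis Tchi : forall t r, a < t < 0 -> J r ->
  is_derive t 1 (chi ^~ r) (- chi t r * (A t r + mm * C t r)).
Hypothesis Tpsi : forall t r, a < t < 0 -> J r ->
  is_derive t 1 (psi ^~ r) (- psi t r * (A t r + mm * B t r)).
Hypothesis Tphi : forall t r, a < t < 0 -> J r ->
  is_derive t 1 (phi ^~ r)
    (- phi t r * (C t r + B t r + (mm - 1) * D t r)).

Let openR : open (setT : set R) := openT.
Let CJ F : Crinf I setT F -> Crinf I J F.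
Proof. exact: Crinf_sub. Qed.
Let Cphi : Crinf I setT phi.
Proof. by apply: Crinf_mul => //; have [] := @Crinf_sincos R I setT openR. Qed.
Let Cpsi : Crinf I setT psi.
Proof. by apply: Crinf_mul => //; have [] := @Crinf_sincos R I setT openR. Qed.
Let sinJ r : J r -> 0 < sin r.
Proof. exact: sin_gt0_pihalf. Qed.
Let cosJ r : J r -> 0 < cos r.
Proof.
move=> /andP[r0 r1]; apply: cos_gt0_pihalf; rewrite r1 andbT (lt_trans _ r0)//.
by rewrite oppr_lt0 (lt_trans r0).
Qed.
Let phi0 t r : I t -> J r -> 0 < phi t r.
Proof. by move=> It Jr; rewrite mulr_gt0 ?sinJ ?b0. Qed.
Let psi0 t r : I t -> J r -> 0 < psi t r.
Proof. by move=> It Jr; rewrite mulr_gt0 ?cosJ ?g0. Qed.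
Let chiJ t r : I t -> J r -> 0 < chi t r.
Proof. by move=> It _; exact: chi0. Qed.

Let phiD t r : I t -> is_derive r (1 : R) (phi t) (cos r * b t r + sin r * dr b t r).
Proof. by move=> It; apply: isD_mul (isD_sin r) (Crinf_isD Cb It _). Qed.
Let psiD t r : I t -> is_derive r (1 : R) (psi t) (- sin r * g t r + cos r * dr g t r).
Proof. by move=> It; apply: isD_mul (isD_cos r) (Crinf_isD Cg It _). Qed.

Let sin_refl r : sin (2 * (pi / 2) - r) = sin r.
Proof. by rewrite mulrC divfK// sinB sinpi cospi; ring. Qed.
Let cos_refl r : cos (2 * (pi / 2) - r) = - cos r.
Proof. by rewrite mulrC divfK// cosB sinpi cospi; ring. Qed.

Let e0 : endpoint (0 : R). Proof. by left. Qed.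
Let e1 : endpoint (pi / 2 : R). Proof. by right. Qed.

Section Ends.
Variables (t0 T : R) (at0 : a <= t0) (T0 : T < 0).

Lemma collapse0 : exists2 d, 0 < d &
  [/\ small t0 T 0 d 0 A, small t0 T 0 d 0 B, small t0 T 0 d 0 C & small t0 T 0 d 0 D] /\
  [/\ small t0 T 0 d 0 (Xh chi psi phi), small t0 T 0 d 0 (Zh chi phi),
      small t0 T 0 d 0 (psi_slope chi psi phi),
      small t0 T 0 d 0 (phi_slope chi psi phi) &
      small t0 T 0 d 0 (fun t r => S phi t r ^+ 2)] /\
  [/\ small t0 T 0 d 0 (fun t r => (psi t r)^-1), small t0 T 0 d 1 phi,
      small t0 T 0 d 1 (S B) & small t0 T 0 d 1 (S D)].
Proof.
have [pchi pb pg] := even e0.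
apply: (collapse (a := a)) => //.
- by move=> t It; rewrite /circle_radius cos0 mul1r g0.
- move=> t r It; rewrite /sphere_radius pb// mulr0 sub0r sinN; ring.
- move=> t r It; rewrite /circle_radius pg// mulr0 sub0r cosN; ring.
- exact: endpoint_notin.
- move=> t It; rewrite /dr (isD_derive1 (phiD 0 It)) cos0 sin0 mul0r addr0 mul1r.
  by rewrite chi_b.
Qed.

(** At the other end the circle collapses instead of the sphere. The statement is
    symmetric in the two, except that [L] is replaced by the same expression in
    the radius of the circle, and [Y] takes the place of [X]. *)
Lemma collapse1 : exists2 d, 0 < d &
  let s := small t0 T (pi / 2) d 0 in
  [/\ s A, s B, s C & s (kl chi psi)] /\
  [/\ s (Yh chi psi phi), s (Zh chi psi), s (psi_slope chi psi phi) &
      s (phi_slope chi psi phi)] /\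
  [/\ s (fun t r => (phi t r)^-1), small t0 T (pi / 2) d 1 psi,
      small t0 T (pi / 2) d 1 (S B) & small t0 T (pi / 2) d 1 (S (kl chi psi))].
Proof.
have [pchi pb pg] := even e1.
have [||||||d d0 [[HC HB HA HD] [[HX HZ H1 H2 _] [H3 H4 H5 H6]]]] :=
  @collapse R a t0 T (pi / 2) chi psi phi at0 T0 Cchi Cpsi Cphi chi0 psi0 phi0.
- by move=> t It; rewrite /sphere_radius sin_pihalf mul1r b0.
- exact: pchi.
- by move=> t r It; rewrite /circle_radius pg// cos_refl; ring.
- by move=> t r It; rewrite /sphere_radius pb// sin_refl; ring.
- exact: endpoint_notin.
- move=> t It; rewrite /dr (isD_derive1 (psiD (pi / 2) It)) cos_pihalf sin_pihalf.
  by rewrite mul0r addr0 mulN1r sqrrN chi_g.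
have BE : k2 chi phi psi = B.
  by apply/funext => t; apply/funext => r; rewrite /k2 [X in X / _]mulrC [X in _ / X]mulrC.
have YE : Yh chi psi phi = fun t r => - Xh chi phi psi t r.
  apply/funext => t; apply/funext => r; rewrite /Yh /Xh BE -mulNr opprB.
  by [].
rewrite BE in HB H5.
exists d => //=; split=> //; split=> //; split=> //.
rewrite YE; have [M M0 HM] := HX; exists M => // t r tI Jr rd.
by rewrite normrN HM.
Qed.

End Ends.

Let openJ : open J.
Proof.
rewrite (_ : J = `]0, pi / 2[%classic); first exact: interval_open.
by apply/seteqP; split=> x; rewrite /= in_itv.
Qed.
Let CA : Crinf I J A. Proof. by apply: Crinf_kt => //; exact: CJ. Qed.
Let CB : Crinf I J B. Proof. by apply: Crinf_k2 => //; exact: CJ. Qed.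
Let CC : Crinf I J C. Proof. by apply: Crinf_k1 => //; exact: CJ. Qed.
Let CD : Crinf I J D. Proof. by apply: Crinf_kl => //; exact: CJ. Qed.
Let CD' : Crinf I J (kl chi psi). Proof. by apply: Crinf_kl => //; exact: CJ. Qed.
Let Cchi' : Crinf I J chi := CJ Cchi.
Let Cphi' : Crinf I J phi := CJ Cphi.
Let Cpsi' : Crinf I J psi := CJ Cpsi.

(** ** Limits at the singular orbits *)

Let small_cvg F r0 d t : I t -> endpoint r0 -> 0 < d -> Crinf I J F ->
  small t t r0 d 1 (S F) -> cvg (F t x @[x --> within J (nbhs r0)]).
Proof.
move=> It er d0 CF [M M0 HM]; have tt : t <= t <= t by rewrite lexx.
have [N N0 HN] : exists2 N, 0 < N & forall s r, t <= s <= t -> 0 <= r <= pi / 2 ->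
    `|chi s r| <= N.
  apply: (cts_bounded (I := I) (J := setT)) (Crinf_cts Cchi) => //.
  by move=> s; rewrite -eq_le => /eqP <-.
pose d' := Num.min d 1.
apply: (@bounded_derivative_cvg _ (F t) (fun r => S F t r * chi t r) r0 d' (M * N)) => //.
- by rewrite lt_min d0 ltr01.
- exact: mulr_gt0.
move=> r Jr; rewrite lt_min => /andP[rd r1]; split.
  apply: isD_eq (Crinf_isD CF It Jr) _.
  by rewrite /arcd divfK ?gt_eqF ?chi0.
rewrite normrM ler_pM//; last by apply: HN => //; case/andP: Jr => /ltW -> /ltW ->.
rewrite (le_trans (HM t r tt Jr rd))// expr1 ler_piMr ?ltW//.
Qed.

Lemma curvature_limits t r0 : I t -> endpoint r0 ->
  let lim F := cvg (F t x @[x --> within J (nbhs r0)]) in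
  [/\ lim A, lim B, lim C & lim D].
Proof.
move=> It er lim; have /andP[at_ T0] := It.
have tt : t <= t <= t by rewrite lexx.
have close F G H d : 0 < d -> small t t r0 d 0 H -> small t t r0 d 1 F ->
    (forall r, J r -> G t r = F t r ^+ 2 * H t r) ->
    forall U V, (forall r, J r -> V t r - U t r = G t r) -> lim U -> lim V.
  move=> d0 [M M0 HM] [N N0 HN] GE U V VU /cvg_ex[l Ul].
  apply/cvg_ex; exists l.
  apply: (@cvg_of_close _ (U t) (V t) r0 (Num.min d 1) (N * N * M) l er _ _ _ Ul).
  - by rewrite lt_min d0 ltr01.
  - by rewrite !mulr_gt0.
  move=> r Jr; rewrite lt_min => /andP[rd r1]; rewrite VU// GE// normrM normrX expr2.
  have Fr := HN t r tt Jr rd; rewrite expr1 in Fr.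
  have Hr := HM t r tt Jr rd; rewrite expr0 mulr1 in Hr.
  have x1 : `|r - r0| <= 1 by exact: ltW.
  have Fr' : `|F t r| <= N by rewrite (le_trans Fr)// ler_piMr// ltW.
  rewrite (_ : N * N * M * `|r - r0| = N * (N * `|r - r0|) * M); last by ring.
  by rewrite ler_pM ?mulr_ge0// ler_pM.
case: er => E; rewrite {}/lim E in close *.
- have [d d0 [[sA sB sC sD] [[sX sZ _ _ _] [_ sf sSB sSD]]]] := collapse0 at_ T0.
  have lB := small_cvg It e0 d0 CB sSB; have lD := small_cvg It e0 d0 CD sSD.
  split=> //.
    apply: (close _ (fun t r => A t r - B t r) _ d d0 sX sf) lB => // r Jr.
    by rewrite /Xh; field; rewrite gt_eqF ?phi0.
  apply: (close _ (fun t r => C t r - D t r) _ d d0 sZ sf) lD => // r Jr.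
  by rewrite /Zh; field; rewrite gt_eqF ?phi0.
have [d d0 [[sA sB sC sD] [[sY sZ _ _] [_ sf sSB sSD]]]] := collapse1 at_ T0.
have lB := small_cvg It e1 d0 CB sSB; have lD := small_cvg It e1 d0 CD' sSD.
split=> //.
- apply: (close _ (fun t r => A t r - kl chi psi t r) _ d d0 sZ sf) lD => // r Jr.
  by rewrite /Zh; field; rewrite gt_eqF ?psi0.
- have [M M0 HM] := sY.
  have sY' : small t t (pi / 2) d 0 (fun t r => - Yh chi psi phi t r).
    by exists M => // s r sI Jr rd; rewrite normrN HM.
  apply: (close _ (fun t r => C t r - B t r) _ d d0 sY' sf) lB => // r Jr.
  by rewrite /Yh; field; rewrite gt_eqF ?psi0.
- apply/cvg_ex; exists (D t (pi / 2)); apply: cvg_within_filter.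
  suff : {for pi / 2, continuous (D t)} by [].
  have cS : {for pi / 2, continuous (S phi t)}.
    apply: isD_cont; apply: (Crinf_isD (J := setT) (I := I) _ It) => //.
    apply: Crinf_mul => //; first exact: Crinf_dr.
    by apply: Crinf_inv => // s r Is _; rewrite gt_eqF ?chi0.
  have cp : {for pi / 2, continuous (phi t)} by apply: isD_cont (phiD _ It).
  have pN : phi t (pi / 2) != 0.
    by rewrite /sphere_radius sin_pihalf mul1r gt_eqF ?b0.
  have -> : D t = fun r => (1 - S phi t r * S phi t r) / (phi t r * phi t r).
    by apply/funext => r; rewrite /kl !expr2.
  apply: cvgM; first by apply: cvgB; [exact: cvg_cst|exact: cvgM].
  by apply: cvgV; [rewrite mulf_neq0|exact: cvgM].
Qed.

(** ** Uniform bounds *)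

Section Bounds.
Variables (T : R) (T0 : T < 0).

Let ub (P : R -> Prop) F := exists2 M, 0 < M &
  forall t r, a <= t <= T -> J r -> P r -> `|F t r| <= M.

Let IT t : a <= t <= T -> I t.
Proof. by move=> /andP[t1 t2]; apply/andP; split=> //; exact: le_lt_trans T0. Qed.

Let ub_mul P F G : ub P F -> ub P G -> ub P (fun t r => F t r * G t r).
Proof.
move=> [M M0 HM] [N N0 HN]; exists (M * N); first exact: mulr_gt0.
by move=> t r tI Jr Pr; rewrite normrM ler_pM ?HM ?HN.
Qed.

Let ub_sub P F G : ub P F -> ub P G -> ub P (fun t r => F t r - G t r).
Proof.
move=> [M M0 HM] [N N0 HN]; exists (M + N); first exact: addr_gt0.
by move=> t r tI Jr Pr; rewrite (le_trans (ler_normB _ _))// lerD ?HM ?HN.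
Qed.

Let ub_ext P F G : (forall t r, I t -> J r -> F t r = G t r) -> ub P F -> ub P G.
Proof.
move=> FG [M M0 HM]; exists M => // t r tI Jr Pr.
by rewrite -FG ?HM//; exact: IT.
Qed.

Let ub_small r0 d F : small a T r0 d 0 F -> ub (fun r => `|r - r0| < d) F.
Proof.
move=> [M M0 HM]; exists M => // t r tI Jr rd.
by have := HM t r tI Jr rd; rewrite expr0 mulr1.
Qed.

Let ub_glob P F : Crinf I setT F -> ub P F.
Proof.
move=> CF; have [M M0 HM] := @cts_bounded _ I setT a T 0 (pi / 2) F IT
  (fun _ _ => Logic.I) (Crinf_cts CF).
by exists M => // t r tI /andP[r0 r1] _; apply: HM => //; rewrite !ltW.
Qed.

Let ub_union d d' F : 0 < d -> 0 < d' -> Crinf I J F ->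
  ub (fun r => `|r - 0| < d) F -> ub (fun r => `|r - pi / 2| < d') F ->
  ub (fun=> True) F.
Proof.
move=> d0 d'0 CF [M M0 HM] [M' M'0 HM'].
have mid r : d <= r <= pi / 2 - d' -> J r.
  by move=> /andP[r1 r2]; rewrite /J/= (lt_le_trans d0 r1) (le_lt_trans r2)// gtrBl.
have [N N0 HN] := cts_bounded IT mid (Crinf_cts CF).
exists (M + M' + N); first by rewrite !addr_gt0.
move=> t r tI Jr _.
have [rd|rd] := ltP (`|r - 0|) d; first by have := HM t r tI Jr rd; lra.
have [rd'|rd'] := ltP (`|r - pi / 2|) d'; first by have := HM' t r tI Jr rd'; lra.
have /andP[r0 r1] := Jr; move: rd rd'; rewrite subr0 gtr0_norm// => rd.
rewrite ltr0_norm ?subr_lt0// opprB => rd'.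
have : `|F t r| <= N by apply: HN => //; rewrite rd/=; lra.
lra.
Qed.

(** Each quantity is bounded near one end by the analysis of the collapsing sphere,
    near the other end by that of the collapsing circle, and in between by
    compactness. *)
Lemma uniform_bounds : exists2 M, 1 <= M & forall t r, a <= t <= T -> J r ->
  [/\ `|A t r| <= M, `|B t r| <= M, `|C t r| <= M & `|D t r| <= M] /\
  [/\ `|Xh chi psi phi t r| <= M, `|Yh chi psi phi t r| <= M
    & `|Zh chi phi t r| <= M] /\
  [/\ psi_slope chi psi phi t r <= M, phi_slope chi psi phi t r <= M,
      S phi t r ^+ 2 <= M, psi t r <= M & phi t r <= M].
Proof.
have [d d0 [[sA sB sC sD] [[sX sZ s1 s2 s3] [spsi sf _ _]]]] := collapse0 (lexx a) T0.
have [d' d'0 [[sA' sB' sC' sD'] [[sY' sZ' s1' s2'] [sphi sf' _ _]]]] :=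
  collapse1 (lexx a) T0.
have phiN t r : I t -> J r -> phi t r != 0 by move=> *; rewrite gt_eqF ?phi0.
have psiN t r : I t -> J r -> psi t r != 0 by move=> *; rewrite gt_eqF ?psi0.
have CSphi : Crinf I setT (S phi).
  apply: Crinf_mul => //; first exact: Crinf_dr.
  by apply: Crinf_inv => // s r Is _; rewrite gt_eqF ?chi0.
have CX : Crinf I J (Xh chi psi phi) by exact: Crinf_Xh.
have CY : Crinf I J (Yh chi psi phi) by exact: Crinf_Yh.
have CZ : Crinf I J (Zh chi phi) by exact: Crinf_Zh.
have CS F : Crinf I J F -> Crinf I J (S F) by move=> CF; exact: Crinf_arcd.
have Cq F G : Crinf I J F -> Crinf I J G -> (forall t r, I t -> J r -> G t r != 0) ->
    Crinf I J (fun t r => S F t r ^+ 2 / G t r ^+ 2).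
  move=> CF CG G0; apply: Crinf_mul => //; first by apply: Crinf_exp => //; exact: CS.
  apply: Crinf_inv => //; last exact: Crinf_exp.
  by move=> t r It Jr; rewrite expf_neq0 ?G0.
have uphi := ub_small sphi; have upsi := ub_small spsi.
have uSphi P : ub P (S phi) by exact: ub_glob.
have uD' : ub (fun r => `|r - pi / 2| < d') D.
  have u1 : ub (fun r => `|r - pi / 2| < d') (fun _ _ => 1).
    by apply: ub_glob; exact: Crinf_cst.
  apply: ub_ext (ub_mul (ub_sub u1 (ub_mul (uSphi _) (uSphi _))) (ub_mul uphi uphi)).
  by move=> t r It Jr; rewrite /kl; field; exact: phiN.
have [M1 M10 H1] : ub (fun=> True) A := ub_union d0 d'0 CA (ub_small sA) (ub_small sA').
have [M2 M20 H2] : ub (fun=> True) B := ub_union d0 d'0 CB (ub_small sB) (ub_small sB').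
have [M3 M30 H3] : ub (fun=> True) C := ub_union d0 d'0 CC (ub_small sC) (ub_small sC').
have [M4 M40 H4] : ub (fun=> True) D := ub_union d0 d'0 CD (ub_small sD) uD'.
have [M5 M50 H5] : ub (fun=> True) (Xh chi psi phi).
  apply: (ub_union d0 d'0 CX (ub_small sX)).
  apply: (ub_ext _ (ub_mul (ub_sub (ub_small sA') (ub_small sB')) (ub_mul uphi uphi))).
  by move=> t r It Jr; rewrite /Xh; field; exact: phiN.
have [M6 M60 H6] : ub (fun=> True) (Yh chi psi phi).
  apply: (ub_union d0 d'0 CY _ (ub_small sY')).
  apply: (ub_ext _ (ub_mul (ub_sub (ub_small sB) (ub_small sC)) (ub_mul upsi upsi))).
  by move=> t r It Jr; rewrite /Yh; field; exact: psiN.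
have [M7 M70 H7] : ub (fun=> True) (Zh chi phi).
  apply: (ub_union d0 d'0 CZ (ub_small sZ)).
  apply: (ub_ext _ (ub_mul (ub_sub (ub_small sC') uD') (ub_mul uphi uphi))).
  by move=> t r It Jr; rewrite /Zh; field; exact: phiN.
have [M8 M80 H8] : ub (fun=> True) (psi_slope chi psi phi).
  by apply: (ub_union d0 d'0 _ (ub_small s1) (ub_small s1')); exact: Cq.
have [M9 M90 H9] : ub (fun=> True) (phi_slope chi psi phi).
  by apply: (ub_union d0 d'0 _ (ub_small s2) (ub_small s2')); exact: Cq.
have [M10' M100 H10] : ub (fun=> True) (fun t r => S phi t r ^+ 2).
  by apply: (ub_ext _ (ub_mul (uSphi _) (uSphi _))) => t r It Jr; rewrite expr2.
have [M11 M110 H11] : ub (fun=> True) psi by exact: ub_glob.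
have [M12 M120 H12] : ub (fun=> True) phi by exact: ub_glob.
have [M M1' [[L1 L2 L3 L4] [[L5 L6 L7 L8] [L9 L10 L11 L12]]]] :=
  common_bound M1 M2 M3 M4 M5 M6 M7 M8 M9 M10' M11 M12.
exists M => //.
move=> t r tI Jr; split; last split.
- by split; [apply: le_trans (H1 t r tI Jr Logic.I) _|apply: le_trans (H2 t r tI Jr Logic.I) _
    |apply: le_trans (H3 t r tI Jr Logic.I) _|apply: le_trans (H4 t r tI Jr Logic.I) _].
- by split; [apply: le_trans (H5 t r tI Jr Logic.I) _|apply: le_trans (H6 t r tI Jr Logic.I) _
    |apply: le_trans (H7 t r tI Jr Logic.I) _].
- split; apply: le_trans (ler_norm _) _.
  + by apply: le_trans (H8 t r tI Jr Logic.I) _.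
  + by apply: le_trans (H9 t r tI Jr Logic.I) _.
  + by apply: le_trans (H10 t r tI Jr Logic.I) _.
  + by apply: le_trans (H11 t r tI Jr Logic.I) _.
  + by apply: le_trans (H12 t r tI Jr Logic.I) _.
Qed.

End Bounds.

Let phi_vanish T : T < 0 -> a <= T -> exists2 M, 0 < M & forall t r, a <= t <= T -> J r ->
  [/\ phi t r <= M * r, psi t r <= M * (pi / 2 - r), phi t r <= M & psi t r <= M].
Proof.
move=> T0 aT; have IT t : a <= t <= T -> I t.
  by move=> /andP[t1 t2]; apply/andP; split=> //; exact: le_lt_trans T0.
have glob F : Crinf I setT F -> exists2 M, 0 < M &
    forall t r, a <= t <= T -> 0 <= r <= pi / 2 -> `|F t r| <= M.
  by move=> CF; exact: (cts_bounded (I := I) (J := setT) IT _ (Crinf_cts CF)).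
have [M1 M10 H1] := glob _ (Crinf_dr Cphi); have [M2 M20 H2] := glob _ (Crinf_dr Cpsi).
have [M3 M30 H3] := glob _ Cphi; have [M4 M40 H4] := glob _ Cpsi.
have [M M1' [[L1 L2 L3 L4] _]] := common_bound M1 M2 M3 M4 0 0 0 0 0 0 0 0.
exists M; first exact: lt_le_trans M1'.
move=> t r tI /andP[r0 r1].
have rr : 0 <= r <= pi / 2 by rewrite !ltW.
have phiI x : is_derive x (1 : R) (phi t) (dr phi t x) by exact: (Crinf_isD Cphi (IT t tI) Logic.I).
have psiI x : is_derive x (1 : R) (psi t) (dr psi t x) by exact: (Crinf_isD Cpsi (IT t tI) Logic.I).
have phi_0 : phi t 0 = 0 by rewrite /sphere_radius sin0 mul0r.
have psi_1 : psi t (pi / 2) = 0 by rewrite /circle_radius cos_pihalf mul0r.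
split.
- have [c cI] := @mean_value _ (phi t) (dr phi t) 0 r (fun x _ => phiI x).
  move: cI; rewrite (min_l (ltW r0)) (max_r (ltW r0)) phi_0 !subr0 => /andP[c0 c1] ->.
  rewrite ler_wpM2r ?(ltW r0)// (le_trans (ler_norm _))// (le_trans (H1 t c tI _))//.
  by rewrite c0 (le_trans c1)// ltW.
- have [c cI] := @mean_value _ (psi t) (dr psi t) (pi / 2) r (fun x _ => psiI x).
  move: cI; rewrite (min_r (ltW r1)) (max_l (ltW r1)) psi_1 subr0 => /andP[c0 c1] ->.
  rewrite -opprB mulrN -mulNr ler_wpM2r ?subr_ge0 ?(ltW r1)//.
  rewrite (le_trans (ler_norm _))// normrN (le_trans (H2 t c tI _))//.
  by rewrite c1 (le_trans (ltW r0)).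
- by rewrite (le_trans (ler_norm _))// (le_trans (H3 t r tI rr)).
- by rewrite (le_trans (ler_norm _))// (le_trans (H4 t r tI rr)).
Qed.

Let barrier_infinite T : T < 0 -> a <= T -> forall N, exists d1 d2 : R,
  [/\ 0 < d1, d2 < pi / 2 & forall t r, a <= t <= T -> J r -> ~~ (d1 <= r <= d2) ->
     N <= barrier psi phi t r].
Proof.
move=> T0 aT N; have [M M0 HM] := phi_vanish T0 aT.
pose d := expR (- N) / (M * M).
have d0 : 0 < d by rewrite divr_gt0 ?expR_gt0// mulr_gt0.
exists d, (pi / 2 - d); split=> // [|t r tI Jr]; first by rewrite gtrBl.
have It : I t by case/andP: tI => ? ?; apply/andP; split=> //; exact: le_lt_trans T0.
have [H1 H2 H3 H4] := HM t r tI Jr; have ph := phi0 It Jr; have ps := psi0 It Jr.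
have key : phi t r * psi t r <= expR (- N) -> N <= barrier psi phi t r.
  have pos1 : phi t r * psi t r \is Num.pos by rewrite posrE mulr_gt0.
  have pos2 : expR (- N) \is Num.pos by rewrite posrE expR_gt0.
  rewrite -(ler_ln pos1 pos2) expRK => H.
  by rewrite /barrier -opprD -lnM ?posrE// lerNr.
rewrite negb_and -!ltNge => /orP[rd|rd]; apply: key.
  have -> : expR (- N) = (M * d) * M by rewrite /d; field; rewrite gt_eqF.
  by rewrite ler_pM ?(ltW ph) ?(ltW ps)// (le_trans H1)// ler_pM2l// ltW.
have -> : expR (- N) = M * (M * d) by rewrite /d; field; rewrite gt_eqF.
rewrite ler_pM ?(ltW ph) ?(ltW ps)// (le_trans H2)// ler_pM2l//; lra.
Qed.

Definition curvature_order t r : Prop :=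
  [/\ extend (B t) r <= extend (A t) r, extend (C t) r <= extend (B t) r,
      extend (D t) r <= extend (C t) r & 0 < extend (D t) r].

(** On the open interval the order of the curvatures is the nonnegativity of [X],
    [Y], [Z] together with a positive lower bound of [D]; that bound exists
    initially because [D] also has positive limits at the ends. At the ends the
    inequalities pass to the limit. *)
Theorem curvature_order_preserved :
  (forall r, 0 <= r <= pi / 2 -> curvature_order a r) ->
  forall t, a <= t < 0 -> forall r, 0 <= r <= pi / 2 -> curvature_order t r.
Proof.
move=> init t It; have /andP[at_ t0] := It.
have Ia : I a by rewrite /I/= lexx (le_lt_trans at_).
have lims s r0 (Is : I s) (er : endpoint r0) := curvature_limits Is er.
have pi0 : 0 < pi / 2 :> R by rewrite divr_gt0// pi_gt0.
have inJ r : J r -> curvature_order a r by move=> /andP[/ltW r0 /ltW r1]; apply: init; rewrite r0.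
have ext_pos r0 : endpoint r0 -> exists2 l : R, 0 < l & D a x @[x --> within J (nbhs r0)] --> l.
  move=> er; have [_ _ _ /cvg_ex[l Dl]] := lims a r0 Ia er; exists l => //.
  have [|_ _ _] := init r0; last by rewrite (extend_end er Dl).
  by case: er => ->; rewrite lexx ltW.
have [l0 l00 D0] := ext_pos 0 e0; have [l1 l10 D1] := ext_pos (pi / 2) e1.
have [r Jr|r Jr|delta delta0 Dd] := positive_lower l00 l10 D0 D1.
- exact: isD_cont (Crinf_isD CD Ia Jr).
- by have [_ _ _] := inJ r Jr; rewrite extend_in.
have [M M1 HM] := uniform_bounds t0.
have initJ r : J r -> [/\ 0 <= Xh chi psi phi a r, 0 <= Yh chi psi phi a r,
    0 <= Zh chi phi a r & delta <= D a r].
  move=> Jr; have [] := inJ r Jr; rewrite !extend_in// => H1 H2 H3 _.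
  by split; rewrite ?Dd// divr_ge0 ?sqr_ge0// subr_ge0.
have pos r : J r -> [/\ C t r <= B t r, B t r <= A t r, D t r <= C t r & delta <= D t r].
  move=> Jr; have tt : a <= t <= t by rewrite at_ lexx.
  have [X0 Y0 Z0 Dt] := positivity m0 chiJ psi0 phi0 Cchi' Cpsi' Cphi' Tchi Tpsi Tphi
     at_ t0 M1 delta0 HM (barrier_infinite t0 at_) initJ tt Jr.
  have up : 0 < phi t r ^+ 2 by rewrite exprn_gt0 ?phi0.
  have vp : 0 < psi t r ^+ 2 by rewrite exprn_gt0 ?psi0.
  by split=> //; rewrite -subr_ge0; [move: Y0|move: X0|move: Z0];
    rewrite pmulr_lge0 ?invr_gt0.
move=> r /andP[r0 r1].
have [Jr|er] : J r \/ endpoint r.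
  move: r0; rewrite le_eqVlt => /orP[/eqP <-|r0]; first by right; left.
  move: r1; rewrite le_eqVlt => /orP[/eqP ->|r1]; first by right; right.
  by left; rewrite /J/= r0.
  rewrite /curvature_order !extend_in//; have [H1 H2 H3 H4] := pos r Jr.
  by split=> //; exact: lt_le_trans H4.
have [/cvg_ex[lA Al] /cvg_ex[lB Bl] /cvg_ex[lC Cl] /cvg_ex[lD Dl]] := lims t r It er.
have PF := endpoint_proper er.
rewrite /curvature_order (extend_end er Al) (extend_end er Bl) (extend_end er Cl).
rewrite (extend_end er Dl).
have nJ (P : R -> Prop) : (forall x, J x -> P x) -> \forall x \near within J (nbhs r), P x.
  by move=> H; rewrite near_withinE; apply: nearW.
split.
- by apply: ler_cvg_to Bl Al _; apply: nJ => x /pos[].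
- by apply: ler_cvg_to Cl Bl _; apply: nJ => x /pos[].
- by apply: ler_cvg_to Dl Cl _; apply: nJ => x /pos[].
- apply: lt_le_trans delta0 _; apply: cvgr_to_ge Dl _; apply: nJ => x /pos[] //.
Qed.

End WarpedFlow.

(** * Functions of class C^k *)

Section DirectionalDerivatives.
Context {R : realType} {V : normedModType R}.
Implicit Types (f g : V -> R) (x v : V) (a b : R).

Lemma isDv_cst x v (c : R) : is_derive x v (fun=> c) 0.
Proof. exact: is_derive_cst. Qed.

Lemma isDv_line f x v a :
  is_derive x v f a <-> is_derive (0 : R) (1 : R) (fun h => f (h *: v + x)) a.
Proof.
have D : 'D_v f x = 'D_1 (fun h : R => f (h *: v + x)) 0.
  rewrite /derive; set g1 := fun h => h^-1 *: _; set g2 := fun h => h^-1 *: _.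
  suff -> : g1 = g2 by [].
  by rewrite funeqE /g1 /g2 => h /=; rewrite addr0 scale0r add0r [_%:A]mulr1.
split=> -[df <-].
  by apply: DeriveDef; [exact: (derivable1P f x v).1 df|rewrite D].
by apply: DeriveDef; [exact: (derivable1P f x v).2 df|rewrite D].
Qed.

Lemma isDv_comp f (h : R -> R) x v a b : is_derive x v f a ->
  is_derive (f x) 1 h b -> is_derive x v (fun y => h (f y)) (b * a).
Proof.
move=> /isDv_line fa hb; apply/isDv_line.
by apply: (isD_comp (f := fun h => f (h *: v + x)) fa); rewrite scale0r add0r.
Qed.

Lemma isDv_sum n (F : 'I_n -> V -> R) x v (a : 'I_n -> R) :
  (forall i, is_derive x v (F i) (a i)) ->
  is_derive x v (fun y => \sum_i F i y) (\sum_i a i).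
Proof.
move=> H; rewrite (_ : (fun y => _) = \sum_i F i); first exact: is_derive_sum.
by apply/funext => y; rewrite fct_sumE.
Qed.

Lemma isDv_derive f x v a : is_derive x v f a -> 'D_v f x = a.
Proof. by move=> []. Qed.

End DirectionalDerivatives.

Section MatrixDerivative.
Context {R : realType} {V : normedModType R}.

Lemma isDv_mx m n (F : V -> 'M[R]_(m, n)) x v (dF : 'M[R]_(m, n)) :
  (forall i j, is_derive x v (fun y => F y i j) (dF i j)) -> is_derive x v F dF.
Proof.
move=> H; have dv : derivable F x v by apply/derivable_mxP => i j; have [] := H i j.
split=> //; rewrite derive_mx//; apply/matrixP => i j; rewrite !mxE.
exact: isDv_derive (H i j).
Qed.

Lemma isDv_coord m n (x v : 'M[R]_(m, n)) i j :
  is_derive x v (fun y : 'M[R]_(m, n) => y i j) (v i j).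
Proof.
apply/isDv_line.
apply: (isD_ext (g := fun h => h * v i j + x i j)) => [h|]; first by rewrite !mxE.
apply: isD_eq (isD_add (isD_mul (isD_id 0) (isD_cst 0 _)) (isD_cst 0 _)) _.
by rewrite mulr0 mul1r !addr0.
Qed.

End MatrixDerivative.

Section SmoothClosure.
Context {R : realType} {V : normedModType R} (O : set V) (openO : open O).
Implicit Types (f g : V -> R) (k : nat).

Lemma Ck_continuous (W : normedModType R) k (f : V -> W) :
  Ck k O f -> forall x, O x -> {for x, continuous f}.
Proof. by case: k => [|k] []. Qed.

Lemma Ck_ext (W : normedModType R) k (f g : V -> W) :
  (forall x, O x -> f x = g x) -> Ck k O f -> Ck k O g.
Proof.
have nfg (f' g' : V -> W) x : (forall x, O x -> f' x = g' x) -> O x ->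
    \forall y \near x, f' y = g' y.
  move=> fg Ox; have : nbhs x O by apply: open_nbhs_nbhs.
  by apply: filterS.
elim: k f g => [|k IH] f g fg [cf H].
  split=> // x Ox; change (g @ x --> g x); rewrite -fg//.
  by apply: cvg_trans (cf x Ox); apply: near_eq_cvg; exact: nfg.
split=> [x Ox|v].
  change (g @ x --> g x); rewrite -fg//.
  by apply: cvg_trans (cf x Ox); apply: near_eq_cvg; exact: nfg.
have [df Cf] := H v; split=> [x Ox|].
  by apply: near_eq_derivable (df x Ox); exact: nfg.
by apply: IH Cf => x Ox; apply: near_eq_derive; exact: nfg.
Qed.

Lemma Ck_intro (W : normedModType R) k (f : V -> W) (df : V -> V -> W) :
  (forall x, O x -> {for x, continuous f}) ->
  (forall v x, O x -> is_derive x v f (df v x)) ->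
  (forall v, Ck k O (df v)) -> Ck k.+1 O f.
Proof.
move=> cf fdf Cdf; split=> // v; split.
  by move=> x Ox; have [] := fdf v x Ox.
by apply: Ck_ext (Cdf v) => x Ox; have [_] := fdf v x Ox.
Qed.

Lemma Ck_isD (W : normedModType R) k (f : V -> W) v x : Ck k.+1 O f -> O x ->
  is_derive x v f ('D_v f x).
Proof. by move=> [_ /(_ v)[df _]] Ox; exact: derivableP (df x Ox). Qed.

Lemma Ck_D (W : normedModType R) k (f : V -> W) v : Ck k.+1 O f -> Ck k O ('D_v f).
Proof. by move=> [_ /(_ v)[]]. Qed.

Lemma Ck_pred (W : normedModType R) k (f : V -> W) : Ck k.+1 O f -> Ck k O f.
Proof.
elim: k f => [|k IH] f [cf H]; first by split.
by split=> // v; have [df Cf] := H v; split=> //; exact: IH.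
Qed.

Lemma Ck_cst k (c : R) : Ck k O (fun=> c).
Proof.
elim: k c => [|k IH] c; first by split=> // x _; exact: cst_continuous.
apply: (@Ck_intro _ _ _ (fun _ _ => 0)) => //.
by move=> x _; exact: cst_continuous.
Qed.

Lemma Ck_add k f g : Ck k O f -> Ck k O g -> Ck k O (fun x => f x + g x).
Proof.
have cD f' g' : (forall x, O x -> {for x, continuous f'}) ->
    (forall x, O x -> {for x, continuous g'}) ->
    forall x, O x -> {for x, continuous (fun x => f' x + g' x : R)}.
  by move=> cf cg x Ox; apply: cvgD; [exact: cf|exact: cg].
elim: k f g => [|k IH] f g Cf Cg.
  by split=> //; apply: cD; [exact: Ck_continuous Cf|exact: Ck_continuous Cg].
apply: (@Ck_intro _ _ _ (fun v x => 'D_v f x + 'D_v g x)).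
- by apply: cD; [exact: Ck_continuous Cf|exact: Ck_continuous Cg].
- by move=> v x Ox; exact: isD_add (Ck_isD v Cf Ox) (Ck_isD v Cg Ox).
- by move=> v; exact: IH (Ck_D v Cf) (Ck_D v Cg).
Qed.

Lemma Ck_mul k f g : Ck k O f -> Ck k O g -> Ck k O (fun x => f x * g x).
Proof.
have cM f' g' : (forall x, O x -> {for x, continuous f'}) ->
    (forall x, O x -> {for x, continuous g'}) ->
    forall x, O x -> {for x, continuous (fun x => f' x * g' x : R)}.
  by move=> cf cg x Ox; apply: cvgM; [exact: cf|exact: cg].
elim: k f g => [|k IH] f g Cf Cg.
  by split=> //; apply: cM; [exact: Ck_continuous Cf|exact: Ck_continuous Cg].
apply: (@Ck_intro _ _ _ (fun v x => 'D_v f x * g x + f x * 'D_v g x)).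
- by apply: cM; [exact: Ck_continuous Cf|exact: Ck_continuous Cg].
- by move=> v x Ox; exact: isD_mul (Ck_isD v Cf Ox) (Ck_isD v Cg Ox).
- move=> v; apply: Ck_add; first exact: IH (Ck_D v Cf) (Ck_pred Cg).
  exact: IH (Ck_pred Cf) (Ck_D v Cg).
Qed.

Lemma Ck_opp k f : Ck k O f -> Ck k O (fun x => - f x).
Proof.
by move=> Cf; apply: Ck_ext (Ck_mul (Ck_cst k (-1)) Cf) => x _; rewrite mulN1r.
Qed.

Lemma Ck_inv k f : (forall x, O x -> f x != 0) -> Ck k O f ->
  Ck k O (fun x => (f x)^-1).
Proof.
move=> f0; have cV : (forall x, O x -> {for x, continuous f}) ->
    forall x, O x -> {for x, continuous (fun x => (f x)^-1 : R)}.
  by move=> cf x Ox; apply: cvgV; [exact: f0|exact: cf].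
elim: k => [|k IH] Cf; first by split=> //; apply: cV; exact: Ck_continuous Cf.
apply: (@Ck_intro _ _ _ (fun v x => - ('D_v f x * ((f x)^-1 * (f x)^-1)))).
- by apply: cV; exact: Ck_continuous Cf.
- move=> v x Ox; apply: isD_eq (isD_inv (f0 x Ox) (Ck_isD v Cf Ox)) _.
  by rewrite mulNr expr2 invfM.
- move=> v; apply: Ck_opp; apply: Ck_mul (Ck_D v Cf) _.
  by apply: Ck_mul; exact: IH (Ck_pred Cf).
Qed.

Lemma Ck_sincos k f : Ck k O f ->
  Ck k O (fun x => sin (f x)) /\ Ck k O (fun x => cos (f x)).
Proof.
have cC (h : R -> R) : continuous h -> (forall x, O x -> {for x, continuous f}) ->
    forall x, O x -> {for x, continuous (fun x => h (f x))}.
  by move=> ch cf x Ox; apply: continuous_comp (cf x Ox) _; exact: ch.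
elim: k => [|k IH] Cf; have cf := Ck_continuous Cf.
  by split; split=> //; apply: cC => //; [exact: continuous_sin|exact: continuous_cos].
have [Cs Cc] := IH (Ck_pred Cf); split.
  apply: (@Ck_intro _ _ _ (fun v x => cos (f x) * 'D_v f x)).
  - by apply: cC cf; exact: continuous_sin.
  - by move=> v x Ox; exact: isDv_comp (Ck_isD v Cf Ox) (isD_sin (f x)).
  - by move=> v; exact: Ck_mul Cc (Ck_D v Cf).
apply: (@Ck_intro _ _ _ (fun v x => - sin (f x) * 'D_v f x)).
- by apply: cC cf; exact: continuous_cos.
- by move=> v x Ox; exact: isDv_comp (Ck_isD v Cf Ox) (isD_cos (f x)).
- by move=> v; exact: Ck_mul (Ck_opp Cs) (Ck_D v Cf).
Qed.

Lemma Ck_sum k n (F : 'I_n -> V -> R) : (forall i, Ck k O (F i)) ->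
  Ck k O (fun x => \sum_i F i x).
Proof.
elim: n F => [|n IH] F CF.
  by apply: Ck_ext (Ck_cst k 0) => x _; rewrite big_ord0.
apply: Ck_ext (Ck_add (CF ord0) (IH (fun i => F (lift ord0 i)) (fun i => CF _))) => x _.
by rewrite big_ord_recl.
Qed.

Lemma Ck_mx k m n (F : V -> 'M[R]_(m, n)) : (forall i j, Ck k O (fun x => F x i j)) ->
  Ck k O F.
Proof.
have cM (G : V -> 'M[R]_(m, n)) :
    (forall i j x, O x -> {for x, continuous (fun x => G x i j)}) ->
    forall x, O x -> {for x, continuous G}.
  move=> cG x Ox; apply/cvgrPdist_le => e e0.
  have : \forall y \near x, forall i j, `|G x i j - G y i j| <= e.
    apply: filter_forall => i; apply: filter_forall => j.
    by have /cvgrPdist_le/(_ e e0) := cG i j x Ox.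
  apply: filterS => y H; rewrite /Num.Def.normr/= mx_normrE.
  by apply: bigmax_le; [exact: ltW|move=> i _; rewrite !mxE; exact: H].
elim: k F => [|k IH] F CF.
  by split=> //; apply: cM => i j; exact: Ck_continuous (CF i j).
apply: (@Ck_intro _ _ _ (fun v x => \matrix_(i, j) 'D_v (fun y => F y i j) x)).
- by apply: cM => i j; exact: Ck_continuous (CF i j).
- by move=> v x Ox; apply: isDv_mx => i j; rewrite mxE; exact: Ck_isD (CF i j) Ox.
- move=> v; apply: IH => i j; apply: Ck_ext (Ck_D v (CF i j)) => x _.
  by rewrite mxE.
Qed.

End SmoothClosure.

Lemma Ck_coord (R : realType) (n k : nat) (O : set 'rV[R]_n) (i : 'I_n) : open O ->
  Ck k O (fun x : 'rV[R]_n => x 0 i : R).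
Proof.
move=> oO; case: k => [|k].
  by split=> // x _; exact: coord_continuous.
apply: (Ck_intro oO (df := fun v _ => v 0 i)).
- by move=> x _; exact: coord_continuous.
- by move=> v x _; exact: isDv_coord.
- by move=> v; exact: Ck_cst.
Qed.

(** * Metrics invariant under O(2) x O(n - 1) *)

Section Householder.
Context {R : realType} {k : nat}.
Implicit Types (u v w : 'rV[R]_k) (P Q : 'M[R]_k).

Definition dot u v : R := (u *m v^T) 0 0.

Lemma dot_mx u v : u *m v^T = (dot u v)%:M.
Proof. by rewrite [LHS]mx11_scalar. Qed.

Lemma dotE u v : dot u v = \sum_i u 0 i * v 0 i.
Proof. by rewrite /dot mxE; apply: eq_bigr => i _; rewrite mxE. Qed.

Lemma dotC u v : dot u v = dot v u.
Proof. by rewrite !dotE; apply: eq_bigr => i _; rewrite mulrC. Qed.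

Lemma dotDl u v w : dot (u + v) w = dot u w + dot v w.
Proof. by rewrite /dot mulmxDl mxE. Qed.

Lemma dotZl a u w : dot (a *: u) w = a * dot u w.
Proof. by rewrite /dot -scalemxAl mxE. Qed.

Lemma dotNl u w : dot (- u) w = - dot u w.
Proof. by rewrite /dot mulNmx mxE. Qed.

Lemma dotDr u v w : dot w (u + v) = dot w u + dot w v.
Proof. by rewrite !(dotC w) dotDl. Qed.

Lemma dotZr a u w : dot w (a *: u) = a * dot w u.
Proof. by rewrite !(dotC w) dotZl. Qed.

Lemma dotNr u w : dot w (- u) = - dot w u.
Proof. by rewrite !(dotC w) dotNl. Qed.

Lemma dot_ge0 u : 0 <= dot u u.
Proof. by rewrite dotE sumr_ge0// => i _; rewrite -expr2 sqr_ge0. Qed.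

Lemma dot_eq0 u : (dot u u == 0) = (u == 0).
Proof.
apply/idP/eqP => [|->]; last by rewrite /dot mul0mx mxE.
rewrite dotE psumr_eq0 => [/allP H|i _]; last by rewrite -expr2 sqr_ge0.
apply/rowP => i; have := H i (mem_index_enum i).
by rewrite /= mulf_eq0 orbb mxE => /eqP.
Qed.

Lemma dot_orthogonal Q u v : orthogonal_mx Q -> dot (u *m Q) (v *m Q) = dot u v.
Proof. by move=> oQ; rewrite /dot trmx_mul mulmxA -(mulmxA u) oQ mulmx1. Qed.

Lemma orthogonal_mx1 : orthogonal_mx (1%:M : 'M[R]_k).
Proof. by rewrite /orthogonal_mx trmx1 mulmx1. Qed.

(** The reflection in the hyperplane orthogonal to [v], which is the identity
    for [v = 0] since then the factor is [2 / 0 = 0]. *)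
Definition reflection v : 'M[R]_k := 1%:M - (2 / dot v v) *: (v^T *m v).

Lemma mul_reflection u v :
  u *m reflection v = u - (2 * dot u v / dot v v) *: v.
Proof.
rewrite mulmxBr mulmx1 -scalemxAr mulmxA dot_mx mul_scalar_mx scalerA.
by rewrite mulrAC.
Qed.

Lemma reflection_orthogonal v : orthogonal_mx (reflection v).
Proof.
rewrite /orthogonal_mx /reflection; set c := 2 / _; set P := v^T *m v.
have tP : P^T = P by rewrite /P trmx_mul trmxK.
have PP : P *m P = dot v v *: P.
  by rewrite /P mulmxA -(mulmxA _ v) dot_mx mul_mx_scalar -scalemxAl.
have -> : (1%:M - c *: P)^T = 1%:M - c *: P.
  by apply/matrixP => i j; rewrite -{2}tP !mxE eq_sym.
rewrite mulmxBl mul1mx mulmxBr mulmx1 -scalemxAr -scalemxAl.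
rewrite PP !scalerA.
have [v0|v0] := eqVneq v 0.
  by rewrite /P v0 mulmx0 !scaler0 !subr0.
rewrite (_ : c * c * dot v v = c + c); last first.
  by rewrite /c; field; rewrite dot_eq0.
set x := c *: P; rewrite scalerDl -/x.
by rewrite (_ : x - (x + x) = - x) ?opprK ?subrK// opprD addrA subrr sub0r.
Qed.

Lemma reflection_fix u v : dot u v = 0 -> u *m reflection v = u.
Proof. by move=> uv; rewrite mul_reflection uv mulr0 mul0r scale0r subr0. Qed.

Lemma reflection_flip v : v *m reflection v = - v.
Proof.
rewrite mul_reflection; have [->|v0] := eqVneq v 0; first by rewrite scaler0 subr0 oppr0.
rewrite mulfK ?dot_eq0//; rewrite (_ : 2 = 1 + 1)// scalerDl scale1r opprD addrA.
by rewrite subrr sub0r.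
Qed.

Lemma reflection_swap u v : dot u u = dot v v -> u *m reflection (u - v) = v.
Proof.
move=> uv; have [/eqP|uv0] := eqVneq (u - v) 0.
  rewrite subr_eq0 => /eqP ->; rewrite subrr reflection_fix//.
  by rewrite /dot trmx0 mulmx0 mxE.
rewrite mul_reflection (_ : 2 * dot u (u - v) = dot (u - v) (u - v)).
  by rewrite divff ?dot_eq0// scale1r opprB addrCA subrr addr0.
rewrite dotDr dotNr !(dotDl, dotNl, dotDr, dotNr) (dotC v u) -uv; ring.
Qed.

End Householder.

Section Invariance.
Context {R : realType} {m : nat} (g : tensor2 R m.+2).
Hypothesis ginv : invariant_metric g.
Implicit Types (r : R) (c : 'rV[R]_2) (w : 'rV[R]_(m.+1)).

(** The point at distance [r] from [c] on the great circle from [c] to [w], and the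
    velocity of this great circle. *)
Definition pt r c w : ambient R m.+2 := row_mx (cos r *: c) (sin r *: w).
Definition dpt r c w : ambient R m.+2 := row_mx (- sin r *: c) (cos r *: w).

Lemma dot_row k l (a b : 'rV[R]_k) (a' b' : 'rV[R]_l) :
  dot (row_mx a a') (row_mx b b') = dot a b + dot a' b'.
Proof. by rewrite /dot tr_row_mx mul_row_col mxE. Qed.

Lemma sphereE (p : ambient R m.+2) : sphere p <-> dot p p = 1.
Proof.
rewrite /sphere/= dot_mx; split=> [/matrixP/(_ 0 0)|->//].
by rewrite !mxE.
Qed.

Lemma tangentE (p u : ambient R m.+2) : tangent p u <-> dot u p = 0.
Proof.
rewrite /tangent/= dot_mx; split=> [/matrixP/(_ 0 0)|->]; first by rewrite !mxE.
by apply/matrixP => i j; rewrite !mxE mul0rn.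
Qed.

Lemma sphere_pt r c w : dot c c = 1 -> dot w w = 1 -> sphere (pt r c w).
Proof.
move=> cc ww; apply/sphereE; rewrite dot_row !dotZl !dotZr cc ww !mulr1 -!expr2.
exact: cos2Dsin2.
Qed.

Lemma tangent_dpt r c w : dot c c = 1 -> dot w w = 1 -> tangent (pt r c w) (dpt r c w).
Proof.
move=> cc ww; apply/tangentE; rewrite dot_row !dotZl !dotZr cc ww; ring.
Qed.

Lemma tangent_circle r c w c' : dot c' c = 0 -> tangent (pt r c w) (row_mx c' 0).
Proof.
by move=> cc; apply/tangentE; rewrite dot_row !dotZr cc /dot mul0mx mxE !mulr0 addr0.
Qed.

Lemma tangent_sphere r c w w' : dot w' w = 0 -> tangent (pt r c w) (row_mx 0 w').
Proof.
by move=> cc; apply/tangentE; rewrite dot_row !dotZr cc /dot mul0mx mxE !mulr0 addr0.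
Qed.

Lemma inner_move P Q (p1 u1 v1 : 'rV[R]_2) (p2 u2 v2 : 'rV[R]_(m.+1)) :
  orthogonal_mx P -> orthogonal_mx Q ->
  let p : ambient R m.+2 := row_mx p1 p2 in
  sphere p -> tangent p (row_mx u1 u2) -> tangent p (row_mx v1 v2) ->
  inner g (row_mx (p1 *m P) (p2 *m Q) : ambient R m.+2)
    (row_mx (u1 *m P) (u2 *m Q)) (row_mx (v1 *m P) (v2 *m Q)) =
  inner g p (row_mx u1 u2) (row_mx v1 v2).
Proof.
move=> oP oQ p sp tu tv; rewrite -(ginv oP oQ sp tu tv) /p.
by rewrite !mul_row_block !mulmx0 !addr0 !add0r.
Qed.

Lemma innerNl (p u v : ambient R m.+2) : inner g p (- u) v = - inner g p u v.
Proof. by rewrite /inner !mulNmx mxE. Qed.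
Lemma innerNr (p u v : ambient R m.+2) : inner g p u (- v) = - inner g p u v.
Proof. by rewrite /inner linearN/= mulmxN mxE. Qed.
Lemma innerZ (p u v : ambient R m.+2) a b :
  inner g p (a *: u) (b *: v) = a * b * inner g p u v.
Proof. by rewrite /inner linearZ/= -!scalemxAl -scalemxAr scalerA mxE. Qed.

(** Tangent vectors that a symmetry fixing the point distinguishes by a sign
    are orthogonal. *)
Lemma inner_flip P Q (p1 u1 v1 : 'rV[R]_2) (p2 u2 v2 : 'rV[R]_(m.+1)) :
  orthogonal_mx P -> orthogonal_mx Q ->
  let p : ambient R m.+2 := row_mx p1 p2 in
  sphere p -> tangent p (row_mx u1 u2) -> tangent p (row_mx v1 v2) ->
  p1 *m P = p1 -> p2 *m Q = p2 -> u1 *m P = u1 -> u2 *m Q = u2 ->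
  v1 *m P = - v1 -> v2 *m Q = - v2 ->
  inner g p (row_mx u1 u2) (row_mx v1 v2) = 0 /\
  inner g p (row_mx v1 v2) (row_mx u1 u2) = 0.
Proof.
move=> oP oQ p sp tu tv Ep1 Ep2 Eu1 Eu2 Ev1 Ev2.
have := inner_move oP oQ sp tu tv; have := inner_move oP oQ sp tv tu.
rewrite Ep1 Ep2 Eu1 Eu2 Ev1 Ev2 -opp_row_mx innerNl innerNr -/p.
by split; lra.
Qed.

Section AtPoint.
Variables (r : R) (c : 'rV[R]_2) (w : 'rV[R]_(m.+1)).
Hypotheses (cc : dot c c = 1) (ww : dot w w = 1).
Let p := pt r c w.
Let sp : sphere p := sphere_pt r cc ww.

Lemma inner_dpt_circle c' : dot c' c = 0 ->
  inner g p (dpt r c w) (row_mx c' 0) = 0 /\ inner g p (row_mx c' 0) (dpt r c w) = 0.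
Proof.
move=> c'c; apply: (inner_flip (reflection_orthogonal c') (orthogonal_mx1 (k := m.+1))) => //.
- exact: tangent_dpt.
- exact: tangent_circle.
- by rewrite reflection_fix// dotZl dotC c'c mulr0.
- by rewrite mulmx1.
- by rewrite reflection_fix// dotZl dotC c'c mulr0.
- by rewrite mulmx1.
- exact: reflection_flip.
- by rewrite mul0mx oppr0.
Qed.

Lemma inner_dpt_sphere w' : dot w' w = 0 ->
  inner g p (dpt r c w) (row_mx 0 w') = 0 /\ inner g p (row_mx 0 w') (dpt r c w) = 0.
Proof.
move=> w'w; apply: (inner_flip (orthogonal_mx1 (k := 2)) (reflection_orthogonal w')) => //.
- exact: tangent_dpt.
- exact: tangent_sphere.
- by rewrite mulmx1.
- by rewrite reflection_fix// dotZl dotC w'w mulr0.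
- by rewrite mulmx1.
- by rewrite reflection_fix// dotZl dotC w'w mulr0.
- by rewrite mul0mx oppr0.
- exact: reflection_flip.
Qed.

Lemma inner_circle_sphere c' w' : dot c' c = 0 -> dot w' w = 0 ->
  inner g p (row_mx c' 0) (row_mx 0 w') = 0 /\ inner g p (row_mx 0 w') (row_mx c' 0) = 0.
Proof.
move=> c'c w'w; apply: (inner_flip (orthogonal_mx1 (k := 2)) (reflection_orthogonal w')) => //.
- exact: tangent_circle.
- exact: tangent_sphere.
- by rewrite mulmx1.
- by rewrite reflection_fix// dotZl dotC w'w mulr0.
- by rewrite mulmx1.
- by rewrite mul0mx.
- by rewrite mul0mx oppr0.
- exact: reflection_flip.
Qed.

Lemma inner_sphere_sphere w1 w2 : dot w1 w = 0 -> dot w2 w = 0 -> dot w1 w2 = 0 ->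
  inner g p (row_mx 0 w1) (row_mx 0 w2) = 0.
Proof.
move=> w1w w2w w12.
have [] := inner_flip (orthogonal_mx1 (k := 2)) (reflection_orthogonal w2) sp
  (tangent_sphere r c w1w) (tangent_sphere r c w2w) => //.
- by rewrite mulmx1.
- by rewrite reflection_fix// dotZl dotC w2w mulr0.
- by rewrite mulmx1.
- by rewrite reflection_fix.
- by rewrite mulmx1 oppr0.
- exact: reflection_flip.
Qed.

End AtPoint.

Definition e20 : 'rV[R]_2 := \row_j (j == 0)%:R.
Definition e21 : 'rV[R]_2 := \row_j (j == 1)%:R.
Local Notation E0 := (unit_vec 0 : 'rV[R]_(m.+2.-1)).
Local Notation E1 := (unit_vec 1 : 'rV[R]_(m.+2.-1)).

(** The metric on the geodesic, in the directions of the geodesic, of the circle and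
    of the sphere. These functions are smooth and even at both ends, while the
    radii of the orbits carry the additional factors [cos r] and [sin r]. *)
Definition radial_form r : R := inner g (pt r e20 E0) (dpt r e20 E0) (dpt r e20 E0).
Definition circle_form r : R := inner g (pt r e20 E0) (row_mx e21 0) (row_mx e21 0).
Definition sphere_form r : R := inner g (pt r e20 E0) (row_mx 0 E1) (row_mx 0 E1).

Lemma dot_e20 : dot e20 e20 = 1.
Proof. by rewrite dotE !big_ord_recl big_ord0 !mxE /= mul1r mul0r !addr0. Qed.
Lemma dot_e21 : dot e21 e21 = 1.
Proof. by rewrite dotE !big_ord_recl big_ord0 !mxE /= mul1r mul0r add0r addr0. Qed.
Lemma dot_e21_e20 : dot e21 e20 = 0.
Proof. by rewrite dotE !big_ord_recl big_ord0 !mxE /= mul0r mulr0 !addr0. Qed.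
Lemma dot_unit (i j : 'I_(m.+1)) :
  dot (unit_vec i : 'rV[R]_(m.+2.-1)) (unit_vec j) = (i == j)%:R.
Proof.
rewrite dotE (bigD1 i)//= big1 ?addr0 => [|l li]; first by rewrite !mxE eqxx mul1r.
by rewrite !mxE -(inj_eq val_inj) in li *; rewrite (negbTE li) mul0r.
Qed.
Lemma dot_E0 : dot E0 E0 = 1.
Proof. by rewrite (dot_unit ord0 ord0). Qed.

Lemma orth_e20 c : dot c e20 = 0 -> c = c 0 1 *: e21.
Proof.
rewrite dotE !big_ord_recl big_ord0 !mxE /= mulr1 mulr0 !addr0 => c0.
apply/rowP => j; rewrite !mxE; have [->|->] : j = 0 \/ j = 1.
- by case: j => -[|[|//]] h; [left|right]; apply/val_inj.
- by rewrite mulr0.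
- by rewrite mulr1.
Qed.

(** The circle and sphere parts of any point can be rotated to the base
    points [e20] and [E0]. *)
Lemma inner_dpt r c w : dot c c = 1 -> dot w w = 1 ->
  inner g (pt r c w) (dpt r c w) (dpt r c w) = radial_form r.
Proof.
move=> cc ww.
have := inner_move (reflection_orthogonal (c - e20)) (reflection_orthogonal (w - E0))
  (sphere_pt r cc ww) (tangent_dpt r cc ww) (tangent_dpt r cc ww).
rewrite -!scalemxAl !reflection_swap ?cc ?ww ?dot_e20 ?dot_E0// => <-.
Qed.

Lemma inner_circle r c w c' : dot c c = 1 -> dot w w = 1 -> dot c' c = 0 ->
  inner g (pt r c w) (row_mx c' 0) (row_mx c' 0) = dot c' c' * circle_form r.
Proof.
move=> cc ww c'c.
have oP := reflection_orthogonal (c - e20).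
have := inner_move oP (reflection_orthogonal (w - E0))
  (sphere_pt r cc ww) (tangent_circle r w c'c) (tangent_circle r w c'c).
rewrite -!scalemxAl !mul0mx => <-.
have cE : c *m reflection (c - e20) = e20 by rewrite reflection_swap// cc dot_e20.
rewrite cE reflection_swap ?ww ?dot_E0//; last first.
have : dot (c' *m reflection (c - e20)) e20 = 0 by rewrite -[X in dot _ X]cE dot_orthogonal.
move=> /orth_e20 c'E; rewrite -(dot_orthogonal c' c' oP) c'E.
set x := _ 0 1; rewrite dotZl dotZr dot_e21 mulr1 /circle_form -innerZ scale_row_mx scaler0.
by [].
Qed.

Lemma inner_sphere r c w w' : (0 < m)%N -> dot c c = 1 -> dot w w = 1 -> dot w' w = 0 ->
  inner g (pt r c w) (row_mx 0 w') (row_mx 0 w') = dot w' w' * sphere_form r.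
Proof.
move=> m0 cc ww w'w.
have oQ := reflection_orthogonal (w - E0).
have := inner_move (reflection_orthogonal (c - e20)) oQ
  (sphere_pt r cc ww) (tangent_sphere r c w'w) (tangent_sphere r c w'w).
rewrite -!scalemxAl !mul0mx => <-.
have wE : w *m reflection (w - E0) = E0 by rewrite reflection_swap// ww dot_E0.
rewrite wE reflection_swap ?cc ?dot_e20//.
set w1 := w' *m _; have w1E : dot w1 E0 = 0 by rewrite -[X in dot _ X]wE dot_orthogonal.
rewrite -(dot_orthogonal w' w' oQ) -/w1.
pose l := Num.sqrt (dot w1 w1).
have ll : dot w1 w1 = l * l by rewrite -expr2 sqr_sqrtr// dot_ge0.
have E1E1 : dot E1 E1 = 1 by rewrite (dot_unit (Ordinal (m0 : (1 < m.+1)%N)) (Ordinal (m0 : (1 < m.+1)%N))) eqxx.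
have E10 : dot E1 E0 = 0 by rewrite (dot_unit (Ordinal (m0 : (1 < m.+1)%N)) ord0).
have := inner_move (orthogonal_mx1 (k := 2)) (reflection_orthogonal (w1 - l *: E1))
  (sphere_pt r dot_e20 dot_E0) (tangent_sphere r e20 w1E) (tangent_sphere r e20 w1E).
rewrite !mulmx1 -!scalemxAl reflection_fix; last first.
  by rewrite dotDr dotNr dotZr dotC w1E dotC E10 mulr0 subr0.
rewrite reflection_swap; last by rewrite dotZl dotZr E1E1 mulr1.
move=> <-; rewrite ll /sphere_form -innerZ scale_row_mx scaler0.
by [].
Qed.

Lemma twice_half_pi : 2 * (pi / 2) = pi :> R.
Proof. by rewrite mulrC divfK. Qed.

(** Evenness at the ends: the geodesic is continued beyond a singular orbit by the
    geodesic towards the antipode of one of its end points. *)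
Lemma radial_form_opp r : radial_form (- r) = radial_form r.
Proof.
rewrite -(inner_dpt r (c := e20) (w := - E0)) ?dot_e20//; last first.
  by rewrite dotNl dotNr opprK dot_E0.
rewrite /radial_form /pt /dpt sinN cosN.
rewrite (_ : row_mx (- - sin r *: e20) (cos r *: E0) =
  - row_mx (- sin r *: e20) (cos r *: - E0)); last first.
  by rewrite opp_row_mx !scaleNr scalerN !opprK.
by rewrite innerNl innerNr opprK !(scaleNr, scalerN).
Qed.

Lemma radial_form_refl r : radial_form (2 * (pi / 2) - r) = radial_form r.
Proof.
rewrite -(inner_dpt r (c := - e20) (w := E0)) ?dot_E0//; last first.
  by rewrite dotNl dotNr opprK dot_e20.
rewrite /radial_form /pt /dpt twice_half_pi sinB cosB sinpi cospi.
rewrite !mul0r !mulN1r addr0 sub0r opprK.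
rewrite (_ : row_mx (- sin r *: e20) (- cos r *: E0) =
  - row_mx (- sin r *: - e20) (cos r *: E0)); last first.
  by rewrite opp_row_mx !scaleNr scalerN opprK.
by rewrite innerNl innerNr opprK !(scaleNr, scalerN).
Qed.

Let dot_neg k (v : 'rV[R]_k) : dot (- v) (- v) = dot v v.
Proof. by rewrite dotNl dotNr opprK. Qed.

Lemma circle_form_opp r : circle_form (- r) = circle_form r.
Proof.
have cc := dot_e20; have ww : dot (- E0) (- E0) = 1 by rewrite dot_neg dot_E0.
have := inner_circle r cc ww dot_e21_e20; rewrite dot_e21 mul1r => <-.
by rewrite /circle_form /pt sinN cosN scaleNr scalerN.
Qed.

Lemma circle_form_refl r : circle_form (2 * (pi / 2) - r) = circle_form r.
Proof.
have cc : dot (- e20) (- e20) = 1 by rewrite dot_neg dot_e20.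
have c'c : dot e21 (- e20) = 0 by rewrite dotNr dot_e21_e20 oppr0.
have := inner_circle r cc dot_E0 c'c; rewrite dot_e21 mul1r => <-.
rewrite twice_half_pi /circle_form /pt sinB cosB sinpi cospi.
by rewrite !mul0r !mulN1r addr0 sub0r opprK scaleNr scalerN.
Qed.

Hypothesis m0 : (0 < m)%N.

Let dot_E1 : dot E1 E1 = 1.
Proof.
pose i1 : 'I_(m.+1) := Ordinal (m0 : (1 < m.+1)%N).
by rewrite (dot_unit i1 i1) eqxx.
Qed.

Let dot_E1_E0 : dot E1 E0 = 0.
Proof. by rewrite (dot_unit (Ordinal (m0 : (1 < m.+1)%N)) ord0). Qed.

Lemma sphere_form_opp r : sphere_form (- r) = sphere_form r.
Proof.
have cc := dot_e20; have ww : dot (- E0) (- E0) = 1 by rewrite dot_neg dot_E0.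
have w'w : dot E1 (- E0) = 0 by rewrite dotNr dot_E1_E0 oppr0.
have := inner_sphere r m0 cc ww w'w; rewrite dot_E1 mul1r => <-.
by rewrite /sphere_form /pt sinN cosN scaleNr scalerN.
Qed.

Lemma sphere_form_refl r : sphere_form (2 * (pi / 2) - r) = sphere_form r.
Proof.
have cc : dot (- e20) (- e20) = 1 by rewrite dot_neg dot_e20.
have := inner_sphere r m0 cc dot_E0 dot_E1_E0; rewrite dot_E1 mul1r => <-.
rewrite twice_half_pi /sphere_form /pt sinB cosB sinpi cospi.
by rewrite !mul0r !mulN1r addr0 sub0r opprK scaleNr scalerN.
Qed.

(** On a singular orbit the direction along the geodesic and the directions
    tangent to the collapsing sphere are exchanged by symmetries. *)
Lemma radial_sphere_form : radial_form 0 = sphere_form 0.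
Proof.
rewrite -(inner_dpt 0 dot_e20 dot_E1) /sphere_form /pt /dpt.
by rewrite sin0 cos0 !scale0r scale1r oppr0 scale0r scale1r.
Qed.

Lemma radial_circle_form : radial_form (pi / 2) = circle_form (pi / 2).
Proof.
rewrite -(inner_dpt (pi / 2) (c := e21) (w := E0)) ?dot_e21 ?dot_E0// /circle_form /pt /dpt.
rewrite sin_pihalf cos_pihalf !scale0r scale1r scaleN1r.
have -> : row_mx (- e21) 0 = - row_mx e21 0 :> ambient R m.+2.
  by rewrite opp_row_mx oppr0.
by rewrite innerNl innerNr opprK.
Qed.

End Invariance.

Section Positivity.
Context {R : realType} {m : nat} (g : tensor2 R m.+2).
Hypothesis gr : riemannian_metric g.
Implicit Types r : R.

Let pos (p u : ambient R m.+2) : sphere p -> tangent p u -> dot u u != 0 ->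
  0 < inner g p u u.
Proof. by move=> sp tu u0; case: gr => _ H _; apply: H => //; rewrite -dot_eq0. Qed.

Lemma radial_form_gt0 r : 0 < radial_form g r.
Proof.
apply: pos; [exact: (sphere_pt r dot_e20 dot_E0)|exact: (tangent_dpt r dot_e20 dot_E0)|].
rewrite dot_row !dotZl !dotZr dot_e20 dot_E0 !mulr1 mulrNN -!expr2 addrC cos2Dsin2.
exact: oner_neq0.
Qed.

Lemma circle_form_gt0 r : 0 < circle_form g r.
Proof.
apply: pos; first exact: (sphere_pt r dot_e20 dot_E0).
  exact: (tangent_circle r (unit_vec 0 : 'rV[R]_(m.+2.-1)) dot_e21_e20).
by rewrite dot_row dot_e21 /dot mul0mx mxE addr0 oner_neq0.
Qed.

Lemma sphere_form_gt0 r : (0 < m)%N -> 0 < sphere_form g r.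
Proof.
move=> m0; apply: pos; first exact: (sphere_pt r dot_e20 dot_E0).
  apply: (tangent_sphere r e20).
  by rewrite (dot_unit (Ordinal (m0 : (1 < m.+1)%N)) ord0).
rewrite dot_row (dot_unit (Ordinal (m0 : (1 < m.+1)%N)) (Ordinal (m0 : (1 < m.+1)%N))).
by rewrite /dot mul0mx mxE add0r eqxx oner_neq0.
Qed.

End Positivity.

(** * Ricci curvature of diagonal metrics *)

Section DiagonalRicci.
Context {R : realType} {n : nat}.
Implicit Types (x : 'rV[R]_n) (i j k l : 'I_n).
Variables (h : 'rV[R]_n -> 'M[R]_n) (d : 'I_n -> 'rV[R]_n -> R).
Variables (ell : 'I_n -> 'I_n -> 'rV[R]_n -> R) (U : set 'rV[R]_n).
Local Notation e i := (delta_mx 0 i : 'rV[R]_n).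
Hypothesis openU : open U.
Hypothesis hE : forall x, U x -> forall i j, h x i j = (i == j)%:R * d i x.
Hypothesis d0 : forall x j, U x -> d j x != 0.
Hypothesis dE : forall x i j, U x -> is_derive x (e i) (d j) (2 * d j x * ell i j x).

Lemma partial_ext (f f' : 'rV[R]_n -> R) i x : U x -> (forall y, U y -> f y = f' y) ->
  partial i f x = partial i f' x.
Proof.
move=> Ux ff; apply: near_eq_derive.
have : nbhs x U by apply: open_nbhs_nbhs.
by apply: filterS => y; exact: ff.
Qed.

Lemma partialE (f : 'rV[R]_n -> R) a i x : is_derive x (e i) f a -> partial i f x = a.
Proof. exact: isDv_derive. Qed.

Lemma invmx_diagonal x : U x -> forall i j, invmx (h x) i j = (i == j)%:R / d i x.
Proof.
move=> Ux; pose Q : 'M[R]_n := \matrix_(i, j) ((i == j)%:R / d i x).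
have hQ : h x *m Q = 1%:M.
  apply/matrixP => i j; rewrite mxE (bigD1 i)//= big1 => [|k ki].
    rewrite hE// !mxE eqxx mul1r addr0; case: eqVneq => [->|_].
      by rewrite mul1r divff// d0.
    by rewrite mul0r mulr0.
  by rewrite hE// eq_sym (negbTE ki) !mul0r.
have [hu _] := mulmx1_unit hQ.
have -> : invmx (h x) = Q by rewrite -[RHS](mulKmx hu) hQ mulmx1.
by move=> i j; rewrite mxE.
Qed.

(** For a diagonal metric the symbol vanishes unless two of the indices agree; with
    the logarithmic derivatives [ell i j] of the square root of [d j] in the
    direction [i] it is linear in [ell]. *)
Lemma christoffel_diagonal k i j x : U x -> christoffel h k i j x =
  (j == k)%:R * ell i k x + (i == k)%:R * ell j k x
  - (i == j)%:R * (ell k i x * d i x / d k x).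
Proof.
move=> Ux; have P a b c : partial a (fun y => h y b c) x =
    (b == c)%:R * (2 * d b x * ell a b x).
  rewrite (partial_ext (f' := fun y => (b == c)%:R * d b y) _ Ux); last first.
    by move=> y Uy; rewrite hE.
  rewrite (partialE (isD_mul (isDv_cst _ _ _) (dE a b Ux))).
  by rewrite mul0r add0r.
rewrite /christoffel (bigD1 k)//= big1 => [|l lk]; last first.
  by rewrite invmx_diagonal// eq_sym (negbTE lk) !mul0r.
rewrite invmx_diagonal// eqxx mul1r addr0 !P.
have dk := d0 k Ux; set F := (i == j)%:R.
have -> : (j == k)%:R * (2 * d j x * ell i j x) = (j == k)%:R * (2 * d k x * ell i k x).
  by case: eqVneq => [->//|_]; rewrite !mul0r.
have -> : (i == k)%:R * (2 * d i x * ell j i x) = (i == k)%:R * (2 * d k x * ell j k x).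
  by case: eqVneq => [->//|_]; rewrite !mul0r.
by field.
Qed.

Variables (x : 'rV[R]_n) (M : 'I_n -> 'I_n -> 'I_n -> R).
Hypothesis Ux : U x.
Hypothesis ME : forall k i j, is_derive x (e k) (ell i j) (M k i j).

Lemma partial_christoffel a k i j : partial a (christoffel h k i j) x =
  (j == k)%:R * M a i k + (i == k)%:R * M a j k - (i == j)%:R *
  ((M a k i + 2 * ell k i x * (ell a i x - ell a k x)) * d i x / d k x).
Proof.
rewrite (partial_ext a Ux (christoffel_diagonal k i j)).
have c0 (c : R) := isDv_cst x (e a) c; have dk := d0 k Ux.
have H := isD_mul (isD_mul (ME a k i) (dE a i Ux)) (isD_inv dk (dE a k Ux)).
rewrite (partialE (isD_sub (isD_add (isD_mul (c0 _) (ME a i k))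
  (isD_mul (c0 _) (ME a j k))) (isD_mul (c0 (i == j)%:R) H))).
by rewrite !mul0r !add0r; congr (_ - _ * _); field.
Qed.

Lemma sum_delta i (F : 'I_n -> R) : \sum_k (i == k)%:R * F k = F i.
Proof.
rewrite (bigD1 i)//= eqxx mul1r big1 ?addr0// => k ki.
by rewrite eq_sym (negbTE ki) mul0r.
Qed.

(** Each double sum in the definition of the Ricci tensor collapses to a single sum,
    because the products of two symbols carry Kronecker deltas. *)
Lemma ricci_diagonal i : ricci h x i i =
  2 * M i i i - 2 * ell i i x ^+ 2 + 2 * (\sum_k ell i k x) * ell i i x
  - \sum_k (M i i k + ell i k x ^+ 2)
  - \sum_k (M k k i - 2 * ell k i x * ell k k x + (\sum_l ell k l x) * ell k i x)
           * d i x / d k x.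
Proof.
pose w k : R := d i x / d k x; pose s l : R := \sum_k ell l k x.
have wi : w i = 1 by rewrite /w divff// d0.
have H1 : \sum_k partial k (christoffel h k i i) x = 2 * M i i i -
    \sum_k (M k k i + 2 * ell k i x * (ell k i x - ell k k x)) * w k.
  rewrite -[2 * _](sum_delta i (fun k => 2 * M k i k)) -sumrB; apply: eq_bigr => k _.
  by rewrite partial_christoffel eqxx mul1r /w mulrA; ring.
have H2 : \sum_k partial i (christoffel h k i k) x = \sum_k M i i k.
  apply: eq_bigr => k _; rewrite partial_christoffel eqxx mul1r.
  by case: eqVneq => [->|_]; rewrite ?mul0r ?mul1r ?mulfK ?d0//; ring.
have H3 : \sum_k \sum_l christoffel h k k l x * christoffel h l i i x =
    2 * s i * ell i i x - \sum_k s k * ell k i x * w k.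
  rewrite exchange_big/= -[2 * _ * _](sum_delta i (fun k => 2 * s k * ell i k x)).
  rewrite -sumrB; apply: eq_bigr => l _.
  rewrite -mulr_suml (_ : \sum_k _ = s l); last first.
    apply: eq_bigr => k _; rewrite christoffel_diagonal// eqxx mul1r [l == k]eq_sym.
    case: eqVneq => [->|_] /=; last by ring.
    by field; exact: d0.
  by rewrite christoffel_diagonal// eqxx mul1r /w; ring.
have H4 : \sum_k \sum_l christoffel h k i l x * christoffel h l i k x =
    \sum_k ell i k x ^+ 2 - 2 * (\sum_k ell k i x ^+ 2 * w k) + 2 * ell i i x ^+ 2.
  have G k l : christoffel h k i l x = (l == k)%:R * ell i k x
      + (i == k)%:R * ell l k x - (i == l)%:R * (ell k i x * w k).
    by rewrite christoffel_diagonal// -mulrA.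
  have E k l : christoffel h k i l x * christoffel h l i k x =
    (k == l)%:R * (ell i k x * ell i l x)
    + (i == l)%:R * ((l == k)%:R * (ell i k x * ell k l x))
    - (k == l)%:R * ((i == k)%:R * (ell i k x * ell l i x * w l))
    + (k == l)%:R * ((i == k)%:R * (ell l k x * ell i l x))
    + (i == l)%:R * ((i == k)%:R * (ell l k x * ell k l x))
    - (i == k)%:R * (ell l k x * ell l i x * w l)
    - (k == l)%:R * ((i == l)%:R * (ell k i x * w k * ell i l x))
    - (i == l)%:R * (ell k i x * w k * ell k l x)
    + (i == l)%:R * ((i == k)%:R * (ell k i x * w k * (ell l i x * w l))).
    rewrite !G [l == k]eq_sym.
    by case: (k == l); case: (i == l); case: (i == k) => /=; ring.
  under eq_bigr => k _ do under eq_bigr => l _ do rewrite E.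
  under eq_bigr => k _.
    rewrite !(big_split, sumrN)/= !sum_delta -mulr_sumr.
    over.
  rewrite !(big_split, sumrN)/= !sum_delta wi.
  have -> : \sum_k ell i k x * ell i k x = \sum_k ell i k x ^+ 2.
    by apply: eq_bigr => k _; rewrite expr2.
  have -> : \sum_k ell k i x * ell k i x * w k = \sum_k ell k i x ^+ 2 * w k.
    by apply: eq_bigr => k _; rewrite expr2.
  have -> : \sum_k ell k i x * w k * ell k i x = \sum_k ell k i x ^+ 2 * w k.
    by apply: eq_bigr => k _; rewrite expr2 mulrAC.
  by ring.
rewrite mxE; transitivity (2 * M i i i -
    \sum_k (M k k i + 2 * ell k i x * (ell k i x - ell k k x)) * w k
  - \sum_k M i i k + (2 * s i * ell i i x - \sum_k s k * ell k i x * w k)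
  - (\sum_k ell i k x ^+ 2 - 2 * (\sum_k ell k i x ^+ 2 * w k) + 2 * ell i i x ^+ 2)).
  by congr (_ - _ + _ - _).
rewrite big_split/=.
have -> : \sum_k (M k k i - 2 * ell k i x * ell k k x + (\sum_l ell k l x) * ell k i x) *
    d i x / d k x = \sum_k (M k k i + 2 * ell k i x * (ell k i x - ell k k x)) * w k
    + \sum_k s k * ell k i x * w k - 2 * (\sum_k ell k i x ^+ 2 * w k).
  rewrite mulr_sumr -big_split -sumrB; apply: eq_bigr => k _ /=.
  by rewrite /w /s; ring.
by rewrite /s; ring.
Qed.

End DiagonalRicci.

Section WarpedRicci.
Context {R : realType} {m : nat}.
Implicit Types (x : 'rV[R]_(m.+2)) (i j : 'I_(m.+2)) (k l : 'I_m).
Local Notation e i := (delta_mx 0 i : 'rV[R]_(m.+2)).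
Local Notation i0 := (ord0 : 'I_(m.+2)).
Local Notation i1 := (lift ord0 ord0 : 'I_(m.+2)).

(** The coordinates are the radial one, the angle of the circle and the [m]
    stereographic coordinates of the sphere. *)
Definition sph k : 'I_(m.+2) := lift ord0 (lift ord0 k).

Lemma sph_eq k l : (sph k == sph l) = (k == l).
Proof. by rewrite !(inj_eq (@lift_inj _ _)). Qed.

Lemma sph_i1 k : (sph k == i1) = false.
Proof. by rewrite (inj_eq (@lift_inj _ _)). Qed.

Lemma ord_cases i : [\/ i = i0, i = i1 | exists k, i = sph k].
Proof.
case: (unliftP ord0 i) => [j ->|->]; last by constructor 1.
case: (unliftP ord0 j) => [k ->|->]; last by constructor 2.
by constructor 3; exists k.
Qed.

Definition conformal x : R := 1 + \sum_k x 0 (sph k) ^+ 2.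

Lemma conformal_gt0 x : 0 < conformal x.
Proof. by rewrite ltr_pwDl// sumr_ge0// => k _; exact: sqr_ge0. Qed.

Variables (c p f c1 p1 f1 : R -> R).

Definition warped_entry i x : R :=
  match i : nat with
  | 0 => c (x 0 i0) ^+ 2
  | 1 => p (x 0 i0) ^+ 2
  | _ => f (x 0 i0) ^+ 2 * (4 / conformal x ^+ 2)
  end.

(** The logarithmic derivatives of the square roots of the diagonal entries. *)
Definition warped_log i j x : R :=
  match i : nat, j : nat with
  | 0, 0 => c1 (x 0 i0) / c (x 0 i0)
  | 0, 1 => p1 (x 0 i0) / p (x 0 i0)
  | 0, _ => f1 (x 0 i0) / f (x 0 i0)
  | 1, _ => 0
  | _, 0 => 0
  | _, 1 => 0
  | _, _ => - (2 * x 0 i / conformal x)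
  end.

Variables (U : set 'rV[R]_(m.+2)) (h : 'rV[R]_(m.+2) -> 'M[R]_(m.+2)).
Hypothesis openU : open U.
Hypothesis hE : forall x, U x -> forall i j, h x i j = (i == j)%:R * warped_entry i x.
Hypothesis nz : forall x, U x -> [/\ c (x 0 i0) != 0, p (x 0 i0) != 0 & f (x 0 i0) != 0].
Hypothesis D1 : forall x, U x -> [/\ is_derive (x 0 i0) (1 : R) c (c1 (x 0 i0)),
  is_derive (x 0 i0) (1 : R) p (p1 (x 0 i0)) & is_derive (x 0 i0) (1 : R) f (f1 (x 0 i0))].

Let N0 x : conformal x != 0.
Proof. by rewrite gt_eqF// conformal_gt0. Qed.

Let eE i j : e i 0 j = (j == i)%:R.
Proof. by rewrite mxE eqxx. Qed.

Let entry_neq0 x j : U x -> warped_entry j x != 0.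
Proof.
move=> Ux; have [c0 p0 f0] := nz Ux; rewrite /warped_entry.
case: (j : nat) => [|[|_]]; rewrite ?expf_neq0//.
by rewrite mulf_neq0 ?expf_neq0// mulf_neq0 ?invr_neq0 ?expf_neq0// pnatr_eq0.
Qed.

Let isDv_radial (u : R -> R) a x i : is_derive (x 0 i0) (1 : R) u a ->
  is_derive x (e i) (fun y => u (y 0 i0)) (a * (i == i0)%:R).
Proof.
move=> ua; apply: isD_eq (isDv_comp (isDv_coord x (e i) 0 i0) ua) _.
by rewrite eE eq_sym.
Qed.

Let isDv_conformal x i : is_derive x (e i) conformal
  (if (i < 2)%N then 0 else 2 * x 0 i).
Proof.
have H k := isD_mul (isDv_coord x (e i) 0 (sph k)) (isDv_coord x (e i) 0 (sph k)).
apply: isD_eq (isD_add (isDv_cst x (e i) 1) (isDv_sum H)) _.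
rewrite add0r; under eq_bigr do rewrite eE mulrC -mulrDr.
case: (ord_cases i) => [->|->|[l ->]].
- by rewrite /= big1// => k _; rewrite addr0 mulr0.
- by rewrite big1 => [|k _]; rewrite ?sph_i1 ?addr0 ?mulr0.
- rewrite (bigD1 l)//= big1 => [|k kl]; last first.
    by rewrite sph_eq (negbTE kl) addr0 mulr0.
  by rewrite eqxx addr0 mulrC.
Qed.

Let isDv_entry x i j : U x ->
  is_derive x (e i) (warped_entry j) (2 * warped_entry j x * warped_log i j x).
Proof.
move=> Ux; have [c0 p0 f0] := nz Ux; have [Dc Dp Df] := D1 Ux.
have sq0 (u : R -> R) (a : R) (ua : is_derive (x 0 i0) (1 : R) u a) (k : 'I_(m.+2)) : (k == i0) = false ->
    is_derive x (e k) (fun y => u (y 0 i0) ^+ 2) 0.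
  move=> k0; apply: isD_eq (isD_mul (isDv_radial k ua) (isDv_radial k ua)) _.
  by rewrite k0 /= !mulr0 mul0r addr0.
have sq1 (u : R -> R) (a : R) (ua : is_derive (x 0 i0) (1 : R) u a) : u (x 0 i0) != 0 ->
    is_derive x (e i0) (fun y => u (y 0 i0) ^+ 2) (2 * u (x 0 i0) ^+ 2 * (a / u (x 0 i0))).
  move=> u0; apply: isD_eq (isD_mul (isDv_radial i0 ua) (isDv_radial i0 ua)) _.
  by rewrite eqxx /= mulr1; field.
have rho (k : 'I_(m.+2)) : is_derive x (e k) (fun y => 4 / conformal y ^+ 2)
    (- (if (k < 2)%N then 0 else 2 * x 0 k) * 8 / conformal x ^+ 3).
  have N2 : conformal x ^+ 2 != 0 by rewrite expf_neq0.
  have H := isD_inv (f := fun y => conformal y ^+ 2) N2 (isD_mul (isDv_conformal x k) (isDv_conformal x k)).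
  apply: isD_eq (isD_mul (isDv_cst x (e k) 4) H) _.
  by rewrite mul0r add0r; field.
rewrite /warped_entry /warped_log.
case: (ord_cases i) => [->|->|[k ->]]; case: (ord_cases j) => [->|->|[l ->]] /=.
- exact: sq1.
- exact: sq1.
- apply: isD_eq (isD_mul (sq1 f _ Df f0) (rho i0)) _.
  by rewrite /= oppr0 !mul0r; ring.
- by rewrite mulr0; exact: (sq0 _ _ Dc).
- by rewrite mulr0; exact: (sq0 _ _ Dp).
- apply: isD_eq (isD_mul (sq0 f _ Df i1 erefl) (rho i1)) _.
  by rewrite /= oppr0 !mul0r !mulr0 addr0.
- by rewrite mulr0; exact: (sq0 _ _ Dc).
- by rewrite mulr0; exact: (sq0 _ _ Dp).
- apply: isD_eq (isD_mul (sq0 f _ Df (sph k) erefl) (rho (sph k))) _.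
  by rewrite /= mul0r add0r; field; exact: N0.
Qed.

Variables (r : R) (x0 : 'rV[R]_(m.+2)) (dc dp df : R).
Hypothesis Ux0 : U x0.
Hypothesis x0r : x0 0 i0 = r.
Hypothesis x0s : forall k, x0 0 (sph k) = 0.
Hypothesis Dlog : [/\ is_derive r (1 : R) (fun s => c1 s / c s) dc,
  is_derive r (1 : R) (fun s => p1 s / p s) dp
  & is_derive r (1 : R) (fun s => f1 s / f s) df].

Let conformal0 : conformal x0 = 1.
Proof. by rewrite /conformal big1 ?addr0// => k _; rewrite x0s expr0n. Qed.

Definition warped_log_derivative (k i j : 'I_(m.+2)) : R :=
  match i : nat, j : nat, k : nat with
  | 0, 0, 0 => dc
  | 0, 1, 0 => dp
  | 0, _.+2, 0 => df
  | _.+2, _.+2, _.+2 => - (2 * (k == i)%:R)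
  | _, _, _ => 0
  end.

Let isDv_log (k i j : 'I_(m.+2)) :
  is_derive x0 (e k) (warped_log i j) (warped_log_derivative k i j).
Proof.
have [Dc Dp Df] := Dlog; rewrite -x0r in Dc Dp Df.
have L (u : R -> R) (a : R) (ua : is_derive (x0 0 i0) (1 : R) u a) b : a * (k == i0)%:R = b ->
    is_derive x0 (e k) (fun y => u (y 0 i0)) b.
  by move=> <-; exact: isDv_radial.
rewrite /warped_log_derivative /warped_log.
case: (ord_cases i) => [->|->|[i' ->]]; case: (ord_cases j) => [->|->|[j' ->]] /=;
  try exact: isDv_cst.
- by apply: (L _ _ Dc); case: (ord_cases k) => [->|->|[k' ->]]; rewrite ?mulr1 ?mulr0.
- by apply: (L _ _ Dp); case: (ord_cases k) => [->|->|[k' ->]]; rewrite ?mulr1 ?mulr0.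
- by apply: (L _ _ Df); case: (ord_cases k) => [->|->|[k' ->]]; rewrite ?mulr1 ?mulr0.
have X := isD_mul (isDv_cst x0 (e k) 2) (isDv_coord x0 (e k) 0 (sph i')).
apply: isD_eq (isD_opp (isD_mul X (isD_inv (N0 x0) (isDv_conformal x0 k)))) _.
rewrite conformal0 x0s eE; transitivity (- (2 * (sph i' == k)%:R) : R); first by field.
by case: (ord_cases k) => [->|->|[k' ->]]; rewrite /= ?mulr0 ?oppr0// eq_sym.
Qed.

Let sum_coord (F : 'I_(m.+2) -> R) :
  \sum_i F i = F i0 + F i1 + \sum_k F (sph k).
Proof. by rewrite !big_ord_recl addrA. Qed.

(** The point is taken at the origin of the stereographic coordinates, where all the
    logarithmic derivatives in the sphere directions vanish and only their own
    derivatives, equal to [- 2], contribute the curvature of the sphere. *)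
Lemma ricci_warped (L0 := c1 r / c r) (L1 := p1 r / p r) (L2 := f1 r / f r) :
  [/\ ricci h x0 i0 i0 = L0 * (L1 + m%:R * L2) - L1 ^+ 2 - m%:R * L2 ^+ 2 - dp - m%:R * df,
      ricci h x0 i1 i1 = - (dp + L1 * (L1 + m%:R * L2 - L0)) * (p r / c r) ^+ 2
    & forall k, ricci h x0 (sph k) (sph k) =
        4 * m%:R - 4 - (df + L2 * (L1 + m%:R * L2 - L0)) * 4 * (f r / c r) ^+ 2].
Proof.
have R0 i := ricci_diagonal openU hE entry_neq0 isDv_entry Ux0 isDv_log i.
have [c0 p0 f0] := nz Ux0; rewrite x0r in c0 p0 f0.
have l00 : warped_log i0 i0 x0 = L0 by rewrite /warped_log /= x0r.
have l01 : warped_log i0 i1 x0 = L1 by rewrite /warped_log /= x0r.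
have l0s k : warped_log i0 (sph k) x0 = L2 by rewrite /warped_log /= x0r.
have l1 j : warped_log i1 j x0 = 0 by [].
have ls k j : warped_log (sph k) j x0 = 0.
  rewrite /warped_log; case: (ord_cases j) => [->|->|[l ->]] //=.
  by rewrite x0s mulr0 mul0r oppr0.
have M00 : warped_log_derivative i0 i0 i0 = dc by [].
have M01 : warped_log_derivative i0 i0 i1 = dp by [].
have M0s k : warped_log_derivative i0 i0 (sph k) = df by [].
have M1 j : warped_log_derivative i1 i1 j = 0 by [].
have Ms0 k : warped_log_derivative (sph k) (sph k) i0 = 0 by [].
have Ms1 k : warped_log_derivative (sph k) (sph k) i1 = 0 by [].
have Mss k l : warped_log_derivative (sph k) (sph k) (sph l) = -2.
  by rewrite /warped_log_derivative /= eqxx mulr1.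
have e0 : warped_entry i0 x0 = c r ^+ 2 by rewrite /warped_entry /= x0r.
have e1 : warped_entry i1 x0 = p r ^+ 2 by rewrite /warped_entry /= x0r.
have es k : warped_entry (sph k) x0 = 4 * f r ^+ 2.
  by rewrite /warped_entry /= x0r conformal0 expr1n divr1 mulrC.
have big_cst (F : 'I_m -> R) a : (forall l, F l = a) -> \sum_l F l = m%:R * a.
  by move=> Fa; rewrite (eq_bigr (fun=> a)) ?sumr_const ?card_ord ?mulr_natl.
have s0 := big_cst _ _ l0s.
have s1 : \sum_k warped_log i1 (sph k) x0 = 0 by rewrite big1.
have ss k : \sum_l warped_log (sph k) l x0 = 0 by rewrite big1.
have ss' k : \sum_l warped_log (sph k) (sph l) x0 = 0 by rewrite big1.
clearbody L0 L1 L2; split=> [||k]; rewrite R0 !sum_coord.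
- rewrite s0 s1 !(l00, l01, l1, M00, M01, M1, e0, e1).
  rewrite (big_cst _ (df + L2 ^+ 2)) => [|l]; last by rewrite M0s l0s.
  rewrite (big_cst _ 0) => [|l]; last by rewrite ss !ls Ms0; ring.
  by field; rewrite p0 c0.
- rewrite s0 s1 !(l00, l01, l1, M00, M01, M1, e0, e1).
  rewrite (big_cst _ 0) => [|l]; last by rewrite M1 l1; ring.
  rewrite (big_cst _ 0) => [|l]; last by rewrite ss !ls Ms1; ring.
  by field; rewrite ?p0 ?c0 ?f0.
- rewrite s0 s1 ss' !(l00, l01, l0s, l1, ls, M00, M01, M0s, M1, Ms0, Ms1, Mss, e0, e1, es).
  rewrite (big_cst _ (-2)) => [|l]; last by rewrite Mss ls; ring.
  rewrite (big_cst _ (-2)) => [|l]; last by rewrite ss !ls Mss !es; field.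
  by field; rewrite ?p0 ?c0 ?f0.
Qed.

End WarpedRicci.

(** * Charts of the sphere *)

Section Frames.
Context {R : realType}.

Lemma isDv_mxP (V : normedModType R) p q (F : V -> 'M[R]_(p, q)) x v dF :
  is_derive x v F dF <-> forall i j, is_derive x v (fun y => F y i j) (dF i j).
Proof.
split=> [[dv <-] i j|]; last exact: isDv_mx.
apply: DeriveDef; first by move/derivable_mxP : dv => /(_ i j).
by rewrite derive_mx// mxE.
Qed.

Lemma isDv_addv (V : normedModType R) p q (F G : V -> 'M[R]_(p, q)) x v dF dG :
  is_derive x v F dF -> is_derive x v G dG ->
  is_derive x v (fun y => F y + G y) (dF + dG).
Proof. exact: is_deriveD. Qed.

Lemma isDv_scale (V : normedModType R) p q (c : V -> R) (G : V -> 'M[R]_(p, q)) x v dc dG :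
  is_derive x v c dc -> is_derive x v G dG ->
  is_derive x v (fun y => c y *: G y) (dc *: G x + c x *: dG).
Proof.
move=> Hc /isDv_mxP HG; apply/isDv_mxP => i j; rewrite !mxE.
have -> : (fun y => (c y *: G y) i j) = (fun y => c y * G y i j).
  by apply/funext => y; rewrite mxE.
exact: isD_mul.
Qed.

Lemma isDv_row_mx (V : normedModType R) p q (F : V -> 'rV[R]_p) (G : V -> 'rV[R]_q) x v dF dG :
  is_derive x v F dF -> is_derive x v G dG ->
  is_derive x v (fun y => row_mx (F y) (G y)) (row_mx dF dG).
Proof.
move=> /isDv_mxP HF /isDv_mxP HG; apply/isDv_mxP => i j.
case: (split_ordP j) => k ->; rewrite ?row_mxEl ?row_mxEr.
  have -> : (fun y => row_mx (F y) (G y) i (lshift q k)) = (fun y => F y i k).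
    by apply/funext => y; rewrite row_mxEl.
  exact: HF.
have -> : (fun y => row_mx (F y) (G y) i (rshift p k)) = (fun y => G y i k).
  by apply/funext => y; rewrite row_mxEr.
exact: HG.
Qed.

Lemma mul_mx_tr_entry p q (A : 'M[R]_(p, q)) (G : 'M[R]_q) i j :
  (A *m G *m A^T) i j = (row i A *m G *m (row j A)^T) 0 0.
Proof.
rewrite -row_mul; move: (A *m G) => B.
by rewrite !mxE; apply: eq_bigr => k _; rewrite !mxE.
Qed.

End Frames.

Section MetricCoord.
Context {R : realType} {n : nat}.

Lemma metric_coordE (g : tensor2 R n) (F : 'rV[R]_n -> ambient R n) x i j u v :
  is_derive x (delta_mx 0 i : 'rV[R]_n) F u -> is_derive x (delta_mx 0 j : 'rV[R]_n) F v ->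
  metric_coord g F x i j = inner g (F x) u v.
Proof.
move=> Hu Hv; have rE k w : is_derive x (delta_mx 0 k : 'rV[R]_n) F w ->
    row k (frame F x) = w.
  by move=> [_ <-]; rewrite rowK.
by rewrite /inner -(rE _ _ Hu) -(rE _ _ Hv) /metric_coord mul_mx_tr_entry.
Qed.

(** Both charts have orthogonal coordinate fields, which makes their frames free. *)
Lemma orthogonal_frame_free (F : 'rV[R]_n -> ambient R n) x (u : 'I_n -> ambient R n) :
  (forall i, is_derive x (delta_mx 0 i : 'rV[R]_n) F (u i)) ->
  (forall i, dot (u i) (u i) != 0) -> (forall i j, i != j -> dot (u i) (u j) = 0) ->
  row_free (frame F x).
Proof.
move=> Hu u0 uu; apply/row_freeP.
exists (\matrix_(j, i) (u i 0 j / dot (u i) (u i))).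
have fE i j : frame F x i j = u i 0 j by rewrite mxE; case: (Hu i) => _ ->.
apply/matrixP => i j; rewrite !mxE.
transitivity (dot (u i) (u j) / dot (u j) (u j)).
  by rewrite dotE mulr_suml; apply: eq_bigr => k _; rewrite fE !mxE mulrA.
have [->|ij] := eqVneq i j; first by rewrite divff.
by rewrite uu// mul0r.
Qed.

End MetricCoord.

Section Stereographic.
Context {R : realType} {p q : nat}.
Variables (u : 'rV[R]_q) (eps : 'I_p -> 'rV[R]_q) (z : 'I_p -> R).

Definition stereo_norm : R := 1 + \sum_k z k ^+ 2.
Let S : 'rV[R]_q := \sum_k z k *: eps k.
Local Notation N := stereo_norm.

(** The inverse stereographic projection of [z] from the pole [- u]. *)
Definition stereo : 'rV[R]_q := (2 / N - 1) *: u + (2 / N) *: S.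

Definition stereo_tangent k : 'rV[R]_q :=
  - (4 * z k / N ^+ 2) *: (u + S) + (2 / N) *: eps k.

Lemma stereo_norm_gt0 : 0 < N.
Proof. by rewrite ltr_pwDl// sumr_ge0// => k _; exact: sqr_ge0. Qed.

Hypotheses (uu : dot u u = 1) (ue : forall k, dot u (eps k) = 0).
Hypothesis ee : forall k l, dot (eps k) (eps l) = (k == l)%:R.

Let N0 : N != 0.
Proof. by rewrite gt_eqF// stereo_norm_gt0. Qed.

Lemma dot_sum (w : 'rV[R]_q) (c : 'I_p -> R) : dot w (\sum_k c k *: eps k) =
  \sum_k c k * dot w (eps k).
Proof.
rewrite /dot linear_sum mulmx_sumr summxE; apply: eq_bigr => k _.
by rewrite linearZ/= -scalemxAr mxE.
Qed.

Let uS : dot u S = 0.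
Proof. by rewrite dot_sum big1// => k _; rewrite ue mulr0. Qed.

Let eS k : dot (eps k) S = z k.
Proof.
rewrite dot_sum (bigD1 k)//= ee eqxx mulr1 big1 ?addr0// => l lk.
by rewrite ee eq_sym (negbTE lk) mulr0.
Qed.

Let SS : dot S S = N - 1.
Proof.
rewrite {2}/S dot_sum /stereo_norm addrAC subrr add0r.
by apply: eq_bigr => k _; rewrite dotC eS expr2.
Qed.

Lemma stereo_sphere : dot stereo stereo = 1.
Proof.
rewrite /stereo !(dotDl, dotDr, dotZl, dotZr) (dotC S u) uu uS SS.
by field.
Qed.

Lemma stereo_tangent_orth k : dot (stereo_tangent k) stereo = 0.
Proof.
rewrite /stereo /stereo_tangent !(dotDl, dotDr, dotZl, dotZr) (dotC S u) uu uS SS.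
by rewrite (dotC (eps k) u) ue eS; field.
Qed.

(** Stereographic projection is conformal. *)
Lemma stereo_tangent_dot k l :
  dot (stereo_tangent k) (stereo_tangent l) = (k == l)%:R * (4 / N ^+ 2).
Proof.
rewrite /stereo_tangent !(dotDl, dotDr, dotZl, dotZr) (dotC S u) uu uS SS.
rewrite (dotC (eps k) u) (dotC S (eps l)) !ue !eS ee; field.
exact: N0.
Qed.

Lemma stereo_tangent_perp w k : dot w u = 0 -> (forall l, dot w (eps l) = 0) ->
  dot w (stereo_tangent k) = 0.
Proof.
move=> wu we; have wS : dot w S = 0.
  by rewrite dot_sum big1// => l _; rewrite we mulr0.
by rewrite /stereo_tangent !(dotDr, dotZr) wu wS we; ring.
Qed.

End Stereographic.

Section StereographicDerivative.
Context {R : realType} {p q n : nat}.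
Variables (u : 'rV[R]_n -> 'rV[R]_q) (eps : 'I_p -> 'rV[R]_q) (emb : 'I_p -> 'I_n).
Let z (y : 'rV[R]_n) k := y 0 (emb k).

Lemma isDv_stereo x v du : is_derive x v u du ->
  is_derive x v (fun y => stereo (u y) eps (z y))
    ((2 / stereo_norm (z x) - 1) *: du +
     \sum_k v 0 (emb k) *: stereo_tangent (u x) eps (z x) k).
Proof.
move=> Hu; set N := stereo_norm (z x).
have N0 : N != 0 by rewrite gt_eqF// stereo_norm_gt0.
have Hz k := isDv_coord x v 0 (emb k).
pose dN : R := \sum_k 2 * z x k * v 0 (emb k).
have HN : is_derive x v (fun y => stereo_norm (z y)) dN.
  have H := isDv_sum (fun k => isD_mul (Hz k) (Hz k)).
  apply: isD_eq (isD_add (isDv_cst x v 1) H) _.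
  by rewrite add0r; apply: eq_bigr => k _; rewrite /z; ring.
have H2 : is_derive x v (fun y => 2 / stereo_norm (z y)) (- 2 * dN / N ^+ 2).
  apply: isD_eq (isD_mul (isDv_cst x v 2) (isD_inv (f := fun y => stereo_norm (z y)) N0 HN)) _.
  by rewrite mul0r add0r; ring.
have H1 := isD_sub H2 (isDv_cst x v 1).
have HS : is_derive x v (fun y => \sum_k z y k *: eps k) (\sum_k v 0 (emb k) *: eps k).
  apply/isDv_mxP => i j; rewrite summxE.
  have -> : (fun y => (\sum_k z y k *: eps k) i j) = (fun y => \sum_k z y k * eps k i j).
    by apply/funext => y; rewrite summxE; apply: eq_bigr => k _; rewrite mxE.
  apply: isD_eq (isDv_sum (fun k => isD_mul (Hz k) (isDv_cst x v (eps k i j)))) _.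
  by apply: eq_bigr => k _; rewrite mxE mulr0 addr0.
have := isDv_addv (isDv_scale H1 Hu) (isDv_scale H2 HS).
rewrite -/N /stereo_tangent; set S := \sum_k z x k *: eps k; set u0 := u x.
suff -> : \sum_k v 0 (emb k) *: (- (4 * z x k / N ^+ 2) *: (u0 + S) + (2 / N) *: eps k) =
    (- 2 * dN / N ^+ 2) *: (u0 + S) + (2 / N) *: \sum_k v 0 (emb k) *: eps k.
  move: (\sum_k v 0 (emb k) *: eps k) => T.
  by congr is_derive; apply/rowP => j; rewrite !mxE; ring.
under eq_bigr do rewrite scalerDr; rewrite big_split/=; congr (_ + _).
  rewrite /dN; under eq_bigr do rewrite scalerA.
  rewrite -scaler_suml; congr (_ *: _); rewrite mulr_sumr mulr_suml.
  by apply: eq_bigr => k _; field.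
by rewrite scaler_sumr; apply: eq_bigr => k _; rewrite !scalerA mulrC.
Qed.

End StereographicDerivative.

Lemma Ck_stereo_entry (R : realType) p q n k (u : 'rV[R]_n -> 'rV[R]_q) (eps : 'I_p -> 'rV[R]_q)
    (emb : 'I_p -> 'I_n) (i : 'I_1) (j : 'I_q) :
  Ck k setT (fun x => u x i j) ->
  Ck k setT (fun x : 'rV[R]_n => stereo (u x) eps (fun k => x 0 (emb k)) i j : R).
Proof.
move=> Cu; have oT : open (setT : set 'rV[R]_n) by exact: openT.
have Cc k' : Ck k setT (fun x : 'rV[R]_n => x 0 (emb k')) by exact: Ck_coord.
have CN : Ck k setT (fun x : 'rV[R]_n => 2 / stereo_norm (fun k => x 0 (emb k))).
  apply: (Ck_mul oT (Ck_cst oT k 2)); apply: (Ck_inv oT).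
    by move=> x _; rewrite gt_eqF// stereo_norm_gt0.
  apply: (Ck_add oT (Ck_cst oT k 1)); apply: (Ck_sum oT) => l.
  exact: (Ck_mul oT).
have CS : Ck k setT (fun x : 'rV[R]_n => \sum_l x 0 (emb l) * eps l i j).
  by apply: (Ck_sum oT) => l; apply: (Ck_mul oT) => //; exact: (Ck_cst oT).
apply: (Ck_ext oT _ (Ck_add oT (Ck_mul oT (Ck_add oT CN (Ck_cst oT k (-1))) Cu)
  (Ck_mul oT CN CS))) => x _.
rewrite !mxE summxE; congr (_ + _ * _).
by apply: eq_bigr => l _; rewrite mxE.
Qed.

Section Charts.
Context {R : realType} {m : nat}.
Implicit Types (x : 'rV[R]_(m.+2)) (i j : 'I_(m.+2)).
Local Notation e i := (delta_mx 0 i : 'rV[R]_(m.+2)).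
Local Notation i0 := (ord0 : 'I_(m.+2)).
Local Notation i1 := (lift ord0 ord0 : 'I_(m.+2)).
Local Notation E k := (unit_vec k : 'rV[R]_(m.+2.-1)).

Lemma isDv_pt (V : normedModType R) (r : V -> R) (c : V -> 'rV[R]_2)
    (w : V -> 'rV[R]_(m.+1)) (x v : V) dr dc dw :
  is_derive x v r dr -> is_derive x v c dc -> is_derive x v w dw ->
  is_derive x v (fun y => pt (r y) (c y) (w y))
    (dr *: dpt (r x) (c x) (w x) + row_mx (cos (r x) *: dc) (sin (r x) *: dw)).
Proof.
move=> Hr Hc Hw.
have := isDv_row_mx (isDv_scale (isDv_comp Hr (isD_cos (r x))) Hc)
  (isDv_scale (isDv_comp Hr (isD_sin (r x))) Hw).
congr is_derive; rewrite /dpt scale_row_mx add_row_mx !scalerA.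
by rewrite (mulrC dr) (mulrC dr).
Qed.

Definition circ (a : R) : 'rV[R]_2 := cos a *: e20 + sin a *: e21.
Definition circ' (a : R) : 'rV[R]_2 := - sin a *: e20 + cos a *: e21.

Let dot_circE a b c d : dot (a *: e20 + b *: e21) (c *: e20 + d *: e21) = a * c + b * d :> R.
Proof.
rewrite !(dotDl, dotDr, dotZl, dotZr) dot_e20 dot_e21 dot_e21_e20 (dotC e20).
by rewrite dot_e21_e20; ring.
Qed.

Lemma dot_circ a : dot (circ a) (circ a) = 1.
Proof. by rewrite dot_circE -!expr2 cos2Dsin2. Qed.
Lemma dot_circ' a : dot (circ' a) (circ' a) = 1.
Proof. by rewrite dot_circE -(cos2Dsin2 a); ring. Qed.
Lemma dot_circ'_circ a : dot (circ' a) (circ a) = 0.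
Proof. by rewrite dot_circE; ring. Qed.

Lemma isDv_circ (V : normedModType R) (f : V -> R) (x v : V) a : is_derive x v f a ->
  is_derive x v (fun y => circ (f y)) (a *: circ' (f x)).
Proof.
move=> fa; have c0 p q (w : 'M[R]_(p, q)) : is_derive x v (fun=> w) 0.
  exact: is_derive_cst.
have := isDv_addv (isDv_scale (isDv_comp fa (isD_cos (f x))) (c0 _ _ e20))
  (isDv_scale (isDv_comp fa (isD_sin (f x))) (c0 _ _ e21)).
by congr is_derive; apply/rowP => j; rewrite !mxE; ring.
Qed.

(** Polar coordinates, with stereographic coordinates on the sphere. *)
Definition sphere_coord x : 'rV[R]_(m.+1) :=
  stereo (E 0) (fun k : 'I_m => E k.+1) (fun k => x 0 (sph k)).
Definition polar_chart x : ambient R m.+2 := pt (x 0 i0) (circ (x 0 i1)) (sphere_coord x).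
Definition polar_domain : set 'rV[R]_(m.+2) := [set x | 0 < x 0 i0 < pi / 2].

(** Stereographic coordinates around the points of one geodesic from a singular
    orbit to the other, that also cover its end points. *)
Definition line_frame (k : 'I_(m.+1)) : ambient R m.+2 :=
  match unlift ord0 k with
  | None => row_mx e21 0
  | Some l => row_mx 0 (E l.+1)
  end.
Definition line_chart x : ambient R m.+2 :=
  stereo (pt (x 0 i0) e20 (E 0)) line_frame (fun k => x 0 (lift ord0 k)).
Definition line_domain : set 'rV[R]_(m.+2) :=
  [set x | \sum_(k < m.+1) x 0 (lift ord0 k) ^+ 2 < 1].

Definition sphere_tangent x k : 'rV[R]_(m.+1) :=
  stereo_tangent (E 0) (fun k : 'I_m => E k.+1) (fun k => x 0 (sph k)) k.

Definition polar_vector x i : ambient R m.+2 :=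
  match unlift ord0 i with
  | None => dpt (x 0 i0) (circ (x 0 i1)) (sphere_coord x)
  | Some j => match unlift ord0 j with
    | None => row_mx (cos (x 0 i0) *: circ' (x 0 i1)) 0
    | Some k => row_mx 0 (sin (x 0 i0) *: sphere_tangent x k)
    end
  end.

Let sum_e_sph (v : 'I_m -> 'rV[R]_(m.+1)) j :
  \sum_k e j 0 (sph k) *: v k =
  match unlift ord0 j with
  | None => 0
  | Some j => if unlift ord0 j is Some k then v k else 0
  end.
Proof.
under eq_bigr do rewrite mxE /=.
case: (unliftP ord0 j) => [l ->|->]; last by rewrite big1// => k _; rewrite scale0r.
case: (unliftP ord0 l) => [k ->|->].
  rewrite (bigD1 k)//= big1 => [|k' kk]; last by rewrite sph_eq (negbTE kk) scale0r.
  by rewrite eqxx scale1r addr0.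
by rewrite big1// => k _; rewrite sph_i1 scale0r.
Qed.

Lemma isDv_polar_chart x i : is_derive x (e i) polar_chart (polar_vector x i).
Proof.
have c0 p q (w : 'M[R]_(p, q)) : is_derive x (e i) (fun=> w) 0 by exact: is_derive_cst.
have := isDv_pt (isDv_coord x (e i) 0 i0) (isDv_circ (isDv_coord x (e i) 0 i1))
  (isDv_stereo (fun k : 'I_m => E k.+1) sph (c0 _ _ (E 0))).
congr is_derive; rewrite scaler0 add0r sum_e_sph !mxE /polar_vector.
case: (unliftP ord0 i) => [l ->|->].
  case: (unliftP ord0 l) => [k ->|->].
    by rewrite /= !scale0r add0r scaler0.
  by rewrite /= ?eqxx scale0r scale1r add0r scaler0.
by rewrite /= ?eqxx scale1r scale0r !scaler0 row_mx0 addr0.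
Qed.


Let dot_E (k l : nat) : (k < m.+1)%N -> (l < m.+1)%N -> dot (E k) (E l) = (k == l)%:R.
Proof. by move=> km lm; rewrite (dot_unit (Ordinal km) (Ordinal lm)). Qed.

Let E00 : dot (E 0) (E 0) = 1. Proof. exact: dot_E0. Qed.
Let E0S (k : 'I_m) : dot (E 0) (E k.+1) = 0.
Proof. by rewrite dot_E ?ltnS. Qed.
Let ESS (k l : 'I_m) : dot (E k.+1) (E l.+1) = (k == l)%:R.
Proof. by rewrite dot_E ?ltnS ?eqSS. Qed.

Lemma dot_sphere_coord x : dot (sphere_coord x) (sphere_coord x) = 1.
Proof. exact: stereo_sphere. Qed.
Lemma sphere_tangent_orth x k : dot (sphere_tangent x k) (sphere_coord x) = 0.
Proof. exact: stereo_tangent_orth. Qed.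
Lemma sphere_tangent_dot x k l :
  dot (sphere_tangent x k) (sphere_tangent x l) = (k == l)%:R * (4 / conformal x ^+ 2).
Proof. exact: stereo_tangent_dot. Qed.

Let dot_rl p q (a : 'rV[R]_p) (b : 'rV[R]_q) : dot (row_mx a 0) (row_mx 0 b) = 0.
Proof. by rewrite dot_row /dot trmx0 mulmx0 mul0mx !mxE addr0. Qed.
Let dot_lr p q (a : 'rV[R]_p) (b : 'rV[R]_q) : dot (row_mx 0 b) (row_mx a 0) = 0.
Proof. by rewrite dotC dot_rl. Qed.
Let dot0r p (a : 'rV[R]_p) : dot a 0 = 0.
Proof. by rewrite /dot trmx0 mulmx0 mxE. Qed.

Let polar_vector0 x : polar_vector x i0 = dpt (x 0 i0) (circ (x 0 i1)) (sphere_coord x).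
Proof. by rewrite /polar_vector unlift_none. Qed.
Let polar_vector1 x : polar_vector x i1 = row_mx (cos (x 0 i0) *: circ' (x 0 i1)) 0.
Proof. by rewrite /polar_vector liftK unlift_none. Qed.
Let polar_vectorS x k :
  polar_vector x (sph k) = row_mx 0 (sin (x 0 i0) *: sphere_tangent x k).
Proof. by rewrite /polar_vector !liftK. Qed.

Let dot_dpt r c (w : 'rV[R]_(m.+1)) : dot c c = 1 -> dot w w = 1 ->
  dot (dpt r c w) (dpt r c w) = 1.
Proof.
move=> cc ww; rewrite dot_row !(dotZl, dotZr) cc ww -[RHS](cos2Dsin2 r); ring.
Qed.

Let dot_dpt_left r c (w : 'rV[R]_(m.+1)) c' : dot c' c = 0 ->
  dot (dpt r c w) (row_mx c' 0) = 0.
Proof. by move=> cc; rewrite dot_row dotZl dotC cc dot0r mulr0 addr0. Qed.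

Let dot_dpt_right r c (w : 'rV[R]_(m.+1)) w' : dot w' w = 0 ->
  dot (dpt r c w) (row_mx 0 w') = 0.
Proof. by move=> ww; rewrite dot_row !dotZl (dotC w) ww dot0r !mulr0 addr0. Qed.

Lemma polar_vector_dot x i j : dot (polar_vector x i) (polar_vector x j) =
  (i == j)%:R * warped_entry (fun=> 1) cos sin i x.
Proof.
have cc' := dot_circ'_circ (x 0 i1); have ww' := sphere_tangent_orth x.
have d01 : dot (polar_vector x i0) (polar_vector x i1) = 0.
  by rewrite polar_vector0 polar_vector1 dot_dpt_left// dotZl cc' mulr0.
have d0s k : dot (polar_vector x i0) (polar_vector x (sph k)) = 0.
  by rewrite polar_vector0 polar_vectorS dot_dpt_right// dotZl ww' mulr0.
have d1s k : dot (polar_vector x i1) (polar_vector x (sph k)) = 0.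
  by rewrite polar_vector1 polar_vectorS dot_rl.
case: (ord_cases i) => [->|->|[k ->]]; case: (ord_cases j) => [->|->|[l ->]];
  rewrite ?d01 ?d0s ?d1s ?[dot (polar_vector x i1) (polar_vector x i0)]dotC
   ?(dotC (polar_vector x (sph _)) (polar_vector x i0))
   ?(dotC (polar_vector x (sph _)) (polar_vector x i1)) ?d01 ?d0s ?d1s ?mul0r//.
- rewrite polar_vector0 dot_dpt ?dot_circ ?dot_sphere_coord//.
  by rewrite /warped_entry /= expr1n mulr1.
- by rewrite polar_vector1 dot_row dot0r dotZl dotZr dot_circ' eqxx /warped_entry /=; ring.
- rewrite polar_vectorS polar_vectorS dot_row dot0r dotZl dotZr sphere_tangent_dot sph_eq.
  by rewrite /warped_entry /=; ring.
Qed.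

Lemma polar_chart_sphere x : sphere (polar_chart x).
Proof. by apply: sphere_pt; [exact: dot_circ|exact: dot_sphere_coord]. Qed.


Lemma polar_parametrization : local_parametrization polar_domain polar_chart.
Proof.
have oT : open (setT : set 'rV[R]_(m.+2)) by exact: openT.
have Cc k i : Ck k setT (fun x : 'rV[R]_(m.+2) => x 0 i) by exact: Ck_coord.
split.
- rewrite (_ : polar_domain = (fun x : 'rV[R]_(m.+2) => x 0 i0) @^-1` `]0, pi / 2[%classic).
    by apply: open_comp; [move=> x _; exact: coord_continuous|exact: interval_open].
  by apply/seteqP; split=> x; rewrite /polar_domain /= in_itv.
- move=> x _; exists setT, polar_chart; split=> // k.
  have [Cs0 Cc0] := Ck_sincos oT (Cc k i0); have [Cs1 Cc1] := Ck_sincos oT (Cc k i1).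
  apply: (Ck_mx oT) => i j; case: (split_ordP j) => l ->.
    have C v w : Ck k setT (fun x : 'rV[R]_(m.+2) => cos (x 0 i0) *
        (cos (x 0 i1) * v + sin (x 0 i1) * w)).
      apply: (Ck_mul oT) => //; apply: (Ck_add oT); apply: (Ck_mul oT) => //; exact: (Ck_cst oT).
    by apply: (Ck_ext oT _ (C (e20 i l) (e21 i l))) => y _; rewrite row_mxEl !mxE.
  have C : Ck k setT (fun x => sphere_coord x i l).
    by apply: Ck_stereo_entry; exact: (Ck_cst oT).
  apply: (Ck_ext oT _ (Ck_mul oT Cs0 C)) => y _.
  by rewrite row_mxEr [RHS]mxE.
- by move=> x _; exact: polar_chart_sphere.
- move=> x /andP[r0 r1]; apply: orthogonal_frame_free (isDv_polar_chart x) _ _.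
    move=> i; rewrite polar_vector_dot eqxx mul1r.
    have s0 : sin (x 0 i0) != 0 by rewrite gt_eqF// sin_gt0_pihalf// r0.
    have c0 : cos (x 0 i0) != 0.
      by rewrite gt_eqF// cos_gt0_pihalf// r1 andbT (lt_trans _ r0)// oppr_lt0 (lt_trans r0).
    have N0 : conformal x != 0 by rewrite gt_eqF// conformal_gt0.
    rewrite /warped_entry; case: (i : nat) => [|[|_]]; rewrite ?expf_neq0 ?oner_neq0//.
    by rewrite mulf_neq0 ?expf_neq0// mulf_neq0 ?pnatr_eq0// invr_neq0 ?expf_neq0.
  by move=> i j ij; rewrite polar_vector_dot (negbTE ij) mul0r.
Qed.

Lemma polar_metric (g : tensor2 R m.+2) x i j :
  invariant_metric g -> riemannian_metric g -> (0 < m)%N ->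
  metric_coord g polar_chart x i j = (i == j)%:R * warped_entry
    (fun r => Num.sqrt (radial_form g r)) (fun r => cos r * Num.sqrt (circle_form g r))
    (fun r => sin r * Num.sqrt (sphere_form g r)) i x.
Proof.
move=> ginv gr m0; rewrite (metric_coordE g (isDv_polar_chart x i) (isDv_polar_chart x j)).
set r := x 0 i0; set c := circ (x 0 i1); set w := sphere_coord x.
have cc : dot c c = 1 := dot_circ _; have ww : dot w w = 1 := dot_sphere_coord x.
have cc' a : dot (a *: circ' (x 0 i1)) c = 0 by rewrite dotZl dot_circ'_circ mulr0.
have ww' a k : dot (a *: sphere_tangent x k) w = 0.
  by rewrite dotZl sphere_tangent_orth mulr0.
rewrite /warped_entry -/r /polar_chart -/r -/c -/w.
case: (ord_cases i) => [->|->|[k ->]]; case: (ord_cases j) => [->|->|[l ->]];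
  rewrite ?polar_vector0 ?polar_vector1 ?polar_vectorS -/r -/c -/w.
- by rewrite inner_dpt// mul1r sqr_sqrtr// ltW// radial_form_gt0.
- by rewrite mul0r; have [] := inner_dpt_circle ginv r cc ww (cc' (cos r)).
- by rewrite mul0r; have [] := inner_dpt_sphere ginv r cc ww (ww' (sin r) l).
- by rewrite mul0r; have [] := inner_dpt_circle ginv r cc ww (cc' (cos r)).
- rewrite inner_circle// dotZl dotZr dot_circ' eqxx mul1r exprMn sqr_sqrtr ?ltW ?circle_form_gt0//.
  by rewrite mulr1 expr2.
- by rewrite mul0r; have [] := inner_circle_sphere ginv r cc ww (cc' (cos r)) (ww' (sin r) l).
- by rewrite mul0r; have [] := inner_dpt_sphere ginv r cc ww (ww' (sin r) k).
- by rewrite mul0r; have [] := inner_circle_sphere ginv r cc ww (cc' (cos r)) (ww' (sin r) k).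
- rewrite sph_eq; have [<-|kl] := eqVneq k l.
    rewrite inner_sphere// dotZl dotZr sphere_tangent_dot eqxx mul1r.
    by rewrite /= exprMn sqr_sqrtr ?ltW ?sphere_form_gt0//; ring.
  rewrite mul0r inner_sphere_sphere// dotZl dotZr sphere_tangent_dot (negbTE kl).
  by rewrite mul0r !mulr0.
Qed.

Definition line_vector x i : ambient R m.+2 :=
  match unlift ord0 i with
  | None => (2 / stereo_norm (fun k : 'I_(m.+1) => x 0 (lift ord0 k)) - 1) *:
      dpt (x 0 i0) e20 (E 0)
  | Some k => stereo_tangent (pt (x 0 i0) e20 (E 0)) line_frame
      (fun k => x 0 (lift ord0 k)) k
  end.

Let line_frame0 : line_frame ord0 = row_mx e21 0.
Proof. by rewrite /line_frame unlift_none. Qed.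
Let line_frameS k : line_frame (lift ord0 k) = row_mx 0 (E k.+1).
Proof. by rewrite /line_frame liftK. Qed.

Let line_frame_dot k l : dot (line_frame k) (line_frame l) = (k == l)%:R.
Proof.
case: (unliftP ord0 k) => [k' ->|->]; case: (unliftP ord0 l) => [l' ->|->];
  rewrite ?line_frame0 ?line_frameS ?dot_lr ?dot_rl//.
  by rewrite dot_row dot0r add0r ESS (inj_eq (@lift_inj _ _)).
by rewrite dot_row dot0r addr0 dot_e21 eqxx.
Qed.

Let pt_line_frame r k : dot (pt r e20 (E 0)) (line_frame k) = 0.
Proof.
case: (unliftP ord0 k) => [k' ->|->]; rewrite ?line_frame0 ?line_frameS dot_row dot0r.
  by rewrite dotZl E0S mulr0 addr0.
by rewrite dotZl dotC dot_e21_e20 mulr0 addr0.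
Qed.

Let dpt_line_frame r k : dot (dpt r e20 (E 0)) (line_frame k) = 0.
Proof.
case: (unliftP ord0 k) => [k' ->|->]; rewrite ?line_frame0 ?line_frameS dot_row dot0r.
  by rewrite dotZl E0S mulr0 addr0.
by rewrite dotZl dotC dot_e21_e20 mulr0 addr0.
Qed.

Let dot_pt r : dot (pt r e20 (E 0)) (pt r e20 (E 0)) = 1.
Proof. by apply/sphereE; apply: sphere_pt; [exact: dot_e20|]. Qed.

Let dpt_pt r : dot (dpt r e20 (E 0)) (pt r e20 (E 0)) = 0.
Proof. by apply/tangentE; apply: tangent_dpt; [exact: dot_e20|]. Qed.

Lemma isDv_line_chart x i : is_derive x (e i) line_chart (line_vector x i).
Proof.
have c0 p q (w : 'M[R]_(p, q)) : is_derive x (e i) (fun=> w) 0 by exact: is_derive_cst.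
have := isDv_stereo line_frame (lift ord0)
  (isDv_pt (isDv_coord x (e i) 0 i0) (c0 _ _ e20) (c0 _ _ (E 0))).
congr is_derive; rewrite !scaler0 row_mx0 addr0 !mxE /line_vector eqxx /=.
under eq_bigr do rewrite mxE eqxx /=.
case: (unliftP ord0 i) => [l ->|->].
  rewrite scale0r scaler0 add0r (bigD1 l)//= eqxx scale1r big1 ?addr0// => k kl.
  by rewrite (inj_eq (@lift_inj _ _)) (negbTE kl) scale0r.
by rewrite eqxx scale1r big1 ?addr0// => k _; rewrite scale0r.
Qed.

Lemma line_parametrization : local_parametrization line_domain line_chart.
Proof.
have oT : open (setT : set 'rV[R]_(m.+2)) by exact: openT.
have Cc k i : Ck k setT (fun x : 'rV[R]_(m.+2) => x 0 i) by exact: Ck_coord.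
split.
- have C := Ck_sum oT (fun k => Ck_mul oT (Cc 0 (lift ord0 k)) (Cc 0 (lift ord0 k))).
  rewrite (_ : line_domain = (fun x : 'rV[R]_(m.+2) =>
      \sum_(k < m.+1) x 0 (lift ord0 k) * x 0 (lift ord0 k)) @^-1` `]-oo, 1[%classic).
    by apply: open_comp; [move=> x _; exact: (Ck_continuous C)|exact: interval_open].
  by apply/seteqP; split=> x; rewrite /line_domain /= in_itv.
- move=> x _; exists setT, line_chart; split=> // k.
  have [Cs0 Cc0] := Ck_sincos oT (Cc k i0).
  apply: (Ck_mx oT) => i j; apply: Ck_stereo_entry.
  case: (split_ordP j) => l ->.
    by apply: (Ck_ext oT _ (Ck_mul oT Cc0 (Ck_cst oT k (e20 i l)))) => y _; rewrite row_mxEl [RHS]mxE.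
  by apply: (Ck_ext oT _ (Ck_mul oT Cs0 (Ck_cst oT k (E 0 i l)))) => y _; rewrite row_mxEr [RHS]mxE.
- by move=> x _; apply/sphereE; exact: stereo_sphere.
- move=> x x1; set N := stereo_norm (fun k : 'I_(m.+1) => x 0 (lift ord0 k)).
  have N0 : 0 < N := stereo_norm_gt0 _.
  have N2 : N < 2 by rewrite /N /stereo_norm (_ : 2 = 1 + 1)// ltrD2l.
  have d0 k : dot (line_vector x i0) (line_vector x (lift ord0 k)) = 0.
    rewrite /line_vector unlift_none liftK dotZl stereo_tangent_perp ?mulr0//.
  apply: orthogonal_frame_free (isDv_line_chart x) _ _ => [i|i j].
    case: (unliftP ord0 i) => [k ->|->]; rewrite /line_vector ?unlift_none ?liftK.
      by rewrite stereo_tangent_dot// eqxx mul1r mulf_neq0 ?pnatr_eq0// invr_neq0 ?expf_neq0// gt_eqF.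
    rewrite dotZl dotZr dot_dpt ?dot_e20// mulr1 mulf_neq0// subr_eq0 gt_eqF//.
      by rewrite ltr_pdivlMr// mul1r.
    by rewrite ltr_pdivlMr// mul1r.
  case: (unliftP ord0 i) => [k ->|->]; case: (unliftP ord0 j) => [l ->|->] => //.
  - rewrite (inj_eq (@lift_inj _ _)) /line_vector !liftK => kl.
    by rewrite stereo_tangent_dot// (negbTE kl) mul0r.
  - by rewrite dotC d0.
Qed.

Definition line_point (r : R) : 'rV[R]_(m.+2) := \row_j (if j == i0 then r else 0).

(** At [z = 0] the differential of stereographic projection is twice the identity. *)
Lemma line_metric (g : tensor2 R m.+2) r :
  invariant_metric g -> riemannian_metric g -> (0 < m)%N ->
  [/\ metric_coord g line_chart (line_point r) i0 i0 = radial_form g r,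
      metric_coord g line_chart (line_point r) i1 i1 = 4 * circle_form g r
    & forall k, metric_coord g line_chart (line_point r) (sph k) (sph k) = 4 * sphere_form g r].
Proof.
move=> ginv gr m0; have z0 k : line_point r 0 (lift ord0 k) = 0 by rewrite mxE.
have r0 : line_point r 0 i0 = r by rewrite mxE.
have N1 : stereo_norm (fun k : 'I_(m.+1) => line_point r 0 (lift ord0 k)) = 1.
  by rewrite /stereo_norm big1 ?addr0// => k _; rewrite z0 expr0n.
have S0 : \sum_k line_point r 0 (lift ord0 k) *: line_frame k = 0.
  by rewrite big1// => k _; rewrite z0 scale0r.
have F0 : line_chart (line_point r) = pt r e20 (E 0).
  by rewrite /line_chart /stereo N1 S0 r0 scaler0 addr0 divr1 -[2]/(1 + 1) addrK scale1r.
have V0 : line_vector (line_point r) i0 = dpt r e20 (E 0).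
  by rewrite /line_vector unlift_none N1 r0 divr1 -[2]/(1 + 1) addrK scale1r.
have VS k : line_vector (line_point r) (lift ord0 k) = 2 *: line_frame k.
  by rewrite /line_vector liftK /stereo_tangent N1 z0 mulr0 mul0r oppr0 scale0r add0r divr1.
have D i := metric_coordE g (isDv_line_chart (line_point r) i) (isDv_line_chart (line_point r) i).
have sq (p v : ambient R m.+2) : inner g p (2 *: v) (2 *: v) = 4 * inner g p v v.
  by rewrite innerZ; congr (_ * _); rewrite -natrM.
split=> [||k]; rewrite D F0 ?V0 ?VS ?sq//.
  by rewrite line_frame0.
rewrite line_frameS (inner_sphere ginv r m0 dot_e20 E00); last by rewrite dotC E0S.
by rewrite ESS eqxx mul1r.
Qed.

End Charts.

(** * Smoothness along a geodesic *)

Section LineRegularity.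
Context {R : realType} {m : nat} (I : set R).
Let V := (R^o * 'rV[R]_(m.+2))%type.
Implicit Types (f : R -> R -> R) (h : V -> R).

Lemma Ck_entry (W : normedModType R) p q k (O : set W) (h : W -> 'M[R]_(p, q)) i j :
  open O -> Ck k O h -> Ck k O (fun z => h z i j).
Proof.
move=> oO; elim: k h => [|k IH] h Ch.
  split=> // z Oz; have /= cz := Ck_continuous Ch Oz.
  exact: continuous_comp cz (@coord_continuous _ _ _ i j (h z)).
apply: (Ck_intro oO (df := fun v z => 'D_v h z i j)).
- move=> z Oz; have /= cz := Ck_continuous Ch Oz.
  exact: continuous_comp cz (@coord_continuous _ _ _ i j (h z)).
- by move=> v z Oz; have /isDv_mxP := Ck_isD v Ch Oz; exact.
- by move=> v; apply: IH; exact: Ck_D Ch.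
Qed.

Let on_line (z : R * R) : V := (z.1, line_point z.2).

Let line_pointE (r : R) : line_point r = r *: delta_mx 0 ord0 :> 'rV[R]_(m.+2).
Proof. by apply/rowP => j; rewrite !mxE eqxx /=; case: eqVneq => _; rewrite ?mulr1 ?mulr0. Qed.

Let on_line_continuous z : {for z, continuous on_line}.
Proof.
apply: (@cvg_pair _ _ _ _ (nbhs (z.1 : R^o)) (nbhs (line_point z.2))).
  exact: cvg_fst.
apply: (@cvg_comp _ _ _ snd (@line_point R m) _ (nbhs z.2)); first exact: cvg_snd.
have -> : @line_point R m = fun r => r *: delta_mx 0 ord0 by apply/funext => r.
exact: scalel_continuous.
Qed.

(* Passing to [dr f] stays within this class, with one derivative less, which makes
   an induction on [k] possible. *)
Let extends k f := forall t r, I t -> exists (O : set V) h,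
  [/\ open O, O (on_line (t, r)), Ck k O h &
      forall s x, O (on_line (s, x)) -> I s -> f s x = h (on_line (s, x))].

Let near_line (O : set V) t r : open O -> O (on_line (t, r)) ->
  \forall z \near nbhs (t, r), O (on_line z).
Proof.
move=> oO Otr; have nO : nbhs (on_line (t, r)) O by apply: open_nbhs_nbhs.
exact: (@on_line_continuous (t, r) O nO).
Qed.

Let near_line_r (O : set V) t r : open O -> O (on_line (t, r)) ->
  \forall x \near r, O (on_line (t, x)).
Proof.
move=> oO Otr; have [[A B] /= [At Br] AB] := near_line oO Otr.
apply: filterS Br => x Bx; apply: (AB (t, x)); split=> //=.
exact: nbhs_singleton At.
Qed.

Let extends_cts k f : extends k f -> cts I setT f.
Proof.
move=> H t r It _; have [Q [h [oQ Qtr Ch fh]]] := H t r It.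
rewrite (fh _ _ Qtr It).
have hl : h (on_line z) @[z --> within (I `*` setT) (nbhs (t, r))] --> h (on_line (t, r)).
  have ch := Ck_continuous Ch Qtr.
  have cl : on_line z @[z --> within (I `*` setT) (nbhs (t, r))] --> on_line (t, r).
    apply: cvg_trans (@on_line_continuous (t, r)); apply: cvg_app; exact: cvg_within.
  exact: cvg_comp cl ch.
apply: cvg_trans hl; apply: near_eq_cvg; rewrite near_withinE.
apply: filterS (near_line oQ Qtr) => -[s x] Qsx [/= Is _].
by rewrite fh.
Qed.


Let extends_isD k f : extends k.+1 f -> exists2 df, extends k df &
  forall t r, I t -> is_derive r (1 : R) (f t) (df t r).
Proof.
move=> H; pose v : V := (0, delta_mx 0 ord0).
have D t r (O : set V) h : I t -> open O -> O (on_line (t, r)) -> Ck k.+1 O h ->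
    (forall s x, O (on_line (s, x)) -> I s -> f s x = h (on_line (s, x))) ->
    is_derive r (1 : R) (f t) ('D_v h (on_line (t, r))).
  move=> It oO Otr Ch fh.
  have hD : is_derive r (1 : R) (fun x => h (on_line (t, x))) ('D_v h (on_line (t, r))).
    apply/isDv_line; have /isDv_line := Ck_isD v Ch Otr.
    congr is_derive; apply/funext => x; congr (h _).
    rewrite /on_line /v /= !line_pointE; congr (_, _) => /=.
      by rewrite /GRing.scale/= mulr0 add0r.
    by rewrite -scalerDl /GRing.scale/= mulr1.
  apply: isD_near hD; apply: filterS (near_line_r oO Otr) => x Ox.
  exact: fh.
exists (dr f) => [t r It|t r It]; have [Q [h [oQ Qtr Ch fh]]] := H t r It; last first.
  have Df := D t r Q h It oQ Qtr Ch fh.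
  by rewrite /dr (isD_derive1 Df).
exists Q, ('D_v h); split=> //; first exact: Ck_D Ch.
by move=> s x Qsx Is; rewrite /dr (isD_derive1 (D s x Q h Is oQ Qsx Ch fh)).
Qed.

Let extends_Crk k f : extends k f -> Crk I setT k f.
Proof.
elim: k f => [|k IH] f Ef; first by split=> //; exact: extends_cts Ef.
have [df Edf Df] := extends_isD Ef.
apply: (Crk_intro openT (extends_cts Ef) _ (IH _ Edf)) => t r It _.
exact: Df.
Qed.

(** Smoothness of the metric in the coordinates of [line_chart], where time runs
    through a half-open interval, restricts to the geodesic. *)
Lemma Crinf_metric_coord (g : R -> tensor2 R m.+2) i :
  smooth_on (I `*` line_domain) (fun z : V => metric_coord (g z.1) line_chart z.2) ->
  Crinf I setT (fun t r => metric_coord (g t) line_chart (line_point r) i i).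
Proof.
move=> sm k; apply: extends_Crk => t r It.
have U r' : line_domain (line_point r' : 'rV[R]_(m.+2)).
  by rewrite /line_domain /= big1// => l _; rewrite mxE expr0n.
have [|Q [h [oQ Qtr Ch gh]]] := sm (on_line (t, r)).
  by split; [exact: It|exact: U].
exists Q, (fun z => h z i i); split=> //; first exact: Ck_entry.
move=> s x Qsx Is; rewrite -gh//.
by split; [exact: Is|exact: U].
Qed.

End LineRegularity.

(** * The flow equations of the profiles *)

Section FlowEquations.
Context {R : realType} {m : nat} (m0 : (0 < m)%N) (a : R) (g : R -> tensor2 R m.+2).
Let I : set R := [set t | a <= t < 0].
Let J : set R := [set r | 0 < r < pi / 2].
Hypothesis hflow : ricci_flow I g.
Hypothesis ginv : forall t, I t -> invariant_metric (g t).
Implicit Types t r : R.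
Let mm : R := m%:R.

(** The profiles are taken as square roots of the metric on the geodesic, which
    are defined and smooth for all real [r], also beyond the singular orbits. *)
Definition radial_scale t r : R := Num.sqrt (radial_form (g t) r).
Definition circle_scale t r : R := Num.sqrt (circle_form (g t) r).
Definition sphere_scale t r : R := Num.sqrt (sphere_form (g t) r).

Local Notation chi := radial_scale.
Local Notation b := sphere_scale.
Local Notation c := circle_scale.
Local Notation psi := (circle_radius circle_scale).
Local Notation phi := (sphere_radius sphere_scale).
Local Notation i0 := (ord0 : 'I_(m.+2)).
Local Notation i1 := (lift ord0 ord0 : 'I_(m.+2)).

Let gr t : I t -> riemannian_metric (g t).
Proof. by move=> It; case: hflow => + _ _; exact. Qed.

Let line_entry t r (It : I t) := line_metric r (ginv It) (gr It) m0.

Let smooth_line : smooth_on (I `*` line_domain)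
  (fun z : R^o * 'rV[R]_(m.+2) => metric_coord (g z.1) line_chart z.2).
Proof. by case: hflow => _ + _; apply; exact: line_parametrization. Qed.

Lemma radial_scale_gt0 t r : I t -> 0 < chi t r.
Proof. by move=> It; rewrite sqrtr_gt0 radial_form_gt0//; exact: gr. Qed.
Lemma circle_scale_gt0 t r : I t -> 0 < c t r.
Proof. by move=> It; rewrite sqrtr_gt0 circle_form_gt0//; exact: gr. Qed.
Lemma sphere_scale_gt0 t r : I t -> 0 < b t r.
Proof. by move=> It; rewrite sqrtr_gt0 sphere_form_gt0//; exact: gr. Qed.

Let oT : open (setT : set R) := openT.

Lemma Crinf_radial_scale : Crinf I setT chi.
Proof.
apply: (Crinf_sqrt oT) => [t r It _|]; first by rewrite radial_form_gt0//; exact: gr.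
apply: Crinf_ext (Crinf_metric_coord i0 smooth_line) => // t r It _.
by have [] := line_entry r It.
Qed.

Let Crinf_quarter (F f : R -> R -> R) : Crinf I setT F ->
  (forall t r, I t -> F t r = 4 * f t r) -> Crinf I setT f.
Proof.
move=> CF Ff; apply: (Crinf_ext oT _ (Crinf_mul oT (Crinf_cst I oT (4^-1)) CF)) => t r It _.
by rewrite Ff// mulKf.
Qed.

Lemma Crinf_circle_scale : Crinf I setT c.
Proof.
apply: (Crinf_sqrt oT) => [t r It _|]; first by rewrite circle_form_gt0//; exact: gr.
apply: Crinf_quarter (Crinf_metric_coord i1 smooth_line) _ => t r It.
by have [] := line_entry r It.
Qed.

Lemma Crinf_sphere_scale : Crinf I setT b.
Proof.
apply: (Crinf_sqrt oT) => [t r It _|]; first by rewrite sphere_form_gt0//; exact: gr.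
apply: Crinf_quarter (Crinf_metric_coord (sph (Ordinal m0)) smooth_line) _ => t r It.
by have [_ _] := line_entry r It; exact.
Qed.

Lemma scales_even r0 : endpoint r0 ->
  [/\ parity I r0 1 chi, parity I r0 1 b & parity I r0 1 c].
Proof.
move=> e0; split=> t r It; rewrite mul1r; congr Num.sqrt; case: e0 => ->;
  rewrite ?mulr0 ?sub0r.
- exact: radial_form_opp (ginv It) r.
- exact: radial_form_refl (ginv It) r.
- exact: sphere_form_opp (ginv It) m0 r.
- exact: sphere_form_refl (ginv It) m0 r.
- exact: circle_form_opp (ginv It) r.
- exact: circle_form_refl (ginv It) r.
Qed.

Lemma radial_sphere_scale t : I t -> chi t 0 = b t 0.
Proof. by move=> It; congr Num.sqrt; exact: (radial_sphere_form (ginv It) m0). Qed.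

Lemma radial_circle_scale t : I t -> chi t (pi / 2) = c t (pi / 2).
Proof. by move=> It; congr Num.sqrt; exact: (radial_circle_form (ginv It)). Qed.

(** At times in the interior of the interval the limit within the interval is an
    ordinary derivative. *)
Lemma flow_entry t x i : a < t < 0 -> polar_domain x ->
  is_derive t (1 : R) (fun s => metric_coord (g s) polar_chart x i i)
    (- (2 * ricci (metric_coord (g t) polar_chart) x i i)).
Proof.
move=> /andP[at_ t0] Ux; case: hflow => _ _ /(_ _ _ polar_parametrization t x).
have It : I t by rewrite /I/= (ltW at_).
move=> /(_ It Ux) H; set L := - (2 *: _) in H.
pose F s := metric_coord (g s) polar_chart x i i.
have {}H : (s - t)^-1 * (F s - F t) @[s --> within I t^'] --> L i i.
  have cc : (fun M : 'M[R]_(m.+2) => M i i : R) @ nbhs (L : 'M[R]_(m.+2)) --> L i i.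
    exact: coord_continuous.
  apply: cvg_trans (cvg_comp _ _ H cc); apply: near_eq_cvg; apply: nearW => s.
  by rewrite /F /= !mxE.
have -> : - (2 * ricci (metric_coord (g t) polar_chart) x i i) = L i i by rewrite !mxE.
apply/isDP => e e0; move/cvgrPdist_le : H => /(_ e e0).
rewrite !near_withinE => /nbhs_ballP[d /= d0 Hd].
have dd : 0 < Num.min d (Num.min (t - a) (- t)).
  by rewrite !lt_min d0 subr_gt0 at_ oppr_gt0.
exists (Num.min d (Num.min (t - a) (- t))) => // h.
rewrite !lt_min => /andP[hd /andP[ha h0]].
have [->|hn] := eqVneq h 0; first by rewrite addr0 subrr mulr0 subrr !normr0 mulr0.
have := Hd (t + h); rewrite /ball/= opprD addNKr normrN => /(_ hd).
have -> : t + h != t by rewrite -subr_eq0 addrAC subrr add0r.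
have Ith : I (t + h).
  rewrite /I/=; move: ha h0; rewrite !ltr_norml => /andP[h1 _] /andP[_ h2].
  by apply/andP; split; lra.
move=> /(_ isT Ith); rewrite addrAC subrr add0r -/(F _) -/(F _) => H.
have -> : F (t + h) - F t - L i i * h = - (h * (L i i - h^-1 * (F (t + h) - F t))).
  by field.
by rewrite normrN normrM mulrC ler_wpM2r.
Qed.

Let Cchi := Crinf_radial_scale.
Let Cphi : Crinf I setT phi.
Proof.
by apply: (Crinf_mul oT) Crinf_sphere_scale; have [] := @Crinf_sincos R I setT oT.
Qed.
Let Cpsi : Crinf I setT psi.
Proof.
by apply: (Crinf_mul oT) Crinf_circle_scale; have [] := @Crinf_sincos R I setT oT.
Qed.

Let phi0 t r : I t -> J r -> 0 < phi t r.
Proof. by move=> It Jr; rewrite mulr_gt0 ?sphere_scale_gt0// sin_gt0_pihalf. Qed.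
Let psi0 t r : I t -> J r -> 0 < psi t r.
Proof.
move=> It /andP[r0 r1]; rewrite mulr_gt0 ?circle_scale_gt0//.
by rewrite cos_gt0_pihalf// r1 andbT (lt_trans _ r0)// oppr_lt0 (lt_trans r0).
Qed.

Let arcd2 (f : R -> R -> R) t r : Crinf I setT f -> I t ->
  arcd chi (arcd chi f) t r =
  (dr (dr f) t r * chi t r - dr f t r * dr chi t r) / chi t r ^+ 3.
Proof.
move=> Cf It; have c0 : chi t r != 0 by rewrite gt_eqF ?radial_scale_gt0.
have H := isD_div c0 (Crinf_isD (Crinf_dr Cf) It (Logic.I : setT r))
  (Crinf_isD Cchi It (Logic.I : setT r)).
rewrite /arcd (isD_derive1 H); by field.
Qed.

(** The Ricci curvature in a direction is the sum of the sectional curvatures of the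
    planes containing it; the factors are the squared lengths of the coordinate
    fields, the factor [4] coming from the stereographic coordinates. *)
Lemma ricci_flow_line t r : I t -> J r ->
  let h := metric_coord (g t) polar_chart in
  let A := kt chi psi t r in let B := k2 chi psi phi t r in
  let C := k1 chi phi t r in let D := kl chi phi t r in
  [/\ ricci h (line_point r) i0 i0 = chi t r ^+ 2 * (A + mm * C),
      ricci h (line_point r) i1 i1 = psi t r ^+ 2 * (A + mm * B)
    & forall k, ricci h (line_point r) (sph k) (sph k) =
        4 * phi t r ^+ 2 * (C + B + (mm - 1) * D)].
Proof.
move=> It Jr h A B C D.
have i0E (x : 'rV[R]_(m.+2)) : polar_domain x -> J (x 0 i0) by [].
have hE (x : 'rV[R]_(m.+2)) : polar_domain x -> forall i j,
    h x i j = (i == j)%:R * warped_entry (chi t) (psi t) (phi t) i x.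
  by move=> _ i j; exact: polar_metric (ginv It) (gr It) m0.
have ch0 x : chi t x != 0 by rewrite gt_eqF ?radial_scale_gt0.
have nz (x : 'rV[R]_(m.+2)) : polar_domain x ->
    [/\ chi t (x 0 i0) != 0, psi t (x 0 i0) != 0 & phi t (x 0 i0) != 0].
  by move=> /i0E Jx; split; rewrite // gt_eqF// ?psi0 ?phi0.
have D1 (x : 'rV[R]_(m.+2)) : polar_domain x ->
    [/\ is_derive (x 0 i0) (1 : R) (chi t) (dr chi t (x 0 i0)),
        is_derive (x 0 i0) (1 : R) (psi t) (dr psi t (x 0 i0))
      & is_derive (x 0 i0) (1 : R) (phi t) (dr phi t (x 0 i0))].
  by move=> _; split; apply: Crinf_isD.
have [ps0 ph0] : psi t r != 0 /\ phi t r != 0.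
  by split; rewrite gt_eqF// ?psi0 ?phi0.
have dlog f : Crinf I setT f -> f t r != 0 -> is_derive r (1 : R)
    (fun s => dr f t s / f t s) ((dr (dr f) t r * f t r - dr f t r * dr f t r) / f t r ^+ 2).
  move=> Cf f0; apply: (isD_div f0 (Crinf_isD (Crinf_dr Cf) It _) (Crinf_isD Cf It _)) => //.
have Dlog := And3 (dlog _ Cchi (ch0 r)) (dlog _ Cpsi ps0) (dlog _ Cphi ph0).
have Ux : polar_domain (line_point r : 'rV[R]_(m.+2)) by rewrite /polar_domain /= mxE.
have [oU _ _ _] := @polar_parametrization R m.
have [||-> -> RS] := ricci_warped oU hE nz D1 Ux _ _ Dlog.
- by rewrite mxE.
- by move=> k; rewrite mxE.
rewrite /A /B /C /D /kt /k1 /k2 /kl !arcd2// /arcd.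
rewrite -!/(dr _ _ _) -/mm.
move: (dr (dr psi) t r) (dr (dr phi) t r) (dr chi t r) (dr psi t r) (dr phi t r) RS.
move: (ch0 r) ps0 ph0 => ch psn phn.
move: (chi t r) (psi t r) (phi t r) ch psn phn.
move=> x1 x2 x3 n1 n2 n3 y1 y2 y3 y4 y5 RS.
split=> [||k]; [| |rewrite RS -/mm]; field; rewrite ?n1 ?n2 ?n3//.
Qed.

Let square_derivative (f : R -> R) t l : 0 < f t ->
  (forall s, I s -> 0 < f s) -> a < t < 0 ->
  is_derive t (1 : R) (fun s => f s ^+ 2) l -> is_derive t (1 : R) f (l / (2 * f t)).
Proof.
move=> ft fs /andP[at_ t0] H.
have ft2 : 0 < f t ^+ 2 by rewrite exprn_gt0.
apply: (isD_near _ (isD_eq (isD_sqrt (f := fun s => f s ^+ 2) ft2 H) _)); last by rewrite sqrtr_sqr gtr0_norm.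
have : nbhs t `]a, 0[%classic.
  by apply: open_nbhs_nbhs; split; [exact: interval_open|rewrite /= in_itv/= at_].
apply: filterS => s; rewrite /= in_itv/= => /andP[/ltW as_ s0].
by rewrite sqrtr_sqr gtr0_norm// fs// /I/= as_.
Qed.

Let Io t : a < t < 0 -> I t.
Proof. by move=> /andP[/ltW ? ?]; apply/andP. Qed.

Let flow_square (f : R -> R -> R) (k : R) t r i l : 0 < k ->
  (forall s, I s -> 0 < f s r) ->
  (forall s, I s -> metric_coord (g s) polar_chart (line_point r) i i = k * f s r ^+ 2) ->
  a < t < 0 -> J r ->
  ricci (metric_coord (g t) polar_chart) (line_point r) i i = k * f t r ^+ 2 * l ->
  is_derive t (1 : R) (f ^~ r) (- f t r * l).
Proof.
move=> k0 f0 fE tI Jr Rl; have It := Io tI.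
have Ux : polar_domain (line_point r : 'rV[R]_(m.+2)) by rewrite /polar_domain /= mxE.
have kn : k != 0 by rewrite gt_eqF.
have fn : f t r != 0 by rewrite gt_eqF ?f0.
have H : is_derive t (1 : R) (fun s => f s r ^+ 2) (- (2 * (f t r ^+ 2 * l))).
  have E := isD_mul (isD_cst t k^-1) (flow_entry i tI Ux).
  apply: (isD_near _ (isD_eq E _)); last by rewrite Rl; field.
  have : nbhs t `]a, 0[%classic.
    by apply: open_nbhs_nbhs; split; [exact: interval_open|rewrite /= in_itv].
  by apply: filterS => s; rewrite /= in_itv/= => /Io Is; rewrite fE// mulKf.
apply: isD_eq (square_derivative (f0 t It) f0 tI H) _.
by field.
Qed.

Let entry_line t r i : I t -> metric_coord (g t) polar_chart (line_point r) i i =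
  warped_entry (chi t) (psi t) (phi t) i (line_point r).
Proof. by move=> It; rewrite (polar_metric _ _ _ (ginv It) (gr It) m0) eqxx mul1r. Qed.

Lemma radial_flow t r : a < t < 0 -> J r -> is_derive t (1 : R) (chi ^~ r)
  (- chi t r * (kt chi psi t r + mm * k1 chi phi t r)).
Proof.
move=> tI Jr; apply: (flow_square (k := 1) (i := i0)) => //.
- by move=> s; exact: radial_scale_gt0.
- by move=> s Is; rewrite entry_line// /warped_entry /= mxE mul1r.
- by rewrite mul1r; have [] := ricci_flow_line (Io tI) Jr.
Qed.

Lemma circle_flow t r : a < t < 0 -> J r -> is_derive t (1 : R) (psi ^~ r)
  (- psi t r * (kt chi psi t r + mm * k2 chi psi phi t r)).
Proof.
move=> tI Jr; apply: (flow_square (k := 1) (i := i1)) => //.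
- by move=> s Is; exact: psi0.
- by move=> s Is; rewrite entry_line// /warped_entry /= mxE mul1r.
- by rewrite mul1r; have [] := ricci_flow_line (Io tI) Jr.
Qed.

Lemma sphere_flow t r : a < t < 0 -> J r -> is_derive t (1 : R) (phi ^~ r)
  (- phi t r * (k1 chi phi t r + k2 chi psi phi t r + (mm - 1) * kl chi phi t r)).
Proof.
move=> tI Jr; apply: (flow_square (k := 4) (i := sph (Ordinal m0))) => //.
- by move=> s Is; exact: phi0.
- move=> s Is; rewrite entry_line// /warped_entry /= mxE /conformal big1 => [|k _].
    by rewrite addr0 expr1n divr1 mulrC.
  by rewrite mxE expr0n.
- by have [_ _] := ricci_flow_line (Io tI) Jr; exact.
Qed.

End FlowEquations.

(** * Curvature conditions in terms of the profiles *)

Section Profiles.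
Context {R : realType} {m : nat} (a : R) (g : R -> tensor2 R m.+2).
Let J : set R := [set r | 0 < r < pi / 2].
Implicit Types t r : R.

Local Notation chi' := (radial_scale g).
Local Notation psi' := (circle_radius (circle_scale g)).
Local Notation phi' := (sphere_radius (sphere_scale g)).
Local Notation E k := (unit_vec k : 'rV[R]_(m.+2.-1)).

Let polarE r th (w : 'rV[R]_(m.+2.-1)) :
  polar r th w = pt r (cos th *: e20 + sin th *: e21) w :> ambient R m.+2.
Proof.
congr row_mx; apply/rowP => j; rewrite !mxE; congr (_ * _).
have [->|->] : j = 0 \/ j = 1 by case: j => -[|[|//]] h; [left|right]; apply/val_inj.
  by rewrite /= mulr1 mulr0 addr0.
by rewrite /= mulr1 mulr0 add0r.
Qed.

Let base_pointE r : base_point r = pt r e20 (E 0).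
Proof. by rewrite /base_point polarE cos0 sin0 scale1r scale0r addr0. Qed.

Let derivative (F : R -> ambient R m.+2) x v : is_derive x (1 : R) F v -> derive1 F x = v.
Proof. by move=> [_ <-]; rewrite derive1E. Qed.

Let cst p q x (w : 'M[R]_(p, q)) : is_derive x (1 : R) (fun=> w) 0.
Proof. exact: is_derive_cst. Qed.

Lemma chiE t r : Defs.chi (g t) r = chi' t r.
Proof.
rewrite /Defs.chi /norm_g base_pointE; congr Num.sqrt; rewrite /radial_form.
rewrite (_ : (fun r' => _) = (fun r' => pt r' e20 (E 0))); last first.
  by apply/funext => r'; rewrite -base_pointE.
have := isD_id r; move/isDv_pt => /(_ m _ _ _ _ (cst r e20) (cst r (E 0)))/derivative.
by rewrite !scaler0 row_mx0 addr0 scale1r => ->.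
Qed.

Lemma psiE t r : J r -> Defs.psi (g t) r = psi' t r.
Proof.
move=> /andP[r0 r1]; have c0 : 0 <= cos r.
  by rewrite ltW// cos_gt0_pihalf// r1 andbT (lt_trans _ r0)// oppr_lt0 (lt_trans r0).
rewrite /Defs.psi /norm_g base_pointE.
rewrite (_ : (fun th => _) = (fun th => pt r (circ th) (E 0))); last first.
  by apply/funext => th; rewrite polarE.
have := isDv_pt (isD_cst 0 r) (isDv_circ (isD_id 0)) (cst 0 (E 0)).
move=> /derivative ->; rewrite /circ /circ' sin0 cos0 oppr0 !scale0r !add0r ?addr0 !scale1r.
rewrite scaler0 (_ : row_mx (cos r *: e21) 0 = cos r *: row_mx e21 0); last first.
  by rewrite scale_row_mx scaler0.
by rewrite innerZ sqrtrM ?mulr_ge0// -expr2 sqrtr_sqr ger0_norm.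
Qed.

Lemma phiE t r : J r -> Defs.phi (g t) r = phi' t r.
Proof.
move=> Jr; have s0 : 0 <= sin r by rewrite ltW// sin_gt0_pihalf.
rewrite /Defs.phi /norm_g base_pointE.
rewrite (_ : (fun x => _) = (fun x => pt r e20 (cos x *: E 0 + sin x *: E 1))); last first.
  by apply/funext => x; rewrite polarE cos0 sin0 scale1r scale0r addr0.
have D := isDv_addv (isDv_scale (isD_cos 0) (cst 0 (E 0))) (isDv_scale (isD_sin 0) (cst 0 (E 1))).
have := isDv_pt (isD_cst 0 r) (cst 0 e20) D.
move=> /derivative ->; rewrite !scaler0 sin0 cos0 oppr0 !scale0r !add0r ?addr0 scale1r.
rewrite (_ : row_mx 0 (sin r *: E 1) = sin r *: row_mx 0 (E 1)); last first.
  by rewrite scale_row_mx scaler0.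
by rewrite innerZ sqrtrM ?mulr_ge0// -expr2 sqrtr_sqr ger0_norm.
Qed.

Let openJ : open J.
Proof.
rewrite (_ : J = `]0, pi / 2[%classic); first exact: interval_open.
by apply/seteqP; split=> x; rewrite /= in_itv.
Qed.

Let ds_arcd (F : R -> R) (G : R -> R -> R) t : (forall r, J r -> F r = G t r) ->
  forall r, J r -> ds (g t) F r = arcd chi' G t r.
Proof.
move=> FG r Jr; rewrite /ds /arcd chiE; congr (_ / _).
rewrite !derive1E; apply: near_eq_derive.
have : nbhs r J by apply: open_nbhs_nbhs.
by apply: filterS => x /FG.
Qed.

Let extend_eq (F G : R -> R) r : (forall x, J x -> F x = G x) -> extend F r = extend G r.
Proof.
move=> FG; rewrite /extend; case: ifP => Jr; first exact: FG.
have near P Q : (forall x, J x -> P x = Q x :> R) ->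
    P x @[x --> within J (nbhs r)] `=>` Q x @[x --> within J (nbhs r)].
  move=> PQ; apply: near_eq_cvg; rewrite near_withinE; apply: nearW => x Jx.
  by rewrite PQ.
congr (lim _); apply/seteqP; split; last exact: near.
by apply: near => x Jx; rewrite FG.
Qed.

(** The curvatures depend only on the profiles inside the interval, where the lengths
    measured by the metric are [chi], [cos r] and [sin r] times the scales. *)
Lemma curvature_conditionsE t : curvature_conditions (g t) <->
  forall r, 0 <= r <= pi / 2 ->
    curvature_order chi' (sphere_scale g) (circle_scale g) t r.
Proof.
have S1 := ds_arcd (@psiE t); have S2 := ds_arcd (@phiE t).
have KT r : K_top (g t) r = extend (kt chi' psi' t) r.
  apply: extend_eq => x Jx; rewrite /kt (ds_arcd (G := arcd chi' psi'))// psiE//.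
have K1 r : K1_perp (g t) r = extend (k1 chi' phi' t) r.
  apply: extend_eq => x Jx; rewrite /k1 (ds_arcd (G := arcd chi' phi'))// phiE//.
have K2 r : K2_perp (g t) r = extend (k2 chi' psi' phi' t) r.
  apply: extend_eq => x Jx.
  congr (- (_ / _)); congr (_ * _); [exact: S1|exact: S2|exact: psiE|exact: phiE].
have KL r : L_curv (g t) r = extend (kl chi' phi' t) r.
  by apply: extend_eq => x Jx; rewrite /kl S2// phiE.
by split=> H r /H; rewrite /curvature_order KT K1 K2 KL.
Qed.

End Profiles.

Theorem proposition3p2 (R : realType) (n : nat) (hn : (3 <= n)%N)
    (alpha : R) (halpha : alpha < 0) (g : R -> tensor2 R n)
    (hflow : ricci_flow [set t : R | alpha <= t < 0] g)
    (hinv : forall t : R, alpha <= t < 0 -> invariant_metric (g t))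
    (hcurv : curvature_conditions (g alpha)) :
  forall t : R, alpha <= t < 0 -> curvature_conditions (g t).
Proof.
case: n hn g hflow hinv hcurv => [|[|m]] m0 g hflow hinv hcurv t tI.
- by rewrite ltn0 in m0.
- by rewrite ltnS ltn0 in m0.
apply/curvature_conditionsE => r; move: t tI r.
apply: (curvature_order_preserved (m0 : (0 < m)%N)).
- exact: Crinf_radial_scale.
- exact: Crinf_sphere_scale.
- exact: Crinf_circle_scale.
- by move=> t r; exact: radial_scale_gt0.
- by move=> t r; exact: sphere_scale_gt0.
- by move=> t r; exact: circle_scale_gt0.
- by move=> r0; exact: scales_even.
- by move=> t; exact: radial_sphere_scale.
- by move=> t; exact: radial_circle_scale.
- by move=> t r; exact: radial_flow.
- by move=> t r; exact: circle_flow.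
- by move=> t r; exact: sphere_flow.
- exact: (curvature_conditionsE g alpha).1.
Qed.
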